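(* For every $p>3$ there is a constant $c_p>0$, depending only on $p$, with the following property. Let $\Gamma$ be a family of curves in $\mathbb{R}^2$ which contains an isometric copy of every set of the form $$G_f := \{(x,f(x)) : x\in[0,1]\},$$ where $f\colon[0,1]\to[0,1]$ is $1$-Lipschitz. That is, for every such $f$ there is an isometry $\iota$ of $\mathbb{R}^2$ with $\iota(G_f)\in\Gamma$. Then $\mathrm{mod}_p(\Gamma)\geq c_p$.
   Context: The ambient space is $\mathbb{R}^2$ with Lebesgue measure $\mathcal{L}^2$, and $\mathcal{H}^1$ denotes one-dimensional Hausdorff measure. For a family $\Gamma$ of curves and $1\le p<\infty$, the $p$-modulus is $$\mathrm{mod}_p(\Gamma)=\inf_{\rho\in\mathrm{adm}(\Gamma)}\int_{\mathbb{R}^2}\rho^p\,d\mathcal{L}^2 .$$ Here $\mathrm{adm}(\Gamma)$ is the set of all Borel functions $\rho\colon\mathbb{R}^2\to[0,\infty]$ such that $\int_\gamma\rho\,d\mathcal{H}^1\ge 1$ for every locally rectifiable $\gamma\in\Gamma$. *)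

(* Defs.v *)
From HB Require Import structures.
From mathcomp Require Import all_boot all_order all_algebra.
From mathcomp Require Import all_classical all_reals all_analysis measurable_realfun.
Set Implicit Arguments. Unset Strict Implicit. Unset Printing Implicit Defensive.
Import Order.TTheory GRing.Theory Num.Theory.
Import numFieldNormedType.Exports.
Local Open Scope classical_set_scope.
Local Open Scope ring_scope.

Section Defs.
Context {R : realType}.

(* The plane R^2 is R * R; its Euclidean distance (mathcomp's default norm
   on pairs is the max norm, so we define the Euclidean one explicitly). *)
Definition edist (x y : R * R) : R :=
  Num.sqrt ((x.1 - y.1) ^+ 2 + (x.2 - y.2) ^+ 2).

Definition plane_isometry (i : R * R -> R * R) : Prop :=
  forall x y, edist (i x) (i y) = edist x y.

Definition lip1_unit (f : R -> R) : Prop :=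
  (forall x, 0 <= x <= 1 -> 0 <= f x <= 1) /\
  (forall x y, 0 <= x <= 1 -> 0 <= y <= 1 -> `|f x - f y| <= `|x - y|).

Definition graph01 (f : R -> R) : set (R * R) :=
  [set (x, f x) | x in [set x : R | 0 <= x <= 1]].

(* diameter (Euclidean), with ediam set0 = 0 *)
Definition ediam (E : set (R * R)) : \bar R :=
  ereal_sup ([set (edist x y)%:E | x in E & y in E] `|` [set 0%E]).

Definition hausdorff1_delta (d : R) (A : set (R * R)) : \bar R :=
  ereal_inf [set (\sum_(0 <= i <oo) ediam (E i))%E | E in
    [set E : nat -> set (R * R) |
       A `<=` \bigcup_i E i /\ forall i, (ediam (E i) <= d%:E)%E]].

Definition hausdorff1 (A : set (R * R)) : \bar R :=
  ereal_sup [set hausdorff1_delta d A | d in [set d : R | 0 < d]].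

(* \int_gamma rho dH^1, for rho >= 0, via the layer-cake (Cavalieri)
   formula  \int rho d(H^1 restricted to gamma)
          = \int_0^oo H^1(gamma /\ {rho > t}) dt. *)
Definition hline_integral (gamma : set (R * R)) (rho : R * R -> \bar R) : \bar R :=
  let h := fun t : R => hausdorff1 (gamma `&` [set x | (t%:E < rho x)%E]) in
  (\int[@lebesgue_measure R]_(t in [set t : R | (0 <= t)%R]) h t)%E.

Definition polygon_length (a b : R) (g : R -> R * R) (s : seq R) : R :=
  let F := g \o nth b (a :: s) in
  \sum_(0 <= n < size s) edist (F n.+1) (F n).

Definition rectifiable_on (a b : R) (g : R -> R * R) : Prop :=
  exists M : R, forall s, itv_partition a b s -> polygon_length a b g s <= M.

Definition loc_rect_curve (gamma : set (R * R)) : Prop :=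
  exists (I : set R) (g : R -> R * R),
    is_interval I /\ I !=set0 /\ {within I, continuous g} /\ gamma = g @` I /\
    forall a b, I a -> I b -> a <= b -> rectifiable_on a b g.

Definition leb2 := ((@lebesgue_measure R) \x (@lebesgue_measure R))%E.

Definition p_admissible (Gamma : set (set (R * R))) : set (R * R -> \bar R) :=
  [set rho : R * R -> \bar R | (forall x, (0 <= rho x)%E) /\ measurable_fun setT rho /\
     forall gamma, Gamma gamma -> loc_rect_curve gamma -> (1 <= hline_integral gamma rho)%E].

Definition p_modulus (p : R) (Gamma : set (set (R * R))) : \bar R :=
  ereal_inf [set (\int[leb2]_x (rho x `^ p))%E | rho in p_admissible Gamma].

End Defs.

(* Main.v *)
(** Suppose that some admissible [rho] has small p-energy.  Outer regularity and
    Z^2-periodization of its dyadic superlevel sets replace it by a larger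
    function [r] which is lower semicontinuous, Z^2-periodic and such that, after
    any rigid motion, its mass in a subset [S] of a fixed box is at most
    [|S|^sg], where [2/3 < sg < 1 - 1/p]; here [p > 3] is used.  It then suffices to
    find one 1-Lipschitz graph on which [r] has bounded integral for all rigid
    motions simultaneously.

    This graph is a limit of functions [f_j], each the lower boundary of a strip
    of width [w_j], with [w_(j+1) = w_j ^ 2].  Inside the strip of [f_j], the
    function [f_(j+1)] follows a zigzag whose phase is piecewise linear with slopes
    [D_i] in [0, 2] that can be chosen freely on successive cells of length about
    [w_j].  On average over the phase, the new strip captures the fraction
    [w_(j+1) / w_j] of the mass of the old one, so that the mean density does not
    increase.  The method of conditional expectations, applied to an exponential
    potential summed over a finite net of motions, selects slopes that are good for
    all motions at once.  By periodicity the net may be finite, and the logarithm of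
    its cardinality is beaten by the largest density of one cell, of order
    [(w_j * w_(j+1))^sg / w_(j+1) = w_j ^ (3 sg - 2)]; this is where [sg > 2/3]
    enters.  Finally, the length of a 1-Lipschitz graph over a set is at most
    twice the measure of the set, so the line integral of [rho] along the limit
    graph is less than 1. *)

Require Import Defs.
From HB Require Import structures.
From mathcomp Require Import all_boot all_order all_algebra.
From mathcomp Require Import all_classical all_reals all_analysis measurable_realfun.
From mathcomp Require Import lra ring zify.
Set Implicit Arguments. Unset Strict Implicit. Unset Printing Implicit Defensive.
Import Order.TTheory GRing.Theory Num.Theory.
Import numFieldNormedType.Exports.
Local Open Scope classical_set_scope.
Local Open Scope ring_scope.

(** * Invariance of the planar measure under rigid motions *)

Section Invariance.
Context {R : realType}.
Local Notation mu := (@lebesgue_measure R).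
Implicit Types (f : R -> \bar R) (h : R * R -> \bar R).

(** The isometry is chosen after the graph, so one graph has to serve all motions. Moreover a graph
    is a null set, on which the p-energy puts no constraint: only masses of strips are controlled,
    and lower semicontinuity is what carries a bound on their mean densities over to the limit
    curve. The obstacle in the refinement is that the phase of the zigzag must be continuous, since
    a jump would destroy the Lipschitz bound; hence the cells cannot receive independent phases. A
    random slope in a cell does not help near the entrance of that cell, where the phase is
    inherited. It does shift the phase at the exit by the slope itself, and the slopes run over
    exactly one period of the zigzag, so that the next cell is entered at a uniform phase. Therefore
    the density of a cell is averaged over the slope of the previous cell as well, and the potential
    has to look one cell ahead. *)

Lemma measurable_shift (a : R) : measurable_fun [set: measurableTypeR R]
  ((fun x => x + a) : _ -> measurableTypeR R).
Proof. exact: measurable_funD. Qed.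

Lemma lebesgue_measure_shift (a : R) (A : set R) : measurable A ->
  pushforward mu ((fun x => x + a) : _ -> measurableTypeR R) A = mu A.
Proof.
move=> mA; apply/esym.
pose phi_mixin := isMeasurableFun.Build _ _ _ _ _ (measurable_shift a).
pose phi : {mfun measurableTypeR R >-> measurableTypeR R} :=
  HB.pack ((fun x => x + a) : _ -> measurableTypeR R) phi_mixin.
apply: (@lebesgue_measure_unique _ (pushforward mu phi)) => //= _ [[b c]] _ <-.
rewrite /pushforward/=.
rewrite (_ : _ @^-1` _ = `]b - a, c - a]%classic); last first.
  by apply/seteqP; split => x /=; rewrite !in_itv/= ltrBlDr lerBrDr.
rewrite !lebesgue_measure_itv/= !lte_fin ltrBlDr subrK; case: ifP => // _.
by rewrite -!EFinB; congr (_%:E); ring.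
Qed.

Lemma integral_shift f (a : R) : measurable_fun setT f ->
  (forall x, 0 <= f x)%E -> (\int[mu]_x f (x + a)%R = \int[mu]_x f x)%E.
Proof.
move=> mf f0.
rewrite -(@ge0_integral_pushforward _ _ _ _ _ _ (measurable_shift a) mu setT f)//.
apply: eq_measure_integral => [|mphi A mA _]; first exact: measurable_shift.
exact: (lebesgue_measure_shift a mA).
Qed.

Lemma integral_opp f : measurable_fun setT f ->
  (forall x, 0 <= f x)%E -> (\int[mu]_x f (- x)%R = \int[mu]_x f x)%E.
Proof.
move=> mf f0.
have mopp : measurable_fun [set: measurableTypeR R]
    (-%R : _ -> measurableTypeR R) by exact: oppr_measurable.
rewrite -(@ge0_integral_pushforward _ _ _ _ _ _ mopp mu setT f)//.
apply: eq_measure_integral => A mA _.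
exact: (lebesgue_measureN mA).
Qed.

Lemma leb2E h : measurable_fun setT h -> (forall z, 0 <= h z)%E ->
  (\int[leb2]_z h z = \int[mu]_x \int[mu]_y h (x, y))%E.
Proof. by move=> mh h0; rewrite fubini_tonelli1. Qed.

Lemma leb2E2 h : measurable_fun setT h -> (forall z, 0 <= h z)%E ->
  (\int[leb2]_z h z = \int[mu]_y \int[mu]_x h (x, y))%E.
Proof. by move=> mh h0; rewrite fubini_tonelli2. Qed.

Lemma measurable_fun1 (g : R -> R) : measurable_fun setT g ->
  measurable_fun [set: R * R] (fun z => g z.1).
Proof. by move=> mg; exact: measurableT_comp. Qed.

Lemma measurable_fun2 (g : R -> R) : measurable_fun setT g ->
  measurable_fun [set: R * R] (fun z => g z.2).
Proof. by move=> mg; exact: measurableT_comp. Qed.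

(** On each vertical fibre a shear is a translation, so Tonelli reduces the claim to
    [integral_shift]. *)
Lemma leb2_shear2 h (g : R -> R) : measurable_fun setT h ->
  (forall z, 0 <= h z)%E -> measurable_fun setT g ->
  (\int[leb2]_z h (z.1, (z.2 + g z.1)%R) = \int[leb2]_z h z)%E.
Proof.
move=> mh h0 mg.
have mphi : measurable_fun [set: R * R] (fun z => (z.1, z.2 + g z.1)).
  apply: measurable_fun_pair => //; apply: measurable_funD => //.
  exact: measurable_fun1.
apply: (eq_trans (leb2E (measurableT_comp mh mphi) (fun=> h0 _))).
apply: (eq_trans _ (esym (leb2E mh h0))); apply: eq_integral => x _ /=.
rewrite (integral_shift (f := fun y => h (x, y)))//.
exact: measurableT_comp.
Qed.

Lemma leb2_swap h : measurable_fun setT h -> (forall z, 0 <= h z)%E ->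
  (\int[leb2]_z h (z.2, z.1) = \int[leb2]_z h z)%E.
Proof.
move=> mh h0.
rewrite leb2E//; last by apply: (measurableT_comp mh); exact: measurable_fun_pair.
by rewrite leb2E2.
Qed.

Lemma leb2_opp2 h : measurable_fun setT h -> (forall z, 0 <= h z)%E ->
  (\int[leb2]_z h (z.1, - z.2)%R = \int[leb2]_z h z)%E.
Proof.
move=> mh h0.
have mphi : measurable_fun [set: R * R] (fun z => (z.1, - z.2)).
  apply: measurable_fun_pair => //; exact: measurable_fun2.
apply: (eq_trans (leb2E (measurableT_comp mh mphi) (fun=> h0 _))).
apply: (eq_trans _ (esym (leb2E mh h0))); apply: eq_integral => x _ /=.
rewrite (integral_opp (f := fun y => h (x, y)))//.
exact: measurableT_comp.
Qed.

Lemma leb2_opp1 h : measurable_fun setT h -> (forall z, 0 <= h z)%E ->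
  (\int[leb2]_z h (- z.1, z.2)%R = \int[leb2]_z h z)%E.
Proof.
move=> mh h0.
have mphi : measurable_fun [set: R * R] (fun z => (- z.1, z.2)).
  apply: measurable_fun_pair => //; exact: measurable_fun1.
apply: (eq_trans (leb2E2 (measurableT_comp mh mphi) (fun=> h0 _))).
apply: (eq_trans _ (esym (leb2E2 mh h0))); apply: eq_integral => x _ /=.
rewrite (integral_opp (f := fun y => h (y, x)))//.
exact: measurableT_comp.
Qed.

Lemma leb2_shear1 h (g : R -> R) : measurable_fun setT h ->
  (forall z, 0 <= h z)%E -> measurable_fun setT g ->
  (\int[leb2]_z h ((z.1 + g z.2)%R, z.2) = \int[leb2]_z h z)%E.
Proof.
move=> mh h0 mg.
have mphi : measurable_fun [set: R * R] (fun z => (z.1 + g z.2, z.2)).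
  apply: measurable_fun_pair => //; apply: measurable_funD => //.
  exact: measurable_fun2.
apply: (eq_trans (leb2E2 (measurableT_comp mh mphi) (fun=> h0 _))).
apply: (eq_trans _ (esym (leb2E2 mh h0))); apply: eq_integral => x _ /=.
rewrite (integral_shift (f := fun y => h (y, x)))//.
exact: measurableT_comp.
Qed.

End Invariance.

Section Rigid.
Context {R : realType}.
Local Notation mu := (@lebesgue_measure R).
Implicit Types (h : R * R -> \bar R).

(* The plane isometry with linear part the rotation of matrix
   [[c, -s], [s, c]], precomposed with (x, y) |-> (x, -y) when [b] is false. *)
Definition rigid (P1 P2 c s : R) (b : bool) (z : R * R) : R * R :=
  let y := if b then z.2 else - z.2 in
  (P1 + (c * z.1 - s * y), P2 + (s * z.1 + c * y)).

Lemma measurable_rigid P1 P2 c s b :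
  measurable_fun [set: R * R] (rigid P1 P2 c s b).
Proof.
have m2 : measurable_fun [set: R * R] (fun z => if b then z.2 else - z.2).
  case: b; first exact: measurable_snd.
  exact: measurableT_comp.
by apply: measurable_fun_pair; apply: measurable_funD => //;
  [apply: measurable_funB|apply: measurable_funD]; apply: measurable_funM.
Qed.

Lemma leb2_translation h a b : measurable_fun setT h ->
  (forall z, 0 <= h z)%E ->
  (\int[leb2]_z h ((a + z.1)%R, (b + z.2)%R) = \int[leb2]_z h z)%E.
Proof.
move=> mh h0; rewrite -[RHS](leb2_shear1 (g := cst a))// -[RHS](leb2_shear2 (g := cst b))//=.
  by apply: eq_integral => z _; rewrite (addrC a) (addrC b).
apply: (measurableT_comp mh); apply: measurable_fun_pair => //.
exact: measurable_funD.
Qed.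

Lemma leb2_rotation h c s : measurable_fun setT h -> (forall z, 0 <= h z)%E ->
  c ^+ 2 + s ^+ 2 = 1 ->
  (\int[leb2]_z h ((c * z.1 - s * z.2)%R, (s * z.1 + c * z.2)%R) =
   \int[leb2]_z h z)%E.
Proof.
move=> mh h0 cs.
(* For the angle pi the tangent [s / (1 + c)] of half the angle, used below, has no meaning; this
   rotation is a product of two reflections. *)
have [cN1|cN1] := eqVneq c (-1).
  have s0 : s = 0 by apply/eqP; rewrite -sqrf_eq0; apply/eqP; nra.
  rewrite -[RHS]leb2_opp1// -[RHS]leb2_opp2//=.
    by apply: eq_integral => z _; rewrite cN1 s0 !mul0r subr0 add0r !mulN1r.
  apply: (measurableT_comp mh); apply: measurable_fun_pair => //.
  exact: measurable_fun1.
have c1 : 1 + c != 0 by rewrite addrC -[1]opprK subr_eq0.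
(* A rotation of angle other than pi is a product of three shears. *)
pose t := s / (1 + c).
have ts : t * s = 1 - c.
  by apply: (mulIf c1); rewrite /t mulrAC divfK//; nra.
have t2 : t * (1 + c) = s by rewrite /t divfK.
have mshear1 (u : R) : measurable_fun [set: R * R] (fun z => (z.1 + u * z.2, z.2)).
  apply: measurable_fun_pair => //; apply: measurable_funD => //.
  exact: measurable_funM.
have mshear2 (u : R) : measurable_fun [set: R * R] (fun z => (z.1, z.2 + u * z.1)).
  apply: measurable_fun_pair => //; apply: measurable_funD => //.
  exact: measurable_funM.
have mm (u : R) : measurable_fun setT ( *%R u : R -> R) by exact: measurable_funM.
rewrite -[RHS](leb2_shear1 (g := *%R (- t)))//.
have mh1 := measurableT_comp mh (mshear1 (- t)).
rewrite -[RHS](leb2_shear2 (g := *%R s))//.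
have mh2 := measurableT_comp mh1 (mshear2 s).
rewrite -[RHS](leb2_shear1 (g := *%R (- t)))//=.
apply: eq_integral => -[x y] _ /=; congr h.
have -> : y + s * (x + - t * y) = s * x + (1 - t * s) * y by ring.
have -> : x + - t * y + - t * (s * x + (1 - t * s) * y) =
  (1 - t * s) * x - t * (1 + (1 - t * s)) * y by ring.
have -> : 1 - t * s = c by rewrite ts; ring.
by rewrite t2.
Qed.

Lemma leb2_rigid h P1 P2 c s b : measurable_fun setT h ->
  (forall z, 0 <= h z)%E -> c ^+ 2 + s ^+ 2 = 1 ->
  (\int[leb2]_z h (rigid P1 P2 c s b z) = \int[leb2]_z h z)%E.
Proof.
move=> mh h0 cs.
have main : (\int[leb2]_z h (rigid P1 P2 c s true z) = \int[leb2]_z h z)%E.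
  rewrite -[RHS](leb2_translation P1 P2)// -[RHS](leb2_rotation _ _ cs)//.
  apply: (measurableT_comp mh).
  by apply: measurable_fun_pair; apply: measurable_funD.
case: b => //; rewrite -[RHS]main -[RHS]leb2_opp2//.
exact: measurableT_comp mh (measurable_rigid _ _ _ _ _).
Qed.

Definition rigidV (P1 P2 c s : R) (b : bool) (z : R * R) : R * R :=
  let u := z.1 - P1 in let v := z.2 - P2 in
  (c * u + s * v, if b then c * v - s * u else s * u - c * v).

Lemma measurable_rigidV P1 P2 c s b :
  measurable_fun [set: R * R] (rigidV P1 P2 c s b).
Proof.
have m1 : measurable_fun [set: R * R] (fun z => z.1 - P1).
  by apply: measurable_funB.
have m2 : measurable_fun [set: R * R] (fun z => z.2 - P2).
  by apply: measurable_funB.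
apply: measurable_fun_pair.
  by apply: measurable_funD => //; apply: measurable_funM.
by case: b; apply: measurable_funB => //; apply: measurable_funM.
Qed.

Lemma rigidK P1 P2 c s b : c ^+ 2 + s ^+ 2 = 1 ->
  cancel (rigid P1 P2 c s b) (rigidV P1 P2 c s b).
Proof.
move=> cs [x y]; rewrite /rigid /rigidV/=; case: b; congr pair;
  by rewrite !(addrC P1) !(addrC P2) !addrK -[RHS]mul1r -cs; ring.
Qed.

Lemma rigidVK P1 P2 c s b : c ^+ 2 + s ^+ 2 = 1 ->
  cancel (rigidV P1 P2 c s b) (rigid P1 P2 c s b).
Proof.
move=> cs [x y]; rewrite /rigid /rigidV/=; case: b; congr pair;
  apply/eqP; rewrite eq_sym addrC -subr_eq -[eqbLHS]mul1r -cs; apply/eqP; ring.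
Qed.

End Rigid.

(** * Greedy choice of the slopes *)

Section Zigzag.
Context {R : realType}.
Local Notation mu := (@lebesgue_measure R).

(** The triangle wave of period 2: the distance to the nearest even integer. *)
Definition zigzag (x : R) : R := `|x - 2 * (Num.floor ((x + 1) / 2))%:~R|.

Lemma zigzag_floor (x : R) (k : int) : 2 * k%:~R - 1 <= x < 2 * k%:~R + 1 ->
  zigzag x = `|x - 2 * k%:~R|.
Proof.
move=> xk; rewrite /zigzag (_ : Num.floor _ = k)//.
by apply: Num.Theory.floor_def; rewrite ler_pdivlMr// ltr_pdivrMr// intrD; lra.
Qed.

Lemma floor_window (x : R) :
  let k := (Num.floor ((x + 1) / 2))%:~R in 2 * k - 1 <= x < 2 * k + 1.
Proof.
have /andP[] := Num.Theory.floor_itv ((x + 1) / 2).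
by rewrite ler_pdivlMr// ltr_pdivrMr// intrD => *; cbv zeta; lra.
Qed.

Lemma zigzag_ge0 x : 0 <= zigzag x. Proof. exact: normr_ge0. Qed.

Lemma zigzag_le1 x : zigzag x <= 1.
Proof. by rewrite ler_norml; have := floor_window x; cbv zeta; lra. Qed.

(** This exhibits [zigzag] as a minimum of 1-Lipschitz functions, whence [zigzag_lip]. *)
Lemma zigzag_le x (k : int) : zigzag x <= `|x - 2 * k%:~R|.
Proof.
have := floor_window x; rewrite /zigzag; set m := Num.floor _ => xm.
have [km|km|->//] := ltgtP k m.
- have : k%:~R + 1 <= m%:~R :> R.
    by rewrite (_ : 1 = 1%:~R)// -intrD ler_int; lia.
  by move=> ?; rewrite (ger0_norm (x := x - 2 * k%:~R)) ?ler_norml; lra.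
- have : m%:~R + 1 <= k%:~R :> R.
    by rewrite (_ : 1 = 1%:~R)// -intrD ler_int; lia.
  by move=> ?; rewrite (ler0_norm (x := x - 2 * k%:~R)) ?ler_norml; lra.
Qed.

Lemma zigzag_lip x y : `|zigzag x - zigzag y| <= `|x - y|.
Proof.
have half u v : zigzag u - zigzag v <= `|u - v|.
  rewrite {2}/zigzag lerBlDr (le_trans (zigzag_le u (Num.floor ((v + 1) / 2))))//.
  by rewrite (le_trans _ (ler_normD _ _))// addrA subrK.
by rewrite ler_norml half lerNl opprB distrC half.
Qed.

Lemma zigzag_add2 x : zigzag (x + 2) = zigzag x.
Proof.
have := floor_window x; cbv zeta => xk.
rewrite (zigzag_floor (k := Num.floor ((x + 1) / 2) + 1)) ?intrD/=; last lra.
by rewrite /zigzag mulrDr mulr1 opprD addrACA subrr addr0.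
Qed.

Lemma zigzag_continuous : continuous zigzag.
Proof.
move=> x; apply/cvgrPdist_le => e e0; near=> t.
rewrite (le_trans (zigzag_lip _ _))//; near: t.
Unshelve. all: by end_near. Qed.

Lemma measurable_zigzag : measurable_fun setT zigzag.
Proof. by apply: continuous_measurable_fun; exact: zigzag_continuous. Qed.

(* Probabilistically: [zigzag] of a uniform phase is uniform on [0, 1]. *)
Lemma zigzag_equidistributed (c a b : R) : a <= b ->
  (mu (`[c, (c + 2)%R[ `&` zigzag @^-1` `[a, b]) <= (2 * (b - a))%:E)%E.
Proof.
move=> ab; pose E := zigzag @^-1` `[a, b].
have mE : measurable E.
  by rewrite /E -[_ @^-1` _]setTI; exact: measurable_zigzag.
have := floor_window c; cbv zeta; set m := (_%:~R : R); move=> cm.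
(* The part [B] of the window beyond [2 * m + 1] is moved by one period to [B'], so that only the
   period centred at [2 * m] is left, where [zigzag x] is the distance from [x] to [2 * m]. *)
pose A := `[c, 2 * m + 1[ `&` E.
pose B := `[2 * m + 1, c + 2[ `&` E.
pose B' := `[2 * m - 1, c[ `&` E.
have mA : measurable A by exact: measurableI.
have mB : measurable B by exact: measurableI.
have mB' : measurable B' by exact: measurableI.
have BB' : mu B' = mu B.
  rewrite -(lebesgue_measure_shift (- 2) mB')/pushforward/=; congr (mu _).
  apply/seteqP; split => x /=; rewrite /B /B' /E/= !in_itv/=.
    rewrite -(zigzag_add2 (x + -2)) subrK => -[xx ->]; split => //; lra.
  rewrite -(zigzag_add2 (x + -2)) subrK => -[xx ->]; split => //; lra.
have AB' : [disjoint A & B'].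
  apply/disj_setPS => x [[/= + _] [/= + _]]; rewrite !in_itv/=; lra.
apply: (@le_trans _ _ (mu (A `|` B))).
  apply: le_measure; rewrite ?inE; [exact: measurableI|exact: measurableU|].
  move=> x /= [xc Ex]; have [xm|xm] := ltP x (2 * m + 1); [left|right];
    split => //=; rewrite in_itv/=; move: xc; rewrite in_itv/=; lra.
apply: (le_trans (measureU2 _ _ _)) => //.
rewrite -[X in (_ + X)%E]BB' -measureU//; last by apply/disj_set2P.
apply: (@le_trans _ _ (mu (`[2 * m + a, 2 * m + b] `|` `[2 * m - b, 2 * m - a]))).
  apply: le_measure; rewrite ?inE; [exact: measurableU|exact: measurableU|].
  move=> x /= xAB.
  have xm : 2 * m - 1 <= x < 2 * m + 1.
    by move: xAB => [] [/= + _]; rewrite in_itv/=; lra.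
  have : a <= zigzag x <= b by move: xAB => [] [/= _]; rewrite /E/= in_itv.
  rewrite (zigzag_floor xm) !in_itv/=; case: ger0P => ? ?; [left|right]; lra.
apply: (le_trans (measureU2 _ _ _)) => //.
rewrite -[leLHS]/(mu `[(2 * m + a)%R, (2 * m + b)%R] + mu `[(2 * m - b)%R, (2 * m - a)%R])%E.
rewrite !lebesgue_measure_itv/= !lte_fin.
by do 2 case: ifP => ?; rewrite -?EFinB -?EFinD ?adde0 ?add0e lee_fin; lra.
Qed.

End Zigzag.

Section GreedyChoice.
Context {R : realType}.
Local Notation mu := (@lebesgue_measure R).

(** The density of a uniform slope, not normalized: its mass 2 explains the factors 2 and 4 in the
    bounds on means. *)
Definition ind02 (x : R) : R := \1_(`[0, 2[ : set R) x.

Lemma ind02E x : ind02 x = ((0 <= x < 2)%R : nat)%:R.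
Proof.
rewrite /ind02 indicE; congr (_%:R); congr nat_of_bool.
by apply/idP/idP; rewrite inE/= in_itv.
Qed.

Lemma ind02_ge0 x : 0 <= ind02 x.
Proof. by rewrite /ind02 indicE. Qed.

Lemma measurable_ind02 : measurable_fun setT ind02.
Proof. exact: measurable_indic. Qed.

Lemma integral_ind02 : (\int[mu]_x (ind02 x)%:E = 2%:E)%E.
Proof.
transitivity (mu `[0, 2[%classic); first by rewrite /ind02 integral_indic// setIT.
by rewrite lebesgue_measure_itv/= lte_fin ltr0n/= sube0.
Qed.

(** If [F] exceeded [c] on all of [[0, 2[], then [F - c] would be positive there while its integral
    is at most 0. *)
Lemma mean_value_choice (F : R -> R) (c : R) : measurable_fun setT F ->
  (forall x, 0 <= F x) ->
  (\int[mu]_x (ind02 x * F x)%:E <= (2 * c)%:E)%E ->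
  exists x, 0 <= x < 2 /\ F x <= c.
Proof.
move=> mF F0 intF; apply: contrapT => /forallNP noF.
have Fc x : 0 <= x < 2 -> c < F x.
  by move=> x02; rewrite ltNge; apply/negP => Fxc; exact: (noF x).
have c0 : 0 <= c.
  have : (0 <= (2 * c)%:E)%E.
    apply: le_trans intF; apply: integral_ge0 => x _.
    by rewrite lee_fin mulr_ge0// ind02_ge0.
  by rewrite lee_fin pmulr_rge0.
pose g x := ind02 x * (F x - c).
have mg : measurable_fun setT g.
  by apply: measurable_funM; [exact: measurable_ind02|exact: measurable_funB].
have g0 x : 0 <= g x.
  rewrite /g ind02E; have [/Fc|_] := boolP (0 <= x < 2); last by rewrite mul0r.
  by rewrite mul1r subr_ge0 => /ltW.
have intE : (\int[mu]_x (ind02 x * F x)%:E =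
    \int[mu]_x (g x)%:E + (2 * c)%:E)%E.
  under eq_integral => x _.
    rewrite (_ : ind02 x * F x = g x + ind02 x * c); last by rewrite /g; ring.
    rewrite EFinD; over.
  rewrite ge0_integralD//=; last 4 first.
  - by move=> x _; rewrite lee_fin.
  - exact/measurable_EFinP.
  - by move=> x _; rewrite lee_fin mulr_ge0// ind02_ge0.
  - by apply/measurable_EFinP; apply: measurable_funM => //; exact: measurable_ind02.
  congr (_ + _)%E; under eq_integral do rewrite EFinM.
  rewrite ge0_integralZr//; last first.
  - by move=> x _; rewrite lee_fin ind02_ge0.
  - by apply/measurable_EFinP; exact: measurable_ind02.
  by rewrite integral_ind02.
have int0 : (\int[mu]_x (g x)%:E = 0)%E.
  apply/eqP; rewrite eq_le integral_ge0 ?andbT//; last by move=> x _; rewrite lee_fin.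
  by move: intF; rewrite intE -[X in (_ <= X)%E]add0e leeD2rE.
have : ae_eq mu setT (EFin \o g) (cst 0%E).
  apply/(ae_eq_integral_abs mu measurableT); first exact/measurable_EFinP.
  by rewrite -[RHS]int0; apply: eq_integral => x _ /=; rewrite ger0_norm.
move=> [N [mN N0 gN]].
have : (mu (`[0%R, 2%R[) <= mu N)%E.
  apply: le_measure; rewrite ?inE// => x /=; rewrite in_itv/= => x02.
  apply: gN => /= /(_ I) [gx0]; have := Fc x x02.
  by move: gx0; rewrite /g ind02E x02 mul1r; lra.
by rewrite N0 lebesgue_measure_itv/= lte_fin ltr0n/= sube0 lee_fin leNgt ltr0n.
Qed.

(** Inverting [1 - y <= expR (- y)] gives [expR y <= (1 - y)^-1], which lies below the affine
    function because [(1 + k) * y <= k]. *)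
Lemma expR_le_affine (k y : R) : 0 < k <= 1 -> 0 <= y -> 2 * y <= k ->
  expR y <= 1 + (1 + k) * y.
Proof.
move=> /andP[k0 k1] y0 yk.
have y1 : 0 < 1 - y by lra.
have : 1 - y <= expR (- y) by rewrite -(opprK 1) opprK; exact: expR_ge1Dx.
rewrite expRN => h.
have : expR y <= (1 - y)^-1.
  by rewrite -[leLHS]invrK lef_pV2 ?posrE// invr_gt0 expR_gt0.
move=> /le_trans; apply; rewrite -[leLHS]mul1r ler_pdivrMr//; nra.
Qed.

(** Since [lam * V] is small, the exponential is affine up to the factor [1 + k]. Thus it suffices
    to average [V] itself, and [1 + y <= expR y] leads back to exponentials. *)
Lemma exponential_choice (T : finType) (q v : T -> R) (V : T -> R -> R)
    (M lam k : R) :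
  0 < k <= 1 -> 0 < lam -> 2 * (lam * M) <= k ->
  (forall t, 0 <= q t) -> (forall t, measurable_fun setT (V t)) ->
  (forall t x, 0 <= V t x <= M) ->
  (forall t, (\int[mu]_x (ind02 x * V t x)%:E <= (2 * v t)%:E)%E) ->
  exists x, 0 <= x < 2 /\
    \sum_t q t * expR (lam * V t x) <= \sum_t q t * expR ((1 + k) * (lam * v t)).
Proof.
move=> k01 lam0 lamM q0 mV V0M intV.
have k0 : 0 < 1 + k by case/andP: k01 => *; lra.
have V0 t x : 0 <= V t x by have /andP[] := V0M t x.
have [x [x02 xle]] : exists x, 0 <= x < 2 /\
    \sum_t q t * V t x <= \sum_t q t * v t.
  apply: mean_value_choice.
  - by apply: measurable_sum => t; exact: measurable_funM.
  - by move=> x; apply: sumr_ge0 => t _; rewrite mulr_ge0.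
  under eq_integral => x _.
    rewrite mulr_sumr -sumEFin.
    under eq_bigr do rewrite mulrCA EFinM.
    over.
  rewrite ge0_integral_sum//; last 2 first.
  - move=> t; apply/measurable_funeM/measurable_EFinP; apply: measurable_funM.
      exact: measurable_ind02.
    exact: mV.
  - by move=> t x _; rewrite -EFinM lee_fin !mulr_ge0// ind02_ge0.
  rewrite mulr_sumr -sumEFin; apply: lee_sum => t _.
  rewrite ge0_integralZl//; last 3 first.
  - by apply/measurable_EFinP; apply: measurable_funM;
      [exact: measurable_ind02|exact: mV].
  - by move=> x _; rewrite lee_fin !mulr_ge0// ind02_ge0.
  - by rewrite lee_fin.
  by rewrite mulrCA EFinM; apply: lee_wpmul2l; rewrite ?lee_fin.
exists x; split => //.
apply: (@le_trans _ _ (\sum_t q t * (1 + (1 + k) * (lam * V t x)))).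
  apply: ler_sum => t _; apply: ler_wpM2l => //; apply: expR_le_affine => //.
    by rewrite mulr_ge0// ltW.
  apply: le_trans lamM; rewrite ler_pM2l// ler_pM2l//.
  by have /andP[] := V0M t x.
apply: (@le_trans _ _ (\sum_t q t * (1 + (1 + k) * (lam * v t)))); last first.
  by apply: ler_sum => t _; apply: ler_wpM2l => //; exact: expR_ge1Dx.
have E (w : T -> R) : \sum_t q t * (1 + (1 + k) * (lam * w t)) =
    \sum_t q t + ((1 + k) * lam) * \sum_t q t * w t.
  by rewrite mulr_sumr -big_split/=; apply: eq_bigr => t _; ring.
by rewrite !E lerD2l ler_pM2l// mulr_gt0.
Qed.

End GreedyChoice.

Lemma measurable_integral2 (R : realType) (h : R * R -> \bar R) :
  measurable_fun setT h -> (forall z, 0 <= h z)%E ->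
  measurable_fun setT (fun x => \int[@lebesgue_measure R]_y h (x, y))%E.
Proof.
move=> mh h0.
exact: (@measurable_fun_fubini_tonelli_F _ _ _ _ R (@lebesgue_measure R) h mh h0).
Qed.

Section GreedySequence.
Context {R : realType} (T : finType).
Local Notation mu := (@lebesgue_measure R).
(* [Y i t a d] is the density collected in cell [i] by the motion [t] when the phase
   enters the cell at [a] with slope [d], and [m i t] bounds its mean over a uniform
   previous slope [x] and a uniform slope [y]. *)
Variables (Y : nat -> T -> R -> R -> R) (m : nat -> T -> R) (b k : R).
Hypothesis k01 : 0 < k <= 1.
Hypothesis b0 : 0 < b.
Hypothesis mY : forall i t, measurable_fun [set: R * R] (fun z => Y i t z.1 z.2).
Hypothesis Yb : forall i t a d, 0 <= Y i t a d <= b.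
Hypothesis intY : forall i t a,
  (\int[mu]_x \int[mu]_y (ind02 x * (ind02 y * Y i t (a + x) y))%:E <=
   (4 * m i t)%:E)%E.

Let Z i t a := fine (\int[mu]_y (ind02 y * Y i t a y)%:E)%E / 2.

Let mY1 i t a : measurable_fun setT (Y i t a).
Proof.
have := mY i t; rewrite -[Y i t a]/((fun z : R * R => Y i t z.1 z.2) \o (pair a)).
by move=> h; apply: measurableT_comp => //; exact: measurable_fun_pair.
Qed.

Let mYind i t : measurable_fun [set: R * R]
  (fun z => (ind02 z.2 * Y i t z.1 z.2)%:E).
Proof.
apply/measurable_EFinP; apply: measurable_funM; last exact: mY.
exact: (measurable_fun2 measurable_ind02).
Qed.

Let Yind_ge0 i t (z : R * R) : (0 <= (ind02 z.2 * Y i t z.1 z.2)%:E)%E.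
Proof. by rewrite lee_fin mulr_ge0 ?ind02_ge0//; have /andP[] := Yb i t z.1 z.2. Qed.

Let intYZ i t a : (\int[mu]_y (ind02 y * Y i t a y)%:E = (2 * Z i t a)%:E)%E.
Proof.
rewrite /Z mulrC divfK// fineK// ge0_fin_numE; last first.
  by apply: integral_ge0 => y _; exact: (Yind_ge0 i t (a, y)).
apply: (@le_lt_trans _ _ (\int[mu]_y ((ind02 y)%:E * b%:E))%E).
  apply: ge0_le_integral => //.
  - by move=> y _; exact: (Yind_ge0 i t (a, y)).
  - apply/measurable_EFinP; apply: measurable_funM; last exact: mY1.
    exact: measurable_ind02.
  - by apply: emeasurable_funM => //; apply/measurable_EFinP; exact: measurable_ind02.
  - move=> y _; rewrite -EFinM lee_fin ler_wpM2l ?ind02_ge0//.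
    by have /andP[] := Yb i t a y.
rewrite ge0_integralZr//.
- by rewrite integral_ind02 -EFinM ltry.
- by apply/measurable_EFinP; exact: measurable_ind02.
- by move=> y _; rewrite lee_fin ind02_ge0.
- by rewrite lee_fin ltW.
Qed.

Let Zb i t a : 0 <= Z i t a <= b.
Proof.
have := intYZ i t a => E.
have : (0 <= (2 * Z i t a)%:E <= (2 * b)%:E)%E.
  rewrite -E; apply/andP; split.
    by apply: integral_ge0 => y _; exact: (Yind_ge0 i t (a, y)).
  apply: (@le_trans _ _ (\int[mu]_y ((ind02 y)%:E * b%:E))%E).
    apply: ge0_le_integral => //.
    - by move=> y _; exact: (Yind_ge0 i t (a, y)).
    - apply/measurable_EFinP; apply: measurable_funM; last exact: mY1.
      exact: measurable_ind02.
    - by apply: emeasurable_funM => //; apply/measurable_EFinP; exact: measurable_ind02.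
    - move=> y _; rewrite -EFinM lee_fin ler_wpM2l ?ind02_ge0//.
      by have /andP[] := Yb i t a y.
  rewrite ge0_integralZr//.
  - by rewrite integral_ind02 -EFinM.
  - by apply/measurable_EFinP; exact: measurable_ind02.
  - by move=> y _; rewrite lee_fin ind02_ge0.
  - by rewrite lee_fin ltW.
by rewrite !lee_fin pmulr_rge0// ler_pM2l.
Qed.

Let mZ i t : measurable_fun setT (Z i t).
Proof.
apply: measurable_funM => //; apply: measurableT_comp.
  exact: fine_measurable.
exact: (measurable_integral2 (mYind i t) (Yind_ge0 i t)).
Qed.

Let intZ i t a : (\int[mu]_x (ind02 x * Z i t (a + x)%R)%:E <= (2 * m i t)%:E)%E.
Proof.
have := intY i t a.
under eq_integral => x _.
  rewrite (_ : (\int[mu]_y _)%E = (2%:E * (ind02 x * Z i t (a + x)%R)%:E)%E).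
  over.
  under eq_integral do rewrite EFinM.
  rewrite ge0_integralZl//.
  - by rewrite intYZ -!EFinM; congr EFin; ring.
  - apply/measurable_EFinP; apply: measurable_funM; last exact: mY1.
    exact: measurable_ind02.
  - by move=> y _; exact: (Yind_ge0 i t (a + x, y)).
  - by rewrite lee_fin ind02_ge0.
rewrite ge0_integralZl//.
- rewrite (_ : 4 * m i t = 2 * (2 * m i t)); last ring.
  by rewrite EFinM lee_pmul2l.
- apply/measurable_EFinP; apply: measurable_funM.
    exact: measurable_ind02.
  apply: (measurableT_comp (mZ i t)).
  exact: measurable_funD.
- move=> x _; rewrite lee_fin mulr_ge0 ?ind02_ge0//.
  by have /andP[] := Zb i t (a + x).
Qed.

(* In the potential [W n], the cells already decided count with their density [Y],
   the next cell with its mean [Z] over its own slope, and the mean bounds [m] are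
   subtracted; some choice of each slope does not increase [W]. *)
Let lam := k / (6 * b).
Let S n (D : nat -> R) t := \sum_(i < n) Y i t (\sum_(j < i) D j) (D i).
Let W n (D : nat -> R) := \sum_t expR (lam *
  (S n D t + (1 + k) * Z n t (\sum_(j < n) D j)
   - (1 + k) ^+ 2 * \sum_(i < n) m i.+1 t)).

(** Choosing the slope of cell [n] turns [Z n] into [Y n] and [m n.+1] into [Z n.+1], each time at
    the price of a factor [1 + k]. Every density undergoes both replacements, hence the square. *)
Let potential n : exists D : nat -> R, (forall i, 0 <= D i < 2) /\
  W n D <= W 0 (fun=> 0).
Proof.
have /andP[k0 k1] := k01.
have lam0 : 0 < lam by rewrite divr_gt0// mulr_gt0.
elim: n => [|n [D [D02 WD]]].
  by exists (fun=> 0); split => // i; rewrite lexx ltr0n.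
pose a := \sum_(j < n) D j.
pose q t := expR (lam * (S n D t - (1 + k) ^+ 2 * \sum_(i < n.+1) m i.+1 t)).
pose V t d := Y n t a d + (1 + k) * Z n.+1 t (a + d).
pose v t := Z n t a + (1 + k) * m n.+1 t.
have [d [d02 dle]] : exists d, 0 <= d < 2 /\
    \sum_t q t * expR (lam * V t d) <= \sum_t q t * expR ((1 + k) * (lam * v t)).
  (* [V] is at most [b + (1 + k) * b <= 3 * b], and [lam] is such that [2 * (lam * (3 * b)) = k]. *)
  apply: (@exponential_choice _ _ q v V (3 * b)) => //.
  - rewrite /lam (_ : 2 * (_ * _) = k)//; field.
    by rewrite gt_eqF.
  - by move=> t; exact: expR_ge0.
  - move=> t; apply: measurable_funD => //; apply: measurable_funM => //.
    by apply: (measurableT_comp (mZ n.+1 t)); exact: measurable_funD.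
  - move=> t x; rewrite /V; have /andP[Y0 Yle] := Yb n t a x.
    have /andP[Z0 Zle] := Zb n.+1 t (a + x).
    by apply/andP; split; nra.
  - move=> t.
    under eq_integral => x _.
      rewrite (_ : ind02 x * V t x = ind02 x * Y n t a x +
         (1 + k) * (ind02 x * Z n.+1 t (a + x))); last by rewrite /V; ring.
      rewrite EFinD (EFinM (1 + k)); over.
    have mZa : measurable_fun setT (fun x : R => (ind02 x * Z n.+1 t (a + x))%:E).
      apply/measurable_EFinP; apply: measurable_funM; first exact: measurable_ind02.
      by apply: (measurableT_comp (mZ n.+1 t)); exact: measurable_funD.
    have Za0 (x : R) : (0 <= (ind02 x * Z n.+1 t (a + x))%:E)%E.
      by rewrite lee_fin mulr_ge0 ?ind02_ge0//; have /andP[] := Zb n.+1 t (a + x).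
    rewrite ge0_integralD//; last 4 first.
    + by move=> y _; exact: (Yind_ge0 n t (a, y)).
    + apply/measurable_EFinP; apply: measurable_funM; first exact: measurable_ind02.
      exact: mY1.
    + by move=> x _; rewrite mule_ge0// lee_fin addr_ge0// ltW.
    + exact: measurable_funeM.
    rewrite intYZ ge0_integralZl//; last by rewrite lee_fin addr_ge0// ltW.
    rewrite (_ : 2 * v t = 2 * Z n t a + (1 + k) * (2 * m n.+1 t)); last first.
      by rewrite /v; ring.
    rewrite [leRHS]EFinD (EFinM (1 + k)); apply: leeD2l.
    by apply: lee_wpmul2l; [rewrite lee_fin addr_ge0// ltW|exact: intZ].
pose D' i := if (i < n)%N then D i else d.
have D'D i : (i <= n)%N -> \sum_(j < i) D' j = \sum_(j < i) D j.
  by move=> lein; apply: eq_bigr => j _; rewrite /D' (leq_trans (ltn_ord j)).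
have D'n : D' n = d by rewrite /D' ltnn.
have SD' t : S n.+1 D' t = S n D t + Y n t a d.
  rewrite /S big_ord_recr/= D'D// D'n; congr (_ + _).
  by apply: eq_bigr => i _; rewrite D'D 1?ltnW// /D' ltn_ord.
have aD' : \sum_(j < n.+1) D' j = a + d.
  by rewrite big_ord_recr/= D'D// D'n.
exists D'; split; first by move=> i; rewrite /D'; case: ifP.
apply: le_trans WD; rewrite /W.
rewrite (_ : \sum_t _ = \sum_t q t * expR (lam * V t d)); last first.
  apply: eq_bigr => t _; rewrite /q -expRD SD' aD' /V; congr expR; ring.
apply: (le_trans dle); apply: ler_sum => t _.
rewrite /q -expRD big_ord_recr/= /v -/a le_eqVlt; apply/orP; left; apply/eqP.
by congr expR; ring.
Qed.

(** Each term of the potential is at most the whole sum, hence at most [#|T| * expR 1]. The additive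
    error is the logarithm of this bound divided by [lam]. *)
Lemma greedy_choice n : exists D : nat -> R, (forall i, 0 <= D i < 2) /\
  forall t, \sum_(i < n) Y i t (\sum_(j < i) D j) (D i) <=
    (1 + k) ^+ 2 * \sum_(i < n) m i.+1 t + 6 * b / k * (1 + ln #|T|%:R).
Proof.
have /andP[k0 k1] := k01.
have lam0 : 0 < lam by rewrite divr_gt0// mulr_gt0.
have [D [D02 WD]] := potential n; exists D; split => // t.
have N0 : 0 < #|T|%:R :> R by rewrite ltr0n; apply/card_gt0P; exists t.
(* Cell 0 has no previous slope, so its mean is only bounded by [b]. As
   [lam * (2 * b) = k / 3 <= 1], this costs at most a factor [expR 1]. *)
have W0 : W 0 (fun=> 0) <= #|T|%:R * expR 1.
  rewrite mulr_natl -sumr_const; apply: ler_sum => u _.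
  rewrite ler_expR /S !big_ord0 add0r mulr0 subr0.
  have /andP[Z0 Zle] := Zb 0 u 0.
  have : lam * ((1 + k) * Z 0 u 0) <= lam * (2 * b).
    by rewrite ler_pM2l//; nra.
  move=> /le_trans; apply; rewrite /lam.
  have -> : k / (6 * b) * (2 * b) = k / 3 by field; rewrite gt_eqF.
  by lra.
have : lam * (S n D t + (1 + k) * Z n t (\sum_(j < n) D j)
   - (1 + k) ^+ 2 * \sum_(i < n) m i.+1 t) <= 1 + ln #|T|%:R.
  rewrite -ler_expR expRD lnK ?posrE// [leRHS]mulrC.
  apply: le_trans (le_trans WD W0).
  by rewrite /W (bigD1 t)//= lerDl sumr_ge0// => u _; exact: expR_ge0.
rewrite -ler_pdivlMl// (_ : lam^-1 = 6 * b / k); last by rewrite /lam invf_div.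
have : 0 <= (1 + k) * Z n t (\sum_(j < n) D j).
  by rewrite mulr_ge0//; [lra|have /andP[] := Zb n t (\sum_(j < n) D j)].
by rewrite /S; lra.
Qed.

End GreedySequence.

(** * Strips and moved masses *)

Section Tonelli.
Context {R : realType}.
Local Notation mu := (@lebesgue_measure R).

Lemma leb2_setX (A B : set R) : measurable A -> measurable B ->
  (leb2 (A `*` B) = mu A * mu B)%E.
Proof. by move=> mA mB; rewrite /leb2 product_measure1E. Qed.

Lemma leb2_sigma_finite : sigma_finite setT (@leb2 R).
Proof.
have /sigma_finiteP[F [TF ndF Foo]] := sigma_finiteT mu.
exists (fun n => F n `*` F n).
  rewrite -setXTT TF predeqE => -[x y]; split.
    move=> [/= [n _ Fnx] [k _ Gky]]; exists (maxn n k) => //; split.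
    - by move: x Fnx; exact/subsetPset/ndF/leq_maxl.
    - by move: y Gky; exact/subsetPset/ndF/leq_maxr.
  by move=> [n _ []/= ? ?]; split; exists n.
move=> k; have [? ?] := Foo k.
split; first exact: measurableX.
by rewrite leb2_setX// lte_mul_pinfty// ge0_fin_numE.
Qed.

HB.instance Definition _ := Measure.on (@leb2 R).
HB.instance Definition _ := Measure_isSigmaFinite.Build _ _ _ (@leb2 R)
  leb2_sigma_finite.

(** In the application one plane carries a pair of consecutive slopes and the other one the points
    of the strip. *)
Lemma tonelli22 (F : (R * R) * (R * R) -> \bar R) :
  measurable_fun setT F -> (forall z, 0 <= F z)%E ->
  (\int[leb2]_x \int[leb2]_y F (x, y) = \int[leb2]_y \int[leb2]_x F (x, y))%E.
Proof. by move=> mF F0; rewrite fubini_tonelli. Qed.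

Lemma measurable_integral22 (F : (R * R) * (R * R) -> \bar R) :
  measurable_fun setT F -> (forall z, 0 <= F z)%E ->
  measurable_fun setT (fun x => \int[leb2]_y F (x, y))%E.
Proof.
move=> mF F0.
exact: (@measurable_fun_fubini_tonelli_F _ _ _ _ R (@leb2 R) F mF F0).
Qed.

End Tonelli.

Section Strips.
Context {R : realType}.
Local Notation mu := (@lebesgue_measure R).

Lemma measurable_boolset d (T : measurableType d) (b : T -> bool) :
  measurable_fun setT b -> measurable [set x | b x].
Proof.
by move=> mb; rewrite -[X in measurable X]setTI; exact: (mb measurableT [set true]).
Qed.

(** The linear part is a point of the unit circle with an orientation. Nearby parameters then give
    nearby maps on bounded sets, and modulo integer translations the parameters stay bounded. *)
Record motion := Motion {
  mx : R; my : R; mc : R; ms : R; mb : bool;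
  mcs : mc ^+ 2 + ms ^+ 2 = 1 }.

Definition move q := rigid (mx q) (my q) (mc q) (ms q) (mb q).
Definition unmove q := rigidV (mx q) (my q) (mc q) (ms q) (mb q).

Lemma moveK q : cancel (move q) (unmove q). Proof. exact/rigidK/mcs. Qed.
Lemma unmoveK q : cancel (unmove q) (move q). Proof. exact/rigidVK/mcs. Qed.

Lemma measurable_move q : measurable_fun setT (move q).
Proof. exact: measurable_rigid. Qed.

Lemma measurable_unmove q : measurable_fun setT (unmove q).
Proof. exact: measurable_rigidV. Qed.

Lemma leb2_move (h : R * R -> \bar R) q : measurable_fun setT h ->
  (forall z, 0 <= h z)%E ->
  (\int[leb2]_z h (move q z) = \int[leb2]_z h z)%E.
Proof. by move=> mh h0; exact: (leb2_rigid _ _ _ mh h0 (mcs q)). Qed.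

Definition strip (xl xr lo hi : R) (f : R -> R) : set (R * R) :=
  [set z | [&& xl <= z.1, z.1 <= xr, lo <= z.2 - f z.1 & z.2 - f z.1 <= hi]].

Lemma measurable_strip xl xr lo hi f : measurable_fun setT f ->
  measurable (strip xl xr lo hi f).
Proof.
move=> mf; have mf1 := measurable_fun1 mf.
have mg : measurable_fun [set: R * R] (fun z => z.2 - f z.1).
  exact: measurable_funB.
by apply: measurable_boolset; do !apply: measurable_and;
  apply: measurable_fun_ler.
Qed.

(** Every vertical section of [S] lies in an interval of length [d]. *)
Lemma strip_area (S : set (R * R)) (xl xr d : R) (g : R -> R) :
  xl <= xr -> 0 <= d -> measurable S -> S `<=` strip xl xr 0 d g ->
  (leb2 S <= ((xr - xl) * d)%:E)%E.
Proof.
move=> x0 d0 mS Sg; rewrite /leb2 /product_measure1.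
apply: (@le_trans _ _ (\int[mu]_x ((\1_(`[xl, xr] : set R) x)%:E * d%:E))%E).
  apply: ge0_le_integral => //.
  - exact: measurable_fun_xsection.
  - by apply: emeasurable_funM => //; apply/measurable_EFinP; exact: measurable_indic.
  move=> x _ /=; rewrite indicE.
  have [xlr|xlr] := boolP (x \in `[xl, xr]%classic).
    rewrite mul1e; apply: (@le_trans _ _ (mu `[g x, g x + d])).
      apply: le_measure; rewrite ?inE//; first exact: measurable_xsection.
      move=> y; rewrite /xsection/= inE => /Sg /and4P[_ _ /=].
      by rewrite in_itv/=; lra.
    rewrite lebesgue_measure_itv/= lte_fin; case: ifP => _.
      by rewrite -EFinB addrAC subrr add0r.
    by rewrite lee_fin.
  rewrite mul0e (_ : xsection S x = set0) ?measure0//.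
  apply/seteqP; split => y //; rewrite /xsection/= inE => /Sg /and4P[/= h1 h2 _ _].
  by move: xlr; rewrite notin_setE/= in_itv/= h1 h2; case.
rewrite ge0_integralZr//; last first.
  by apply/measurable_EFinP; exact: measurable_indic.
rewrite (_ : (\int[_]_x _)%E = mu `[xl, xr]); last by rewrite integral_indic// setIT.
rewrite lebesgue_measure_itv/= lte_fin; case: ifP => [_|]; first by rewrite -EFinB.
by move/negbT; rewrite -leNgt => ?; rewrite mul0e lee_fin; nra.
Qed.

(** For fixed [p.2] and any position [t] in the cell, the previous slope [p.1] alone moves the phase
    uniformly through one period. The integral over [p.2] only contributes its mass 2. *)
Lemma strip_equidistributed (c v h w t : R) : 0 < h -> 0 <= w ->
  (\int[leb2]_p (ind02 p.1 * ind02 p.2 *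
     ((0 <= v - h * zigzag (c + p.1 + p.2 * t) <= w)%R : nat)%:R)%:E <=
   (4 * (w / h))%:E)%E.
Proof.
move=> h0 w0.
pose g (p : R * R) : R := ind02 p.1 * ind02 p.2 *
  ((0 <= v - h * zigzag (c + p.1 + p.2 * t) <= w)%R : nat)%:R.
have mzz (c' : R) : measurable_fun setT (fun x : R => zigzag (c' + x)).
  by apply: (measurableT_comp measurable_zigzag); exact: measurable_funD.
have g0 p : (0 <= (g p)%:E)%E.
  by rewrite lee_fin !mulr_ge0 ?ind02_ge0.
have mb : measurable_fun [set: R * R]
    (fun p => (0 <= v - h * zigzag (c + p.1 + p.2 * t) <= w)%R).
  have mz : measurable_fun [set: R * R]
      (fun p => v - h * zigzag (c + p.1 + p.2 * t)).
    apply: measurable_funB => //; apply: measurable_funM => //.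
    apply: (measurableT_comp measurable_zigzag); apply: measurable_funD.
      exact: measurable_funD.
    exact: measurable_funM.
  by apply: measurable_and; apply: measurable_fun_ler.
have mg : measurable_fun setT (fun p => (g p)%:E).
  apply/measurable_EFinP; apply: measurable_funM.
    by apply: measurable_funM; [exact: (measurable_fun1 measurable_ind02)|
                                 exact: (measurable_fun2 measurable_ind02)].
  have -> : (fun p : R * R => ((0 <= v - h * zigzag (c + p.1 + p.2 * t) <= w)%R : nat)%:R) =
      (\1_[set p | (0 <= v - h * zigzag (c + p.1 + p.2 * t) <= w)%R] : R * R -> R).
    apply/funext => p; rewrite indicE; congr (_%:R); congr nat_of_bool.
    by apply/idP/idP; rewrite inE.
  by apply: measurable_indic; exact: measurable_boolset.
rewrite -[leLHS]/(\int[leb2]_p (g p)%:E)%E leb2E2//.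
apply: (@le_trans _ _ (\int[mu]_y ((ind02 y)%:E * (2 * (w / h))%:E))%E); last first.
  rewrite ge0_integralZr//.
  - rewrite integral_ind02 -EFinM lee_fin; lra.
  - by apply/measurable_EFinP; exact: measurable_ind02.
  - by move=> y _; rewrite lee_fin ind02_ge0.
  - by rewrite lee_fin mulr_ge0// divr_ge0// ltW.
apply: ge0_le_integral => //.
- by move=> y _; apply: integral_ge0.
- apply: (measurable_integral2 (h := fun p => (g (p.2, p.1))%:E)) => //.
  by apply: (measurableT_comp mg); exact: measurable_fun_pair.
- by apply: emeasurable_funM => //; apply/measurable_EFinP; exact: measurable_ind02.
move=> y _.
pose E := `[c + y * t, c + y * t + 2[ `&` zigzag @^-1` `[(v - w) / h, v / h].
have mE : measurable E.
  apply: measurableI => //; rewrite -[_ @^-1` _]setTI.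
  exact: measurable_zigzag.
have gE x : g (x, y) = ind02 y * \1_E (x + (c + y * t)).
  rewrite /g/= mulrAC mulrC; congr (_ * _); rewrite ind02E -natrM mulnb indicE.
  congr (_%:R); congr nat_of_bool; rewrite (_ : c + x + y * t = x + (c + y * t)); last ring.
  apply/idP/idP; rewrite inE /E/= !in_itv/= ler_pdivrMr// ler_pdivlMr//.
    by move=> /andP[? ?]; split; lra.
  by move=> [? ?]; apply/andP; split; lra.
under eq_integral do rewrite gE EFinM.
have mE1 : measurable_fun [set: R] (fun x => (\1_E x : R)%:E).
  by apply/measurable_EFinP; exact: measurable_indic.
rewrite ge0_integralZl//; last 2 first.
- by apply: (measurableT_comp mE1); exact: measurable_funD.
- by rewrite lee_fin ind02_ge0.
apply: lee_wpmul2l; first by rewrite lee_fin ind02_ge0.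
rewrite (integral_shift (f := fun x => (\1_E x : R)%:E))//.
rewrite integral_indic// setIT.
apply: le_trans (zigzag_equidistributed _ _) _.
  by rewrite ler_pM2r ?invr_gt0//; lra.
by rewrite lee_fin -mulrBl; apply: ler_wpM2l => //; rewrite ler_pM2r ?invr_gt0//; lra.
Qed.

End Strips.

Section Clamp.
Context {R : realType}.

Definition clamp (n t : R) : R := Num.max 0 (Num.min n t).

Lemma clamp_sum n (u : R) : \sum_(j < n) clamp 1 (u - j%:R) = clamp n%:R u.
Proof.
elim: n => [|n IH].
  rewrite big_ord0 /clamp /Num.max /Num.min.
  by repeat case: ifPn; rewrite -?leNgt; lra.
have n0 : 0 <= n%:R :> R by exact: ler0n.
rewrite big_ord_recr/= IH /clamp -natr1.
rewrite /Num.max /Num.min.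
by repeat case: ifPn; rewrite -?leNgt; lra.
Qed.

Lemma clamp_lip (n t u : R) : 0 <= n -> t <= u -> 0 <= clamp n u - clamp n t <= u - t.
Proof.
move=> n0 tu; rewrite /clamp /Num.max /Num.min.
by repeat case: ifPn; rewrite -?leNgt; lra.
Qed.

(** The continuous piecewise linear function with slope [D j] on the j-th unit interval. Written as
    a sum of ramps, it inherits continuity from [clamp]. *)
Definition phase n (D : nat -> R) (u : R) := \sum_(j < n) D j * clamp 1 (u - j%:R).

Lemma phase_cell n D (u : R) (i : nat) : (i < n)%N -> i%:R <= u < i.+1%:R ->
  phase n D u = \sum_(j < i) D j + D i * (u - i%:R).
Proof.
rewrite -natr1 => lin ui; rewrite /phase -(subnKC lin) !big_split_ord/= big_ord_recr/=.
rewrite [X in _ + X]big1 ?addr0 => [|j _]; last first.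
  rewrite (_ : clamp _ _ = 0) ?mulr0// natrD -natr1.
  have := ler0n R j; rewrite /clamp /Num.max /Num.min.
  by repeat case: ifPn; rewrite -?leNgt; lra.
congr (_ + _).
  apply: eq_bigr => j _; rewrite (_ : clamp _ _ = 1) ?mulr1//.
  have : j%:R + 1 <= i%:R :> R by rewrite natr1 ler_nat.
  by rewrite /clamp /Num.max /Num.min; repeat case: ifPn; rewrite -?leNgt; lra.
congr (_ * _); rewrite /clamp /Num.max /Num.min.
by repeat case: ifPn; rewrite -?leNgt; lra.
Qed.

(** The ramps are nondecreasing and add up to [clamp n], which is 1-Lipschitz; weights below 2 at
    most double the increment. *)
Lemma phase_lip n D (u v : R) : (forall i, 0 <= D i < 2) ->
  `|phase n D u - phase n D v| <= 2 * `|u - v|.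
Proof.
move=> D02; wlog uv : u v / v <= u => [hw|].
  have /orP[|] := le_total v u; first exact: hw.
  by move=> uv; rewrite distrC (distrC u); exact: hw.
rewrite (ger0_norm (x := u - v)) ?subr_ge0// /phase -sumrB.
have b i : 0 <= clamp 1 (u - i%:R) - clamp 1 (v - i%:R).
  by have /andP[] := clamp_lip ler01 (lerB uv (lexx i%:R)).
rewrite ger0_norm; last first.
  apply: sumr_ge0 => i _; rewrite -mulrBr mulr_ge0//.
  by have /andP[] := D02 i.
apply: (@le_trans _ _ (\sum_(i < n) 2 * (clamp 1 (u - i%:R) - clamp 1 (v - i%:R)))).
  apply: ler_sum => i _; rewrite -mulrBr ler_wpM2r//.
  by have /andP[_ /ltW] := D02 i.
rewrite -mulr_sumr ler_pM2l// sumrB !clamp_sum.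
by have /andP[] := clamp_lip (ler0n R n) uv.
Qed.

End Clamp.

Lemma measurable_lip (R : realType) (L : R) (f : R -> R) :
  (forall x y, `|f x - f y| <= L * `|x - y|) -> measurable_fun setT f.
Proof.
move=> flip; apply: continuous_measurable_fun => x.
have L1 : 0 < `|L| + 1 by rewrite ltr_wpDl.
apply/cvgrPdist_le => e e0; near=> t.
apply: (le_trans (flip _ _)).
apply: (@le_trans _ _ ((`|L| + 1) * `|x - t|)).
  by rewrite ler_wpM2r// (le_trans (ler_norm _))// lerDl.
rewrite -ler_pdivlMl//; near: t; apply: cvgr_dist_le => //.
by rewrite mulr_gt0// invr_gt0.
Unshelve. all: by end_near. Qed.

Lemma le_indic_imp (R : realType) T U (A : set T) (B : set U) (x : T) (y : U) :
  (A x -> B y) -> \1_A x <= \1_B y :> R.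
Proof.
move=> AB; rewrite !indicE; have [/set_mem/AB By|_] := boolP (x \in A).
  by rewrite mem_set.
by rewrite ler0n.
Qed.

Section Gain.
Context {R : realType}.
Local Notation mu := (@lebesgue_measure R).
Variable rho : R * R -> \bar R.
Hypothesis mrho : measurable_fun setT rho.
Hypothesis rho0 : forall z, (0 <= rho z)%E.

(** As motions preserve area, this is the mass of [rho] in the image of [S]. Moving the density
    rather than the set keeps all strips over the same horizontal axis. *)
Definition gain (q : motion) (S : set (R * R)) : \bar R :=
  (\int[leb2]_z ((\1_S z : R)%:E * rho (move q z)))%E.

Let mrhoq q : measurable_fun setT (fun z => rho (move q z)).
Proof. by apply: (measurableT_comp mrho); exact: measurable_move. Qed.

Let mind (S : set (R * R)) : measurable S ->
  measurable_fun setT (fun z => (\1_S z : R)%:E).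
Proof. by move=> mS; apply/measurable_EFinP; exact: measurable_indic. Qed.

Lemma measurable_gain q S : measurable S ->
  measurable_fun setT (fun z => (\1_S z : R)%:E * rho (move q z))%E.
Proof. by move=> mS; apply: emeasurable_funM => //; exact: mind. Qed.

Lemma gain_integrand_ge0 q (S : set (R * R)) z :
  (0 <= (\1_S z : R)%:E * rho (move q z))%E.
Proof. by rewrite mule_ge0// lee_fin. Qed.

Lemma gain_ge0 q S : (0 <= gain q S)%E.
Proof. by apply: integral_ge0 => z _; exact: gain_integrand_ge0. Qed.

Lemma le_gain q S S' : measurable S -> measurable S' -> S `<=` S' ->
  (gain q S <= gain q S')%E.
Proof.
move=> mS mS' SS'; apply: ge0_le_integral => //.
- by move=> z _; exact: gain_integrand_ge0.
- exact: measurable_gain.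
- exact: measurable_gain.
move=> z _; apply: lee_wpmul2r => //; rewrite lee_fin.
by apply: le_indic_imp; exact: SS'.
Qed.

(** Both sides are masses of [rho], and the hypothesis says that the image of [S] under [q] lies in
    the image of [S'] under [q']. *)
Lemma gain_transfer q q' S S' : measurable S -> measurable S' ->
  (forall z, S z -> S' (unmove q' (move q z))) -> (gain q S <= gain q' S')%E.
Proof.
move=> mS mS' SS'.
pose h (u : R * R) : \bar R := ((\1_S' (unmove q' u) : R)%:E * rho u)%E.
have mh : measurable_fun setT h.
  apply: emeasurable_funM => //.
  by apply: (measurableT_comp (mind mS')); exact: measurable_unmove.
have h0 u : (0 <= h u)%E by rewrite mule_ge0// lee_fin.
have -> : gain q' S' = (\int[leb2]_z h z)%E.
  rewrite -(leb2_move q' mh h0); apply: eq_integral => z _.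
  by rewrite /h moveK.
rewrite -(leb2_move q mh h0); apply: ge0_le_integral => //.
- by move=> z _; exact: gain_integrand_ge0.
- exact: measurable_gain.
- by apply: (measurableT_comp mh); exact: measurable_move.
move=> z _; apply: lee_wpmul2r => //; rewrite lee_fin.
by apply: le_indic_imp; exact: SS'.
Qed.

Hypothesis periodic : forall (a b : int) z, rho (z.1 + a%:~R, z.2 + b%:~R) = rho z.

Definition translate (q : motion) (a b : R) : motion :=
  @Motion R (mx q + a) (my q + b) (mc q) (ms q) (mb q) (mcs q).

Lemma gain_translate q (a b : int) S :
  gain (translate q a%:~R b%:~R) S = gain q S.
Proof.
apply: eq_integral => z _; congr (_ * _)%E; rewrite -[RHS](periodic a b).
by rewrite /move /rigid/=; congr rho; congr pair; rewrite addrAC.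
Qed.

Lemma gain_bigcup_le q n (S : nat -> set (R * R)) (S' : set (R * R)) :
  (forall i, measurable (S i)) -> measurable S' ->
  (forall z, S' z -> exists2 i, (i < n)%N & S i z) ->
  (gain q S' <= \sum_(i < n) gain q (S i))%E.
Proof.
move=> mS mS' cov; rewrite /gain -ge0_integral_sum//=; last 2 first.
- by move=> i; exact: measurable_gain.
- by move=> i z _; exact: gain_integrand_ge0.
apply: ge0_le_integral => //.
- by move=> z _; exact: gain_integrand_ge0.
- exact: measurable_gain.
- by apply: emeasurable_sum => i; exact: measurable_gain.
move=> z _; have [S'z|S'z] := pselect (S' z); last first.
  by rewrite indicE memNset// mul0e sume_ge0// => i _; exact: gain_integrand_ge0.
have [i lin Siz] := cov z S'z.
rewrite (bigD1 (Ordinal lin))//= !indicE !mem_set//.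
by rewrite leeDl// sume_ge0// => j _; exact: gain_integrand_ge0.
Qed.

Lemma sum_gain_le q n (S : nat -> set (R * R)) (S' : set (R * R)) :
  (forall i, measurable (S i)) -> measurable S' ->
  (forall i, S i `<=` S') ->
  (forall i j z, S i z -> S j z -> i = j) ->
  (\sum_(i < n) gain q (S i) <= gain q S')%E.
Proof.
move=> mS mS' SS' disj; rewrite /gain -ge0_integral_sum//=; last 2 first.
- by move=> i; exact: measurable_gain.
- by move=> i z _; exact: gain_integrand_ge0.
apply: ge0_le_integral => //.
- by move=> z _; apply: sume_ge0 => i _; exact: gain_integrand_ge0.
- by apply: emeasurable_sum => i; exact: measurable_gain.
- exact: measurable_gain.
move=> z _; have [[i Siz]|noS] := pselect (exists i : 'I_n, S i z); last first.
  rewrite big1 ?gain_integrand_ge0// => i _.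
  by rewrite indicE memNset ?mul0e// => Siz; apply: noS; exists i.
rewrite (bigD1 i)//= big1 ?adde0 => [|j ji].
  by rewrite !indicE !mem_set//; exact: SS' Siz.
rewrite indicE memNset ?mul0e// => Sjz.
by move/eqP: ji; apply; apply/val_inj; exact: (disj _ _ _ Sjz Siz).
Qed.

End Gain.

Section Displacement.
Context {R : realType}.
Implicit Types (q : @motion R).

Lemma mc_le1 q : `|mc q| <= 1.
Proof. by have := mcs q; rewrite ler_norml; nra. Qed.

Lemma ms_le1 q : `|ms q| <= 1.
Proof. by have := mcs q; rewrite ler_norml; nra. Qed.

Lemma move_dist q q' (d : R) z : mb q' = mb q ->
  `|mx q - mx q'| <= d -> `|my q - my q'| <= d ->
  `|mc q - mc q'| <= d -> `|ms q - ms q'| <= d ->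
  -1 <= z.1 <= 2 -> 0 <= z.2 <= 1 ->
  `|(move q z).1 - (move q' z).1| <= 4 * d /\
  `|(move q z).2 - (move q' z).2| <= 4 * d.
Proof.
move=> bE dx dy dc ds z1 z2.
have d0 : 0 <= d by apply: le_trans dx.
have Z1 : `|z.1| <= 2 by rewrite ler_norml; lra.
have prod (u v e : R) : `|u| <= d -> `|v| <= e -> `|u * v| <= d * e.
  by move=> *; rewrite normrM ler_pM.
rewrite /move /rigid bE/=; set y := if mb q then z.2 else - z.2.
have Y1 : `|y| <= 1 by rewrite ler_norml /y; case: (mb q); lra.
have := prod _ _ _ dc Z1; have := prod _ _ _ ds Y1.
have := prod _ _ _ ds Z1; have := prod _ _ _ dc Y1.
move: dx dy; rewrite !ler_norml => *.
by split; lra.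
Qed.

Lemma unmove_dist q q' (e : R) z : 
  `|(move q z).1 - (move q' z).1| <= e -> `|(move q z).2 - (move q' z).2| <= e ->
  `|(unmove q' (move q z)).1 - z.1| <= 2 * e /\
  `|(unmove q' (move q z)).2 - z.2| <= 2 * e.
Proof.
move=> d1 d2; rewrite -{2 4}(moveK q' z).
set u := move q z in d1 d2 *; set v := move q' z in d1 d2 *.
have e0 : 0 <= e by apply: le_trans d1.
have prod (c x : R) : `|c| <= 1 -> `|x| <= e -> `|c * x| <= e.
  by move=> *; rewrite -[leRHS]mul1r normrM ler_pM.
have := prod _ _ (mc_le1 q') d1; have := prod _ _ (ms_le1 q') d1.
have := prod _ _ (mc_le1 q') d2; have := prod _ _ (ms_le1 q') d2.
rewrite /unmove /rigidV/= !ler_norml.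
by case: (mb q') => *; split; lra.
Qed.

End Displacement.

(** * Refining a strip *)

Section Step.
Context {R : realType} (T : finType).
Local Notation mu := (@lebesgue_measure R).
Variable rho : R * R -> \bar R.
Hypothesis mrho : measurable_fun setT rho.
Hypothesis rho0 : forall z, (0 <= rho z)%E.
Hypothesis periodic : forall (a b : int) z, rho (z.1 + a%:~R, z.2 + b%:~R) = rho z.
Local Notation gain := (gain rho).
Variable sg : R.
Hypothesis gain_small : forall q (S : set (R * R)) (a : R), measurable S ->
  (forall z, S z -> -1 <= z.1 <= 2 /\ 0 <= z.2 <= 1) -> 0 <= a ->
  (leb2 S <= a%:E)%E -> (gain q S <= (a `^ sg)%:E)%E.
Variables (net : T -> @motion R) (d : R).
Hypothesis netP : forall q, exists t, exists a b : int,
  [/\ mb (net t) = mb q, `|mx q + a%:~R - mx (net t)| <= d,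
      `|my q + b%:~R - my (net t)| <= d, `|mc q - mc (net t)| <= d &
      `|ms q - ms (net t)| <= d].
(* [w] and [w'] are the widths of the old and of the new strip, [l] is the length of
   a cell, [L] the current Lipschitz constant and [B] the current density.  The
   margin [k * w'] on both sides of the new strip absorbs the distance [d] from a
   motion to the net. *)
Variables (f : R -> R) (L w w' k l B : R).
Hypothesis flip : forall x y, `|f x - f y| <= L * `|x - y|.
Hypothesis f01 : forall x, 0 <= f x /\ f x + w <= 1.
Hypothesis w01 : 0 < w <= 1.
Hypothesis w'0 : 0 < w'.
Hypothesis k01 : 0 < k <= 1.
Hypothesis l0 : 0 < l.
Hypothesis w'w : 4 * w' <= w.
Hypothesis dk : 16 * d <= k * w'.
Hypothesis Ll : L + 2 * w / l <= 1.
Hypothesis fB : forall q, (gain q (strip (- w) (1 + w) 0 w f) <= (w * B)%:E)%E.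

(** [w2] is the width of the new strip with both margins, and [h] the amplitude that this leaves for
    a zigzag inside the old strip. *)
Let w2 := w' + 2 * (k * w').
Let h := w - w2.

Let kw' : 0 < k * w' <= w'.
Proof.
have /andP[k0 k1] := k01.
by rewrite mulr_gt0//= -[leRHS]mul1r ler_pM2r.
Qed.

Let w20 : 0 < w2. Proof. by have := kw'; rewrite /w2; lra. Qed.
Let h0 : 0 < h.
Proof.
have := kw'; rewrite /h /w2 => /andP[? ?]; have := w'w; have := w'0. lra.
Qed.

Let mf : measurable_fun setT f. Proof. exact: measurable_lip flip. Qed.

(** Horizontal position in units of [l]. The origin -1 lies to the left of every strip because
    [w <= 1]. *)
Let cellpos (x : R) := (x + 1) / l.

(** The part over cell [i] of the new strip with its margins, provided that the phase enters the
    cell at [a] and has slope [D] there. *)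
Let inS (i : nat) (a D : R) (z : R * R) : bool :=
  [&& i%:R <= cellpos z.1, cellpos z.1 < i.+1%:R, - w <= z.1, z.1 <= 1 + w,
   0 <= z.2 - f z.1 - h * zigzag (a + D * (cellpos z.1 - i%:R)) &
   z.2 - f z.1 - h * zigzag (a + D * (cellpos z.1 - i%:R)) <= w2].

Let mcellpos : measurable_fun setT cellpos.
Proof. by apply: measurable_funM => //; exact: measurable_funD. Qed.

Let minS i : measurable_fun [set: (R * R) * (R * R)]
  (fun p => inS i p.1.1 p.1.2 p.2).
Proof.
have m1 (g : R -> R) : measurable_fun setT g ->
    measurable_fun [set: (R * R) * (R * R)] (fun p => g p.2.1).
  by move=> mg; apply: (measurableT_comp mg); exact: measurableT_comp.
have mz1 := m1 _ (@measurable_id _ _ setT).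
have mz2 : measurable_fun [set: (R * R) * (R * R)] (fun p => p.2.2).
  exact: measurableT_comp.
have ma : measurable_fun [set: (R * R) * (R * R)] (fun p => p.1.1).
  exact: measurableT_comp.
have mD : measurable_fun [set: (R * R) * (R * R)] (fun p => p.1.2).
  exact: measurableT_comp.
have mg : measurable_fun [set: (R * R) * (R * R)] (fun p => p.2.2 - f p.2.1 -
    h * zigzag (p.1.1 + p.1.2 * (cellpos p.2.1 - i%:R))).
  apply: measurable_funB; first by apply: measurable_funB => //; exact: m1.
  apply: measurable_funM => //; apply: (measurableT_comp measurable_zigzag).
  apply: measurable_funD => //; apply: measurable_funM => //.
  by apply: measurable_funB => //; exact: m1.
have mc := m1 _ mcellpos.
by do !apply: measurable_and; first [apply: measurable_fun_ler | apply: measurable_fun_ltr].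
Qed.

Let S i a D := [set z | inS i a D z].

Let mS i a D : measurable (S i a D).
Proof.
apply: measurable_boolset.
have -> : inS i a D = (fun p => inS i p.1.1 p.1.2 p.2) \o (pair (a, D)) by [].
by apply: (measurableT_comp (minS i)); exact: measurable_fun_pair.
Qed.

Let cell i : set (R * R) := [set z | [&& i%:R <= cellpos z.1 & cellpos z.1 < i.+1%:R]]
  `&` strip (- w) (1 + w) 0 w f.

Let mcell i : measurable (cell i).
Proof.
apply: measurableI; last exact: measurable_strip.
apply: measurable_boolset.
have mc := measurable_fun1 mcellpos.
by apply: measurable_and; [apply: measurable_fun_ler | apply: measurable_fun_ltr].
Qed.

Let S_cell i a D : S i a D `<=` cell i.
Proof.
move=> z /and5P[z1 z2 z3 z4 /andP[z5 z6]]; split; first by rewrite /= z1 z2.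
apply/and4P; split => //.
  apply: le_trans z5 _; rewrite lerBlDr lerDl mulr_ge0 ?zigzag_ge0//; exact: ltW.
have : h * zigzag (a + D * (cellpos z.1 - i%:R)) <= h * 1.
  by rewrite ler_pM2l// zigzag_le1.
by move: z6; rewrite /h; lra.
Qed.

Let strip_box z : strip (- w) (1 + w) 0 w f z -> -1 <= z.1 <= 2 /\ 0 <= z.2 <= 1.
Proof. by move=> /and4P[? ? ? ?]; have := f01 z.1; have := w01; split; lra. Qed.

(** The largest possible density of one cell, whose area is at most [l * w2]. *)
Let b := (l * w2) `^ sg / w'.

Let b0 : 0 < b. Proof. by rewrite divr_gt0// powR_gt0// mulr_gt0. Qed.

Let gainS t i a D : (gain (net t) (S i a D) <= (w' * b)%:E)%E.
Proof.
rewrite /b mulrC divfK ?gt_eqF//; apply: gain_small => //.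
- by move=> z /S_cell[_]; exact: strip_box.
- by rewrite mulr_ge0// ltW.
pose xi := l * i%:R - 1.
have -> : l * w2 = ((xi + l) - xi) * w2 by ring.
apply: (strip_area (g := fun x => f x + h * zigzag (a + D * (cellpos x - i%:R)))) => //.
- by rewrite lerDl ltW.
- exact: ltW.
move=> z /and5P[]; rewrite /cellpos ler_pdivlMr// ltr_pdivrMr// -natr1.
move=> z1 z2 _ _ /andP[z5 z6].
by apply/and4P; rewrite /xi opprD addrA z5 z6; split => //; lra.
Qed.

Let Y i t a D := fine (gain (net t) (S i a D)) / w'.

Let gainY i t a D : gain (net t) (S i a D) = (w' * Y i t a D)%:E.
Proof.
rewrite /Y mulrC divfK ?gt_eqF// fineK// ge0_fin_numE; last exact: gain_ge0.
by apply: le_lt_trans (gainS t i a D) _; rewrite ltry.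
Qed.

Let Yb i t a D : 0 <= Y i t a D <= b.
Proof.
have := gainS t i a D; have := gain_ge0 rho0 (net t) (S i a D).
by rewrite gainY !lee_fin pmulr_rge0// ler_pM2l// => -> ->.
Qed.

Let F i t a (p : (R * R) * (R * R)) : \bar R :=
  ((ind02 p.1.1 * ind02 p.1.2)%:E *
   ((\1_(S i (a + p.1.1) p.1.2) p.2 : R)%:E * rho (move (net t) p.2)))%E.

Let indS i a D z : (\1_(S i a D) z : R) = (inS i a D z : nat)%:R.
Proof.
by rewrite indicE; congr (_%:R); congr nat_of_bool; apply/idP/idP; rewrite inE.
Qed.

Let mF i t a : measurable_fun setT (F i t a).
Proof.
apply: emeasurable_funM.
  apply/measurable_EFinP; apply: measurable_funM.
    by apply: (measurableT_comp measurable_ind02); exact: measurableT_comp.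
  by apply: (measurableT_comp measurable_ind02); exact: measurableT_comp.
apply: emeasurable_funM; last first.
  apply: (measurableT_comp mrho); apply: measurableT_comp => //.
  exact: measurable_move.
apply/measurable_EFinP.
have -> : (fun p : (R * R) * (R * R) => \1_(S i (a + p.1.1) p.1.2) p.2) =
    (\1_[set p | inS i (a + p.1.1) p.1.2 p.2] : (R * R) * (R * R) -> R).
  apply/funext => p; rewrite indS indicE; congr (_%:R); congr nat_of_bool.
  by apply/idP/idP; rewrite inE.
apply: measurable_indic; apply: measurable_boolset.
pose g (p : (R * R) * (R * R)) := ((a + p.1.1, p.1.2), p.2).
rewrite [X in measurable_fun _ X](_ : _ = (fun p => inS i p.1.1 p.1.2 p.2) \o g)//.
apply: (measurableT_comp (minS i)).
apply: measurable_fun_pair => //; apply: measurable_fun_pair.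
  by apply: measurable_funD => //; exact: measurableT_comp.
exact: measurableT_comp.
Qed.

Let F0 i t a p : (0 <= F i t a p)%E.
Proof. by rewrite /F !mule_ge0 ?lee_fin ?mulr_ge0 ?ind02_ge0. Qed.

Let intF i t a (p : R * R) : (\int[leb2]_z F i t a (p, z) =
  (ind02 p.1 * ind02 p.2 * (w' * Y i t (a + p.1) p.2))%:E)%E.
Proof.
rewrite /F/= ge0_integralZl//.
- by rewrite -/(gain (net t) (S i (a + p.1) p.2)) gainY -EFinM.
- exact: measurable_gain.
- by move=> z _; exact: gain_integrand_ge0.
- by rewrite lee_fin mulr_ge0 ?ind02_ge0.
Qed.

Let mY i t : measurable_fun [set: R * R] (fun z => Y i t z.1 z.2).
Proof.
apply: measurable_funM => //; apply: measurableT_comp; first exact: fine_measurable.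
pose G (p : (R * R) * (R * R)) : \bar R :=
  ((\1_[set p | inS i p.1.1 p.1.2 p.2] p : R)%:E * rho (move (net t) p.2))%E.
rewrite (_ : (fun z => _) = (fun z => \int[leb2]_u G (z, u))%E); last first.
  by apply/funext => z; apply: eq_integral => u _; rewrite /G; congr (_%:E * _)%E.
apply: measurable_integral22 => [|p]; last by rewrite mule_ge0// lee_fin.
apply: emeasurable_funM; last first.
  apply: (measurableT_comp mrho); apply: measurableT_comp => //.
  exact: measurable_move.
by apply/measurable_EFinP; apply: measurable_indic; exact: measurable_boolset.
Qed.

(** A point of the old strip is caught by the thickened new one with probability at most [w2 / h];
    the remaining factor turns mass into density. *)
Let m i t := w2 / (h * w') * fine (gain (net t) (cell i)).

Let gaincell_fin i t : gain (net t) (cell i) \is a fin_num.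
Proof.
rewrite ge0_fin_numE ?gain_ge0//.
apply: (@le_lt_trans _ _ (w * B)%:E); last by rewrite ltry.
apply: le_trans (fB (net t)); apply: le_gain => //; first exact: measurable_strip.
by move=> z [].
Qed.

(** Tonelli allows the slopes to be integrated first: for a fixed point of the cell,
    [strip_equidistributed] bounds the measure of the pairs of slopes whose strip contains it. *)
Let intY i t a :
  (\int[mu]_x \int[mu]_y (ind02 x * (ind02 y * Y i t (a + x) y))%:E <=
   (4 * m i t)%:E)%E.
Proof.
have -> : (\int[mu]_x \int[mu]_y (ind02 x * (ind02 y * Y i t (a + x) y))%:E =
    (w'^-1)%:E * \int[leb2]_p \int[leb2]_z F i t a (p, z))%E.
  rewrite -ge0_integralZl//; last 3 first.
  - exact: measurable_integral22.
  - by move=> p _; exact: integral_ge0.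
  - by rewrite lee_fin invr_ge0 ltW.
  rewrite leb2E.
  - apply: eq_integral => x _; apply: eq_integral => y _.
    rewrite intF -EFinM; congr EFin => /=.
    by field; rewrite gt_eqF.
  - by apply: measurable_funeM; exact: measurable_integral22.
  - move=> p; rewrite mule_ge0 ?lee_fin ?invr_ge0; [|exact: ltW|exact: integral_ge0].
    by [].
rewrite tonelli22//.
apply: (@le_trans _ _ ((w'^-1)%:E * ((4 * (w2 / h))%:E * gain (net t) (cell i)))%E); last first.
  rewrite -(fineK (gaincell_fin i t)) -!EFinM lee_fin /m le_eqVlt; apply/orP; left.
  by apply/eqP; field; rewrite !gt_eqF.
apply: lee_wpmul2l; first by rewrite lee_fin invr_ge0 ltW.
rewrite /gain -ge0_integralZl//; last 3 first.
- exact: measurable_gain.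
- by move=> z _; exact: gain_integrand_ge0.
- by rewrite lee_fin mulr_ge0// divr_ge0// ltW.
apply: ge0_le_integral => //.
- by move=> z _; apply: integral_ge0.
- pose F' p := F i t a (p.2, p.1).
  apply: (measurable_integral22 (F := F')) => [|p]; last exact: F0.
  by apply: (measurableT_comp (mF i t a)); exact: measurable_fun_pair.
- by apply: measurable_funeM; exact: measurable_gain.
move=> z _; rewrite muleA.
have -> : (\int[leb2]_p F i t a (p, z) = \int[leb2]_p ((ind02 p.1 * ind02 p.2 *
    (\1_(S i (a + p.1) p.2) z : R))%:E * rho (move (net t) z)))%E.
  by apply: eq_integral => p _; rewrite /F/= muleA -EFinM.
rewrite ge0_integralZr//; last 2 first.
- pose F' p := (ind02 p.1 * ind02 p.2 * (\1_(S i (a + p.1) p.2) z : R)).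
  apply/measurable_EFinP; rewrite -/F'; apply: measurable_funM.
    by apply: measurable_funM; [exact: (measurable_fun1 measurable_ind02)|
                                exact: (measurable_fun2 measurable_ind02)].
  rewrite [X in measurable_fun _ X](_ : _ =
      (\1_[set p | inS i (a + p.1) p.2 z] : R * R -> R)); last first.
    apply/funext => p; rewrite indS indicE; congr (_%:R); congr nat_of_bool.
    by apply/idP/idP; rewrite inE.
  apply: measurable_indic; apply: measurable_boolset.
  pose g (p : R * R) := ((a + p.1, p.2), z).
  rewrite [X in measurable_fun _ X](_ : _ = (fun p => inS i p.1.1 p.1.2 p.2) \o g)//.
  apply: (measurableT_comp (minS i)); apply: measurable_fun_pair => //.
  by apply: measurable_fun_pair => //; exact: measurable_funD.
- by move=> p _; rewrite lee_fin !mulr_ge0 ?ind02_ge0.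
apply: lee_wpmul2r => //.
have [cz|ncz] := pselect (cell i z); last first.
  rewrite integral0_eq ?indicE ?memNset ?mule0// => p _.
  by rewrite indicE memNset ?mulr0// => /S_cell.
rewrite [in leRHS]indicE mem_set// mule1.
apply: le_trans (strip_equidistributed a (z.2 - f z.1) (cellpos z.1 - i%:R) h0 (ltW w20)).
rewrite le_eqVlt; apply/orP; left; apply/eqP; apply: eq_integral => p _.
rewrite indS /inS; case: cz => /= /andP[-> ->] /and4P[-> -> _ _].
by [].
Qed.

Let sum_m n t : \sum_(i < n) m i.+1 t <= w2 / (h * w') * (w * B).
Proof.
rewrite -mulr_sumr; apply: ler_wpM2l; first by rewrite ltW// divr_gt0// mulr_gt0.
rewrite -lee_fin -sumEFin; apply: le_trans (fB (net t)).
rewrite (eq_bigr (fun i : 'I_n => gain (net t) (cell i.+1))); last first.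
  by move=> i _; rewrite fineK.
apply: (@sum_gain_le _ rho mrho rho0 (net t) n (fun i => cell i.+1)
  (strip (- w) (1 + w) 0 w f)) => //.
- exact: measurable_strip.
- by move=> i z [].
move=> i j z [/andP[i1 i2] _] [/andP[j1 j2] _].
have : i.+1%:R < j.+2%:R :> R by exact: le_lt_trans i1 j2.
have : j.+1%:R < i.+2%:R :> R by exact: le_lt_trans j1 i2.
by rewrite !ltr_nat !ltnS => ji ij; apply/eqP; rewrite eqn_leq ij ji.
Qed.

Lemma refine_graph : exists f' : R -> R,
  [/\ forall x y, `|f' x - f' y| <= (L + 2 * w / l) * `|x - y|,
      forall x, f x <= f' x /\ f' x + w' <= f x + w &
      forall q, (gain q (strip (- w') (1 + w') 0 w' f') <=
        (w' * ((1 + k) ^+ 2 * (w2 / (h * w') * (w * B)) +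
               6 * b / k * (1 + ln #|T|%:R)))%:E)%E].
Proof.
have [w0 w1] : 0 < w /\ w <= 1 by apply/andP.
have [kw0 kww] : 0 < k * w' /\ k * w' <= w' by apply/andP; exact: kw'.
have hE : h = w - (w' + 2 * (k * w')) by [].
have [hw'w hdk hw' hh] : [/\ 4 * w' <= w, 16 * d <= k * w', 0 < w' & 0 < h].
  by split.
(* Enough cells to cover [[-1, 2]]. *)
pose n := (Num.truncn (3 / l)).+1.
have ln : 3 < n%:R * l.
  rewrite -ltr_pdivrMr//; have := Num.Theory.truncnS_gt (3 / l); exact.
have [D [D02 Dle]] := greedy_choice k01 b0 mY Yb intY n.
pose phi x := phase n D (cellpos x).
(* The shift by [k * w'] leaves room for the lower margin above [f]; as [h + w2 = w], the upper
   margin stays below [f + w]. *)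
pose f' x := f x + k * w' + h * zigzag (phi x).
have f'lip x y : `|f' x - f' y| <= (L + 2 * w / l) * `|x - y|.
  have -> : f' x - f' y = (f x - f y) + h * (zigzag (phi x) - zigzag (phi y)).
    by rewrite /f'; ring.
  rewrite [leRHS]mulrDl; apply: le_trans (ler_normD _ _) _; apply: lerD => //.
  rewrite normrM gtr0_norm//.
  apply: (@le_trans _ _ (h * (2 * (`|x - y| / l)))).
    rewrite ler_pM2l// (le_trans (zigzag_lip _ _))//.
    rewrite (le_trans (phase_lip _ _ _ D02))// ler_pM2l//.
    rewrite /cellpos -mulrBl normrM (gtr0_norm (x := l^-1)) ?invr_gt0//.
    by rewrite opprD addrACA subrr addr0.
  have -> : h * (2 * (`|x - y| / l)) = (2 * h / l) * `|x - y| by ring.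
  rewrite ler_wpM2r// ler_pM2r ?invr_gt0// ler_pM2l//; lra.
have f'lip1 x y : `|f' x - f' y| <= `|x - y|.
  by rewrite (le_trans (f'lip x y))// ler_piMl.
have ff' x : f x <= f' x /\ f' x + w' <= f x + w.
  have hz0 : 0 <= h * zigzag (phi x) by rewrite mulr_ge0 ?zigzag_ge0// ltW.
  have hz1 : h * zigzag (phi x) <= h * 1 by rewrite ler_pM2l// zigzag_le1.
  by rewrite /f'; split; lra.
have mf' : measurable_fun setT f' by exact: measurable_lip f'lip.
exists f'; split => // q.
have [t [i1 [i2 [bE dx dy dc ds]]]] := netP q.
rewrite -(gain_translate periodic q i1 i2).
set q1 := translate q _ _.
pose U := strip (- w) (1 + w) (- (k * w')) (w' + k * w') f'.
(* Passing to the net displaces a point by at most [8 * d] in each coordinate, so its height above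
   the 1-Lipschitz function [f'] changes by at most [16 * d <= k * w']. *)
apply: (@le_trans _ _ (gain (net t) U)).
  apply: gain_transfer => //; try exact: measurable_strip.
  move=> z /and4P[z1 z2 z3 z4].
  have zx : -1 <= z.1 <= 2 by lra.
  have zy : 0 <= z.2 <= 1.
    by have [? ?] := ff' z.1; have [? ?] := f01 z.1; lra.
  have [d1 d2] := move_dist (q := q1) (q' := net t) bE dx dy dc ds zx zy.
  have [] := unmove_dist d1 d2; set z' := unmove _ _ => e1 e2.
  have := le_trans (f'lip1 z'.1 z.1) e1.
  move: e1 e2; rewrite !ler_norml => /andP[? ?] /andP[? ?] /andP[? ?].
  by apply/and4P; split; lra.
apply: (@le_trans _ _ (\sum_(i < n) gain (net t) (S i (\sum_(j < i) D j) (D i)))%E).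
  apply: (gain_bigcup_le mrho rho0 (net t) (S := fun i => S i (\sum_(j < i) D j) (D i))) => //.
    exact: measurable_strip.
  move=> z /and4P[z1 z2 z3 z4].
  have c0 : 0 <= cellpos z.1 by rewrite divr_ge0; [| lra |exact: ltW].
  have cn : cellpos z.1 < n%:R by rewrite ltr_pdivrMr//; lra.
  pose i := Num.truncn (cellpos z.1).
  have /andP[ci1 ci2] := Num.Theory.truncn_itv c0.
  have lin : (i < n)%N by rewrite -(ltr_nat R) (le_lt_trans ci1).
  exists i => //; rewrite /S /= /inS ci1 ci2 z1 z2/=.
  have -> : z.2 - f z.1 - h * zigzag (\sum_(j < i) D j + D i * (cellpos z.1 - i%:R)) =
      z.2 - f' z.1 + k * w'.
    rewrite -(phase_cell D lin); last by rewrite ci1 ci2.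
    by rewrite /f' /phi; ring.
  by rewrite /w2; apply/andP; split; lra.
under eq_bigr do rewrite gainY.
rewrite sumEFin lee_fin -mulr_sumr ler_pM2l// (le_trans (Dle t))// lerD2r.
by rewrite ler_wpM2l// exprn_ge0//; have /andP[] := k01; lra.
Qed.

End Step.

(** * A finite net of motions modulo integer translations *)

Section Net.
Context {R : realType}.
Variable K : nat.
Hypothesis K0 : (0 < K)%N.
Implicit Types (q : @motion R).

Let grid (x : R) : 'I_K.+1 := inord (Num.truncn (x * K%:R)).

Let grid_close (x y : R) : 0 <= x <= 1 -> 0 <= y <= 1 -> grid x = grid y ->
  `|x - y| <= K%:R^-1.
Proof.
have K0' : 0 < K%:R :> R by rewrite ltr0n.
have trK (u : R) : 0 <= u <= 1 -> 0 <= u * K%:R /\ (Num.truncn (u * K%:R) < K.+1)%N.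
  move=> /andP[u0 u1]; split; first by rewrite mulr_ge0.
  have /andP[+ _] := Num.Theory.truncn_itv (mulr_ge0 u0 (ltW K0')).
  by rewrite ltnS -(ler_nat R) => /le_trans; apply; rewrite ler_piMl// ltW.
move=> /trK[x0 xK] /trK[y0 yK] /(congr1 val); rewrite /= !inordK// => xy.
have := Num.Theory.truncn_itv x0; have := Num.Theory.truncn_itv y0.
rewrite xy -natr1 => /andP[? ?] /andP[? ?].
rewrite -(ler_pM2r K0') mulVf ?gt_eqF// -[X in _ * X](gtr0_norm K0') -normrM mulrBl.
by rewrite ler_norml; lra.
Qed.

Let index q := (mb q, (grid (mx q), grid (my q)),
  (grid ((mc q + 1) / 2), grid ((ms q + 1) / 2))).

Let normalized q := (0 <= mx q <= 1) && (0 <= my q <= 1).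

Let unit_motion : @motion R.
Proof. by apply: (@Motion R 0 0 1 0 true); rewrite expr1n expr0n addr0. Defined.

(** Grid points need not have their linear part on the unit circle, so the net consists of one
    motion from each nonempty grid class, with [unit_motion] as default. The factor 2 comes from
    rescaling the coefficients from [[-1, 1]] to [[0, 1]]. *)
Lemma motion_net : exists (T : finType) (net : T -> @motion R),
  #|T| = (2 * K.+1 ^ 4)%N /\
  forall q, exists t, exists a b : int,
  [/\ mb (net t) = mb q, `|mx q + a%:~R - mx (net t)| <= 2 / K%:R,
      `|my q + b%:~R - my (net t)| <= 2 / K%:R,
      `|mc q - mc (net t)| <= 2 / K%:R & `|ms q - ms (net t)| <= 2 / K%:R].
Proof.
have K0' : 0 < K%:R^-1 :> R by rewrite invr_gt0 ltr0n.
pose T : finType := (bool * ('I_K.+1 * 'I_K.+1) * ('I_K.+1 * 'I_K.+1))%type.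
pose net (t : T) : motion :=
  match pselect (exists q, normalized q /\ index q = t) with
  | left e => sval (cid e) | right _ => unit_motion end.
exists T, net; split.
  by rewrite !card_prod card_bool card_ord -!mulnA.
move=> q.
pose a : int := - Num.floor (mx q); pose b : int := - Num.floor (my q).
pose q1 := translate q a%:~R b%:~R.
have fl (x : R) : 0 <= x + (- Num.floor x)%:~R <= 1.
  have := Num.Theory.floor_itv x; rewrite mulrNz intrD => /andP[? ?].
  by apply/andP; split; lra.
have nq1 : normalized q1 by rewrite /normalized /q1/= !fl.
exists (index q1), a, b; rewrite /net; case: pselect => [e|]; last first.
  by case; exists q1.
case: (cid e) => q2 /= [/andP[nx ny]]; rewrite /index => -[bE xE yE cE sE].
have hh (u v : R) : `|u| <= 1 -> `|v| <= 1 -> grid ((u + 1) / 2) = grid ((v + 1) / 2) ->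
    `|v - u| <= 2 / K%:R.
  rewrite !ler_norml => u1 v1 /grid_close uv.
  have : `|(u + 1) / 2 - (v + 1) / 2| <= K%:R^-1 by apply: uv; lra.
  by rewrite !ler_norml; lra.
move/andP: nq1 => [nx1 ny1].
have dx := grid_close nx nx1 xE; have dy := grid_close ny ny1 yE.
split => //.
- by move: dx; rewrite /q1/= -[2]/(1 + 1) mulrDl mul1r !ler_norml; lra.
- by move: dy; rewrite /q1/= -[2]/(1 + 1) mulrDl mul1r !ler_norml; lra.
- by apply: hh; [exact: mc_le1|exact: (mc_le1 q)|].
- by apply: hh; [exact: ms_le1|exact: (ms_le1 q)|].
Qed.

End Net.

(** * The limit graph *)

Section Scales.
Context {R : realType}.

Definition half j : R := 2^-1 ^+ j.
(** The widths of the strips; the shift in the exponent makes the first one 1/16. *)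
Definition scale j : R := half (2 ^ j.+2).

Lemma half_gt0 j : 0 < half j. Proof. by rewrite exprn_gt0. Qed.

Lemma half_le1 j : half j <= 1.
Proof. by rewrite exprn_ile1// invf_le1// ler1n. Qed.

Lemma halfS j : half j.+1 = half j / 2. Proof. by rewrite /half exprSr. Qed.

Lemma half_expn j : half j * 2 ^+ j = 1.
Proof. by rewrite /half -exprMn mulVf// expr1n. Qed.

Lemma le_half i j : (i <= j)%N -> half j <= half i.
Proof. by move=> ij; apply: ler_wiXn2l => //; rewrite invf_le1// ler1n. Qed.

Lemma scaleS j : scale j.+1 = scale j ^+ 2.
Proof. by rewrite /scale /half -exprM expnSr. Qed.

Lemma scale_gt0 j : 0 < scale j. Proof. exact: half_gt0. Qed.

Lemma scale_le j : scale j <= half j / 16.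
Proof.
rewrite /scale (_ : 16 = 2 ^+ 4); last by rewrite -natrX.
rewrite -exprVn -exprD; apply: le_half.
elim: j => // j IH; rewrite expnS; lia.
Qed.

Lemma scale_le16 j : scale j <= 1 / 16.
Proof. by have := scale_le j; have := half_le1 j; lra. Qed.

(** The constant 24 is the factorial in the term of order 4 of the exponential series. *)
Lemma polynomial_decay (be : R) : 0 < be -> exists2 C : R, 0 < C &
  forall x : R, 0 <= x -> x ^+ 4 * expR (- (be * x)) <= C.
Proof.
move=> be0; exists (24 / be ^+ 4); first by rewrite divr_gt0// exprn_gt0.
move=> x x0; have := expR_ge1Dxn 3 (mulr_ge0 (ltW be0) x0).
rewrite exprMn => h; rewrite expRN ler_pdivrMr ?expR_gt0//.
rewrite mulrAC ler_pdivlMr ?exprn_gt0//.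
have : (be ^+ 4 * x ^+ 4) / 24 <= expR (be * x).
  by apply: le_trans h; rewrite (_ : 4`!%:R = 24)// lerDr.
by rewrite ler_pdivrMr//; lra.
Qed.

(** The exponent is [5 = 2 + 2 + 1]: twice from the square, twice from the two margins in
    [1 + 2 * k], once from the loss of amplitude, which is harmless because [w <= k / 16]. *)
Lemma growth_factor j (B k w w' : R) : 0 <= B ->
  k = half j -> w = scale j -> w' = scale j.+1 ->
  (1 + k) ^+ 2 *
    ((w' + 2 * (k * w')) / ((w - (w' + 2 * (k * w'))) * w') * (w * B)) <=
  expR (5 * k) * B.
Proof.
move=> B0 kE wE w'E'.
have [k0 k1] : 0 < k /\ k <= 1 by rewrite kE; split; [exact: half_gt0|exact: half_le1].
have w0 : 0 < w by rewrite wE; exact: scale_gt0.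
have wk : w <= k / 16 by rewrite wE kE; exact: scale_le.
have w'E : w' = w ^+ 2 by rewrite w'E' wE; exact: scaleS.
pose v := w - w ^+ 2 * (1 + 2 * k).
have vw : w <= (1 + k) * v.
  have : w * ((1 + k) * (1 + 2 * k)) <= k / 16 * 6 by rewrite ler_pM//; nra.
  by move=> h; rewrite /v; nra.
have v0 : 0 < v by rewrite -(pmulr_rgt0 _ (_ : 0 < 1 + k)); lra.
have -> : (w' + 2 * (k * w')) / ((w - (w' + 2 * (k * w'))) * w') * (w * B) =
    (1 + 2 * k) * (w / v) * B.
  have vE : w - (w' + 2 * (k * w')) = v by rewrite w'E /v; ring.
  by rewrite vE w'E; field; rewrite !gt_eqF.
rewrite mulrA ler_wpM2r//.
have -> : 5 * k = k + k + 2 * k + k by ring.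
rewrite !expRD -mulrA [leRHS]mulrC [leRHS]mulrA.
have e1 : 1 + k <= expR k by exact: expR_ge1Dx.
have e2 : 1 + 2 * k <= expR (2 * k) by exact: expR_ge1Dx.
have wv : w / v <= expR k by rewrite ler_pdivrMr// (le_trans vw)// ler_pM2r.
have wv0 : 0 <= w / v by rewrite divr_ge0// ltW.
have ek := expR_gt0 k.
have : (1 + k) ^+ 2 <= expR k * expR k by rewrite expr2 ler_pM//; lra.
have : (1 + 2 * k) * (w / v) <= expR (2 * k) * expR k by rewrite ler_pM//; lra.
move=> h1 h2.
rewrite [leRHS](_ : _ = (expR k * expR k) * (expR (2 * k) * expR k)); last by ring.
by rewrite ler_pM// ?sqr_ge0// mulr_ge0//; lra.
Qed.

(** The three summands of the exponent account for [32 = 2 ^ 5], for [half j] and for [scale j.+1]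
    in [mesh_small]. *)
Definition mesh_inv j := (2 ^ (5 + j + 2 ^ j.+3))%N.

Lemma mesh_small j : 16 * (2 / (mesh_inv j)%:R) <= half j * scale j.+1 :> R.
Proof.
rewrite /mesh_inv natrX mulrA ler_pdivrMr ?exprn_gt0// /scale /half.
rewrite -exprD exprVn.
rewrite (_ : (5 + j + 2 ^ j.+3)%N = (5 + (j + 2 ^ j.+3))%N); last by rewrite addnA.
set n := (j + _)%N; rewrite [2 ^+ (5 + n)]exprD mulrCA mulVf ?mulr1.
  by rewrite -natrX -natrM ler_nat.
by rewrite expf_neq0.
Qed.

Let exponentE (c : nat) : (5 + 4 * c = (c.+1 * 4).+1)%N.
Proof. by lia. Qed.

(** Put [X = 2 ^ j = k^-1]. A cell has area of order [X * w ^ 3], so its density is of order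
    [X * w ^ al]; the division by [k] and the logarithm of the net cost one factor [X] each, and a
    fourth one is spent to gain [k]. Since [w ^ al] is exponentially small in [X],
    [polynomial_decay] applies. *)
Lemma step_cost (sg : R) : 2 / 3 < sg <= 1 -> exists2 C : R, 0 < C &
  forall j (k w w' : R), k = half j -> w = scale j -> w' = scale j.+1 ->
  6 * ((w * 2 ^+ j.+2 * (w' + 2 * (k * w'))) `^ sg / w') / k *
    (1 + ln (2 * (mesh_inv j).+1 ^ 4)%:R) <= C * k.
Proof.
move=> /andP[sg0 sg1]; pose al := 3 * sg - 2.
have ln2 : 0 < ln 2 :> R by rewrite ln_gt0// ltr1n.
have ln2_1 : ln 2 <= 1 :> R by have := @le_ln1Dx R 1; rewrite -natr1; apply; lra.
have al0 : 0 < al by rewrite /al; lra.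
have be0 : 0 < 4 * al * ln 2 by rewrite !mulr_gt0.
have [C0 C00 hC0] := polynomial_decay be0.
exists (6 * (12 * (62 * C0))); first by rewrite !mulr_gt0.
move=> j k w w' kE wE' w'E'; pose X : R := 2 ^+ j.
have X1 : 1 <= X by rewrite exprn_ege1// ler1n.
have kX : k * X = 1 by rewrite kE; exact: half_expn.
have k0 : 0 < k by rewrite kE; exact: half_gt0.
have k1 : k <= 1 by rewrite kE; exact: half_le1.
have w0 : 0 < w by rewrite wE'; exact: scale_gt0.
have w'E : w' = w ^+ 2 by rewrite w'E' wE'; exact: scaleS.
have wE : w `^ al = expR (- (4 * al * ln 2 * X)).
  rewrite /powR gt_eqF// wE' /scale /half lnXn ?invr_gt0// lnV ?posrE//.
  congr expR; rewrite /X -[_ *+ _]mulr_natr natrX !exprS; ring.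
have w'0 : 0 < w' by rewrite w'E exprn_gt0.
have X0 : 0 < X by lra.
pose b := (w * 2 ^+ j.+2 * (w' + 2 * (k * w'))) `^ sg / w'.
have hb : b <= 12 * X * w `^ al.
  rewrite /b ler_pdivrMr; last by rewrite w'E exprn_gt0.
  apply: (@le_trans _ _ ((12 * X * w ^+ 3) `^ sg)).
    have sg00 : 0 <= sg by lra.
    apply: (ge0_ler_powR sg00); rewrite ?nnegrE.
    - apply/ltW/mulr_gt0; first by rewrite mulr_gt0// exprn_gt0.
      by rewrite addr_gt0// !mulr_gt0.
    - by apply/ltW; rewrite !mulr_gt0// exprn_gt0.
    - have -> : w * 2 ^+ j.+2 * (w' + 2 * (k * w')) =
        (4 * X * w ^+ 3) * (1 + 2 * k) by rewrite w'E /X !exprS; ring.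
      have -> : 12 * X * w ^+ 3 = (4 * X * w ^+ 3) * 3 by ring.
      by rewrite ler_pM2l; [lra | rewrite !mulr_gt0// exprn_gt0].
  have X12 : 0 <= 12 * X by lra.
  have w30 : 0 <= w ^+ 3 by apply/ltW; rewrite exprn_gt0.
  rewrite (powRM _ X12 w30).
  have -> : 12 * X * w `^ al * w' = (12 * X) `^ 1 * (w ^+ 3) `^ sg.
    rewrite (powRr1 X12).
    rewrite -mulrA; congr (_ * _); rewrite w'E -!powR_mulrn ?ltW//.
    rewrite -powRrM -powRD; first by congr (_ `^ _); rewrite /al; ring.
    by rewrite (gt_eqF w0) implybT.
  rewrite ler_wpM2r ?powR_ge0// ler_powR//; lra.
have hN : 1 + ln (2 * (mesh_inv j).+1 ^ 4)%:R <= 62 * X.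
  have : ln (2 * (mesh_inv j).+1 ^ 4)%:R <= ln (2 ^+ (5 + 4 * (5 + j + 2 ^ j.+3)) : R).
    rewrite ler_ln ?posrE ?exprn_gt0// ?ltr0n ?muln_gt0 ?expn_gt0//.
    have -> : (5 + 4 * (5 + j + 2 ^ j.+3) = ((5 + j + 2 ^ j.+3).+1 * 4).+1)%N.
      exact: exponentE.
    rewrite -natrX ler_nat (expnS 2 (_ * 4)) (expnM 2 _ 4) (expnS 2 (5 + j + _)).
    rewrite -/(mesh_inv j).
    rewrite leq_mul2l/= leq_exp2r//.
    have : (0 < mesh_inv j)%N by rewrite expn_gt0.
    exact: ltn_Pmull.
  rewrite lnXn// -[ln 2 *+ _]mulr_natl => h.
  have jX : j%:R <= X by rewrite /X -natrX ler_nat ltnW// ltn_expl.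
  have hx : (5 + 4 * (5 + j + 2 ^ j.+3))%:R = 25 + 4 * j%:R + 32 * X :> R.
    by rewrite !(natrD, natrM, natrX) !exprS -/X; ring.
  rewrite hx in h.
  have j0 : 0 <= j%:R :> R by [].
  have : (25 + 4 * j%:R + 32 * X) * ln 2 <= (25 + 4 * j%:R + 32 * X) * 1.
    by rewrite ler_wpM2l//; lra.
  by move: h; lra.
have kV : k^-1 = X by apply: (mulfI (lt0r_neq0 k0)); rewrite divff ?lt0r_neq0.
have b0 : 0 <= b by rewrite /b divr_ge0 ?powR_ge0// w'E exprn_ge0// ltW.
rewrite -/b kV.
apply: (@le_trans _ _ (6 * (12 * X * w `^ al) * X * (62 * X))).
  have N0 : 0 <= 1 + ln (2 * (mesh_inv j).+1 ^ 4)%:R :> R.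
    by rewrite addr_ge0// ln_ge0// ler1n muln_gt0 expn_gt0.
  have X0' := ltW X0.
  apply: ler_pM => //; first by apply: mulr_ge0 => //; exact: mulr_ge0.
  by apply: ler_wpM2r => //; rewrite ler_pM2l.
have := hC0 X (le_trans ler01 X1); rewrite -wE => h.
have -> : 6 * (12 * X * w `^ al) * X * (62 * X) =
    6 * (12 * (62 * (X ^+ 4 * w `^ al))) * k.
  have -> : X ^+ 4 * w `^ al = X ^+ 3 * w `^ al * X by ring.
  rewrite [RHS](_ : _ = 6 * (12 * (62 * (X ^+ 3 * w `^ al))) * (k * X)); last by ring.
  by rewrite kX; ring.
by rewrite ler_pM2r// !ler_pM2l.
Qed.

End Scales.

Section GraphSequence.
Context {R : realType}.

(** By Hölder's inequality a function of unit p-norm satisfies such a bound with exponent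
    [1 - p^-1]. The box contains all strips that occur. *)
Definition small_on_box (rho : R * R -> \bar R) (sg : R) :=
  forall q (S : set (R * R)) (a : R), measurable S ->
  (forall z, S z -> -1 <= z.1 <= 2 /\ 0 <= z.2 <= 1) -> 0 <= a ->
  (leb2 S <= a%:E)%E -> (gain rho q S <= (a `^ sg)%:E)%E.

Definition Z2_periodic (rho : R * R -> \bar R) :=
  forall (a b : int) z, rho (z.1 + a%:~R, z.2 + b%:~R) = rho z.

Lemma graph_sequence (sg : R) : 2 / 3 < sg <= 1 -> exists2 A : R, 0 < A &
  forall rho : R * R -> \bar R, measurable_fun setT rho ->
  (forall z, (0 <= rho z)%E) -> Z2_periodic rho -> small_on_box rho sg ->
  exists f : nat -> R -> R, forall j,
  [/\ forall x y, `|f j x - f j y| <= `|x - y|,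
      forall x, 0 <= f j x /\ f j x + scale j <= 1,
      forall x, f j x <= f j.+1 x /\ f j.+1 x + scale j.+1 <= f j x + scale j &
      forall q, (gain rho q (strip (- scale j) (1 + scale j) 0 (scale j) (f j))
        <= (scale j * A)%:E)%E].
Proof.
move=> sg01; have [C C0 hC] := step_cost sg01.
(* Since [half j = 2 * (half j - half j.+1)], the factors [expR (5 * half j)] and the costs
   [C * half j] telescope. The initial value 16 is the density bound for a strip of width 1/16 and
   mass at most 1. *)
pose B j := expR (10 * (1 - half j)) * (16 + 2 * C * (1 - half j)) : R.
have half01 j : 0 <= 1 - half j :> R by rewrite subr_ge0 half_le1.
have CB j : 0 <= 2 * C * (1 - half j) by rewrite !mulr_ge0// ltW.
have B0 j : 0 <= B j by rewrite mulr_ge0 ?expR_ge0//; have := CB j; lra.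
exists (expR 10 * (16 + 2 * C)); first by rewrite mulr_gt0 ?expR_gt0//; lra.
move=> rho mrho rho0 per small.
have BA j : B j <= expR 10 * (16 + 2 * C).
  have := half_gt0 (R := R) j => h.
  rewrite ler_pM ?expR_ge0 ?ler_expR//; first by have := CB j; lra.
    by lra.
  by rewrite lerD2l ler_piMr//; [rewrite mulr_ge0// ltW|lra].
pose Inv j (f : R -> R) := [/\ forall x y, `|f x - f y| <= (1 - half j) * `|x - y|,
  forall x, 0 <= f x /\ f x + scale j <= 1 &
  forall q, (gain rho q (strip (- scale j) (1 + scale j) 0 (scale j) f)
        <= (scale j * B j)%:E)%E].
have Inv0 : Inv 0%N (cst 0).
  have s0 : scale 0 = 16^-1 :> R by rewrite /scale /half exprVn -natrX.
  split => [x y|x|q].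
  - by rewrite subrr normr0 mulr_ge0.
  - by rewrite s0 /=; split; lra.
  have -> : B 0%N = 16 by rewrite /B /half expr0 subrr !mulr0 expR0 addr0 mul1r.
  rewrite s0 mulVf//.
  have := small q (strip (- 16^-1) (1 + 16^-1) 0 16^-1 (cst 0)) 1.
  rewrite powR1; apply => //.
  - exact: measurable_strip.
  - by move=> z /and4P[] /=; rewrite subr0 => *; split; lra.
  apply: le_trans (strip_area (g := cst 0) (d := 16^-1) _ _ _ (@subset_refl _ _)) _ => //.
  - lra.
  - exact: measurable_strip.
  - by rewrite lee_fin; lra.
have step j f : Inv j f -> exists f', Inv j.+1 f' /\
    forall x, f x <= f' x /\ f' x + scale j.+1 <= f x + scale j.
  move=> [flip f01 fB].
  have [|T [net [cardT netP]]] := @motion_net R (mesh_inv j).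
    by rewrite /mesh_inv expn_gt0.
  have w0 := scale_gt0 (R := R) j; have w16 := scale_le16 (R := R) j.
  have k0 := half_gt0 (R := R) j; have k1 := half_le1 (R := R) j.
  (* With this cell length the step adds [2 * w / l = half j.+1] to the Lipschitz constant, and
     these increments sum to 1. *)
  have l0 : 0 < scale j * 2 ^+ j.+2 :> R by rewrite mulr_gt0// exprn_gt0.
  have lE : 2 * scale j / (scale j * 2 ^+ j.+2) = half j.+1 :> R.
    rewrite /half exprVn !exprS; field.
    by rewrite gt_eqF//= expf_neq0.
  have LE : 1 - half j + half j.+1 = 1 - half j.+1 :> R by rewrite halfS; field.
  have [||||f' [f'lip ff' f'B]] := refine_graph (k := half j) mrho rho0 per small
    netP flip f01 _ (scale_gt0 j.+1) _ l0 _ (mesh_small j) _ fB.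
  - by apply/andP; split => //; lra.
  - by rewrite k0.
  - by rewrite scaleS; nra.
  - by rewrite lE LE; have := half_gt0 (R := R) j.+1; lra.
  move: f'lip; rewrite lE LE => f'lip.
  exists f'; split => //; split => //.
    by move=> x; have [? ?] := f01 x; have [? ?] := ff' x; split; lra.
  move=> q; apply: le_trans (f'B q) _; rewrite lee_fin ler_pM2l ?scale_gt0//.
  rewrite cardT; apply: le_trans.
    apply: lerD; first exact: (growth_factor (B0 j) erefl erefl erefl).
    exact: (hC j _ _ _ erefl erefl erefl).
  have -> : B j.+1 = expR (5 * half j) * B j + expR (10 * (1 - half j.+1)) * (C * half j).
    rewrite /B mulrA -expRD.
    have -> : 5 * half j + 10 * (1 - half j) = 10 * (1 - half j.+1) :> R.
      by rewrite halfS; field.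
    by rewrite -mulrDr; congr (_ * _); rewrite halfS; field.
  rewrite lerD2l -[leLHS]mul1r ler_wpM2r//; first by rewrite mulr_ge0// ltW.
  by apply: le_trans (expR_ge1Dx _); rewrite lerDl mulr_ge0.
pose next j (u : {f | Inv j f}) : {f | Inv j.+1 f} :=
  let e := cid (step j (sval u) (svalP u)) in exist _ (sval e) (svalP e).1.
pose fix seqf j : {f | Inv j f} :=
  if j is i.+1 then next i (seqf i) else exist _ _ Inv0.
exists (fun j => sval (seqf j)) => j.
have [flip f01 fB] := svalP (seqf j); split => //.
- move=> x y; apply: le_trans (flip x y) _; rewrite ler_piMl//.
  by have := half_gt0 (R := R) j; lra.
- exact: (svalP (cid (step j (sval (seqf j)) (svalP (seqf j))))).2.
- by move=> q; apply: le_trans (fB q) _; rewrite lee_fin ler_pM2l ?scale_gt0.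
Qed.

End GraphSequence.

Section LimitGraph.
Context {R : realType}.
Local Notation mu := (@lebesgue_measure R).

Lemma limn_einfE (u : (\bar R)^nat) : limn_einf u = ereal_sup (range (einfs u)).
Proof. by rewrite limn_einf_lim; apply/cvg_lim => //; exact: cvg_einfs_sup. Qed.

Lemma limn_einf_le (u : (\bar R)^nat) (A : \bar R) : (forall n, u n <= A)%E ->
  (limn_einf u <= A)%E.
Proof.
move=> uA; rewrite limn_einfE; apply: ge_ereal_sup => _ [n _ <-].
by apply: le_trans (uA n); apply: ereal_inf_lbound; exists n => //=.
Qed.

Lemma le_limn_einf (u : (\bar R)^nat) (A : \bar R) N :
  (forall n, (N <= n)%N -> A <= u n)%E -> (A <= limn_einf u)%E.
Proof.
move=> uA; rewrite limn_einfE; apply: (@le_trans _ _ (einfs u N)).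
  by apply: le_ereal_inf_tmp => _ [n /= Nn <-]; exact: uA.
by apply: ereal_sup_ubound; exists N.
Qed.

Lemma half_small (e : R) : 0 < e -> exists j, half j < e.
Proof.
move=> e0; exists (Num.truncn e^-1).+1.
have := Num.Theory.truncnS_gt e^-1; set n := _.+1 => en.
have n0 : 0 < n%:R :> R by rewrite ltr0n.
have : half n * n%:R < 1 :> R.
  rewrite -[ltRHS](half_expn n) ltr_pM2l ?half_gt0// -natrX ltr_nat.
  exact: ltn_expl.
have := half_gt0 (R := R) n => h0 h1.
have : e^-1 * half n < 1 by apply: le_lt_trans h1; rewrite mulrC ler_pM2l// ltW.
by rewrite -ltr_pdivlMl ?invr_gt0// invrK mulr1.
Qed.

Lemma move_vertical q (x y y' e : R) : `|y - y'| < e ->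
  `|(move q (x, y)).1 - (move q (x, y')).1| < e /\
  `|(move q (x, y)).2 - (move q (x, y')).2| < e.
Proof.
move=> ye.
have prod (c : R) : `|c| <= 1 -> `|c * (y - y')| < e.
  move=> c1; apply: le_lt_trans ye; rewrite normrM -[leRHS]mul1r.
  by rewrite ler_wpM2r.
have := prod _ (mc_le1 q); have := prod _ (ms_le1 q).
rewrite /move /rigid/= !ltr_norml => /andP[? ?] /andP[? ?].
by case: (mb q); split; apply/andP; split; lra.
Qed.

Variable rho : R * R -> \bar R.
Hypothesis mrho : measurable_fun setT rho.
Hypothesis rho0 : forall z, (0 <= rho z)%E.
Hypothesis lsc : forall t : R, open [set z | (t%:E < rho z)%E].

Lemma limit_graph (f : nat -> R -> R) (A : R) :
  (forall j, [/\ forall x y, `|f j x - f j y| <= `|x - y|,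
      forall x, 0 <= f j x /\ f j x + scale j <= 1,
      forall x, f j x <= f j.+1 x /\ f j.+1 x + scale j.+1 <= f j x + scale j &
      forall q, (gain rho q (strip (- scale j) (1 + scale j) 0 (scale j) (f j))
        <= (scale j * A)%:E)%E]) ->
  exists g : R -> R, [/\ forall x y, `|g x - g y| <= `|x - y|,
    forall x, 0 <= g x <= 1 &
    forall q, (\int[mu]_x ((\1_(`[0%R, 1%R] : set R) x : R)%:E *
       rho (move q (x, g x))) <= A%:E)%E].
Proof.
move=> H.
have f_up i j x : (i <= j)%N ->
    f i x <= f j x /\ f j x + scale j <= f i x + scale i.
  move=> /subnK <-; elim: (j - i)%N => [|n [IH1 IH2]]; first by rewrite add0n.
  have [_ _ /(_ x)[h1 h2] _] := H (n + i)%N.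
  by rewrite addSn; split; [exact: le_trans IH1 h1|exact: le_trans h2 IH2].
pose E x := range (fun j => f j x).
pose g x := sup (E x).
have fle i j x : f i x <= f j x + scale j.
  have [ij|/ltnW ij] := leqP i j.
    by have [h _] := f_up _ _ x ij; have := scale_gt0 (R := R) j; lra.
  by have [_ h] := f_up _ _ x ij; have := scale_gt0 (R := R) i; lra.
have E0 x : E x !=set0 by exists (f 0%N x); exists 0%N.
have fg j x : f j x <= g x.
  apply: ub_le_sup; last by exists j.
  by exists (f 0%N x + scale 0) => _ [i _ <-]; exact: fle.
have gf j x : g x <= f j x + scale j.
  by apply: ge_sup => // _ [i _ <-]; exact: fle.
have g_half x y : g x <= g y + `|x - y|.
  apply: ge_sup => // _ [i _ <-]; have [/(_ x y) + _ _ _] := H i.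
  by rewrite ler_norml => /andP[_ h]; have := fg i y; lra.
have glip x y : `|g x - g y| <= `|x - y|.
  have h1 := g_half x y; have h2 := g_half y x; rewrite distrC in h2.
  by rewrite ler_norml; apply/andP; split; lra.
exists g; split => // [x|q].
  have [_ /(_ x)[h1 h2] _ _] := H 0%N; have h3 := fg 0%N x; have h4 := gf 0%N x.
  by apply/andP; split; lra.
have mg : measurable_fun setT g.
  by apply: (@measurable_lip _ 1) => x y; rewrite mul1r.
pose S j := strip (- scale j) (1 + scale j) 0 (scale j) (f j).
have mf j : measurable_fun setT (f j).
  apply: (@measurable_lip _ 1) => x y; rewrite mul1r.
  by have [] := H j.
have mS j : measurable (S j) by exact: measurable_strip.
pose h j (z : R * R) : \bar R := ((\1_(S j) z : R)%:E * rho (move q z))%E.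
have mh j : measurable_fun setT (h j) by exact: measurable_gain.
have h0 j z : (0 <= h j z)%E by exact: gain_integrand_ge0.
(* [G j x] is the mean of [rho] over the fibre of the [j]-th strip above [x].  By
   lower semicontinuity the lower limit of these means is at least the value of
   [rho] at the limit point, and Fatou's lemma applies. *)
pose G j x : \bar R := ((scale j)^-1%:E * \int[mu]_y h j (x, y))%E.
have G0 j x : (0 <= G j x)%E.
  rewrite mule_ge0 ?lee_fin ?invr_ge0; [by []|exact/ltW/scale_gt0|].
  exact: integral_ge0.
have mG j : measurable_fun setT (G j).
  by apply: measurable_funeM; exact: measurable_integral2.
have intG j : (\int[mu]_x G j x <= A%:E)%E.
  rewrite ge0_integralZl//; last 3 first.
  - exact: measurable_integral2.
  - by move=> x _; exact: integral_ge0.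
  - by rewrite lee_fin invr_ge0; exact/ltW/scale_gt0.
  rewrite -leb2E// -[(\int[_]_z _)%E]/(gain rho q (S j)).
  have [_ _ _ /(_ q) gA] := H j.
  apply: (@le_trans _ _ ((scale j)^-1%:E * (scale j * A)%:E)%E).
    by apply: lee_wpmul2l => //; rewrite lee_fin invr_ge0; exact/ltW/scale_gt0.
  by rewrite -EFinM mulKf// gt_eqF// scale_gt0.
apply: (@le_trans _ _ (\int[mu]_x limn_einf (G ^~ x))%E); last first.
  apply: le_trans (fatou mu measurableT mG (fun n x _ => G0 n x)) _.
  exact: limn_einf_le.
apply: ge0_le_integral => //.
- by move=> x _; rewrite mule_ge0// lee_fin.
- apply: emeasurable_funM.
    by apply/measurable_EFinP; exact: measurable_indic.
  apply: (measurableT_comp mrho); apply: (measurableT_comp (measurable_move q)).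
  exact: measurable_fun_pair.
- rewrite (_ : (fun x => _) = (fun x => esups (fun n => einfs (G ^~ x) n) 0%N)).
    by apply: measurable_fun_esups => n; exact: measurable_fun_einfs.
  apply/funext => x; rewrite limn_einfE; congr ereal_sup.
  by apply/seteqP; split => y [n _ <-]; exists n.
move=> x _; rewrite indicE.
have [|_] := boolP (x \in _); last by rewrite mul0e; apply: (@le_limn_einf _ _ 0%N).
rewrite inE/= in_itv/= mul1e => x01.
(* Where [rho] exceeds [t] at the limit point, it does so on a ball; the moved fibres shrink to that
   point and end up in the ball, so their means are at least [t]. *)
have key (t : R) : (t%:E < rho (move q (x, g x)))%E -> (t%:E <= limn_einf (G ^~ x))%E.
  move=> tlt; have [t0|t0] := leP t 0.
    apply: (@le_trans _ _ 0%E); first by rewrite lee_fin.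
    by apply: (@le_limn_einf _ _ 0%N).
  have := @lsc t; rewrite openE => /(_ _ tlt) /nbhs_ballP[e /= e0 be].
  have [N Ne] := half_small e0.
  apply: (@le_limn_einf _ _ N) => j Nj.
  have w0 := scale_gt0 (R := R) j.
  have we : scale j < e.
    apply: le_lt_trans Ne; apply: (le_trans (scale_le j)).
    have := le_half (R := R) Nj; have := half_gt0 (R := R) j; lra.
  apply: (@le_trans _ _ ((scale j)^-1%:E * \int[mu]_y
      ((\1_(`[f j x, f j x + scale j] : set R) y : R)%:E * t%:E))%E).
    rewrite ge0_integralZr//; last 2 first.
    - by apply/measurable_EFinP; exact: measurable_indic.
    - by rewrite lee_fin ltW.
    rewrite (_ : (\int[mu]_y _)%E = mu `[f j x, f j x + scale j]); last first.
      by rewrite integral_indic// setIT.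
    rewrite lebesgue_measure_itv/= lte_fin ltrDl w0 -EFinB addrAC subrr add0r.
    by rewrite -!EFinM mulKf// gt_eqF.
  apply: lee_wpmul2l; first by rewrite lee_fin invr_ge0 ltW.
  apply: ge0_le_integral => //.
  - by move=> y _; rewrite mule_ge0// lee_fin// ltW.
  - apply: emeasurable_funM => //.
    by apply/measurable_EFinP; exact: measurable_indic.
  - by apply: (measurableT_comp (mh j)); exact: measurable_fun_pair.
  move=> y _; rewrite indicE; have [|_] := boolP (y \in _); last by rewrite mul0e.
  rewrite inE/= in_itv/= mul1e => /andP[y1 y2].
  rewrite /h indicE mem_set ?mul1e; last by apply/and4P; rewrite /=; split; lra.
  apply/ltW/be.
  have ye : `|g x - y| < e.
    have := fg j x; have := gf j x; rewrite ltr_norml => *; lra.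
  by have [] := move_vertical q x ye; split.
case E1 : (rho (move q (x, g x))) => [r| |].
- apply/lee_subgt0Pr => e e0; rewrite -EFinB; apply: key; rewrite E1 lte_fin; lra.
- by rewrite leye_eq; apply/eqP/eq_infty => r; apply: key; rewrite E1 ltry.
- by have := rho0 (move q (x, g x)); rewrite E1.
Qed.

End LimitGraph.

(** * The lower semicontinuous periodic majorant *)

Section OuterRegularity.
Context {R : realType}.
Local Notation mu := (@lebesgue_measure R).

Lemma open_preimage_lip (phi : R * R -> R * R) (K : R) (U : set (R * R)) : 0 < K ->
  (forall z z' e, `|z.1 - z'.1| < e -> `|z.2 - z'.2| < e ->
     `|(phi z).1 - (phi z').1| < K * e /\ `|(phi z).2 - (phi z').2| < K * e) ->
  open U -> open (phi @^-1` U).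
Proof.
move=> K0 lip; rewrite !openE => oU z /= /oU /nbhs_ballP[e /= e0 eU].
apply/nbhs_ballP; exists (e / K); first by rewrite /= divr_gt0.
move=> z' [z1 z2]; apply: eU.
by have := lip z z' _ z1 z2; rewrite mulrC divfK ?gt_eqF// => -[h1 h2]; split.
Qed.

Lemma le_leb2 (A B : set (R * R)) : measurable A -> measurable B -> A `<=` B ->
  (leb2 A <= leb2 B)%E.
Proof. by move=> mA mB AB; apply: le_measure; rewrite ?inE. Qed.

Lemma leb2_subadditive (A : set (R * R)) (F : nat -> set (R * R)) :
  measurable A -> (forall n, measurable (F n)) -> A `<=` \bigcup_n F n ->
  (leb2 A <= \sum_(n <oo) leb2 (F n))%E.
Proof. by move=> mA mF AF; exact: (measure_sigma_subadditive leb2 mF mA AF). Qed.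

Lemma leb2_nonincreasing (F : nat -> set (R * R)) :
  (leb2 (F 0%N) < +oo)%E -> (forall n, measurable (F n)) ->
  (forall n m, (n <= m)%N -> F m `<=` F n) ->
  leb2 (F n) @[n --> \oo] --> leb2 (\bigcap_n F n).
Proof.
move=> F0 mF nF; apply: (nonincreasing_cvg_mu (mu := leb2) F0 mF).
  exact: bigcapT_measurable.
by move=> n m nm; apply/subsetPset; exact: nF.
Qed.

(** The sigma-algebra of the plane is the product one, so the open set is written as a countable
    union of rational boxes. *)
Lemma open_measurable_plane (U : set (R * R)) : open U -> measurable U.
Proof.
move=> oU.
pose box (a b : rat) (n : nat) : set (R * R) :=
  ball (ratr a : R) (n.+1%:R^-1) `*` ball (ratr b : R) (n.+1%:R^-1).
pose F (a b : rat) (n : nat) := if `[< box a b n `<=` U >] then box a b n else set0.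
have -> : U = \bigcup_a \bigcup_b \bigcup_n F a b n.
  apply/seteqP; split => z; last first.
    move=> [a _ [b _ [n _]]]; rewrite /F; case: asboolP => // bU; exact: bU.
  move=> Uz; have : nbhs z U by exact: open_nbhs_nbhs.
  move=> /nbhs_ballP[e /= e0 zU].
  pose n := Num.truncn (2 / e).
  have n0 : 0 < n.+1%:R :> R by rewrite ltr0n.
  have ne : n.+1%:R^-1 < e / 2.
    rewrite -[e / 2]invrK ltf_pV2 ?posrE ?invr_gt0 ?divr_gt0// invf_div.
    exact: Num.Theory.truncnS_gt.
  have nV : 0 < n.+1%:R^-1 :> R by rewrite invr_gt0.
  have near (x : R) : exists q : rat, `|ratr q - x| < n.+1%:R^-1.
    have [|q] := @rat_in_itvoo R x (x + n.+1%:R^-1); first by rewrite ltrDl.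
    rewrite in_itv/= => qx; exists q; rewrite ltr_norml.
    by move: (ratr q) (n.+1%:R^-1) qx nV => r v *; lra.
  have [a az] := near z.1; have [b bz] := near z.2.
  exists a => //; exists b => //; exists n => //.
  rewrite /F; case: asboolP => [_|]; first by split.
  case => u [/= u1 u2]; apply: zU; move: u1 u2 az bz.
  rewrite /ball/= /prod_ball /ball/= !ltr_norml.
  by move: (ratr a) (ratr b) (n.+1%:R^-1) ne => r r' v *; split; lra.
apply: bigcupT_measurable_rat => a; apply: bigcupT_measurable_rat => b.
apply: bigcupT_measurable => n; rewrite /F; case: ifP => // _.
by apply: measurableX; exact: measurable_ball.
Qed.

Lemma closed_measurable_plane (C : set (R * R)) : closed C -> measurable C.
Proof.
by move=> cC; have := measurableC (open_measurable_plane (closed_openC cC)); rewrite setCK.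
Qed.

(** A bounded window makes all areas finite, as continuity from above requires in
    [approx_bigcup]. *)
Let Q (M : R) : set (R * R) := `]-M, M[ `*` `]-M, M[.

Let mQ M : measurable (Q M). Proof. exact: measurableX. Qed.

Let Qfin M (A : set (R * R)) : measurable A -> (leb2 (A `&` Q M) < +oo)%E.
Proof.
move=> mA; apply: (@le_lt_trans _ _ (leb2 (Q M))).
  by apply: le_leb2 => [||z []] //; exact: measurableI.
rewrite leb2_setX// !lebesgue_measure_itv/= lte_fin.
by case: ifP => _; rewrite ?mule0 ?ltry// -EFinB -EFinM ltry.
Qed.

(* The sets satisfying [approx M] form a sigma-algebra containing the strips
   parallel to the axes. *)
Let approx M (A : set (R * R)) := forall e : R, 0 < e ->
  exists U C, [/\ open U, closed C, C `<=` A, A `<=` U &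
    (leb2 ((U `\` C) `&` Q M) <= e%:E)%E].

Let approx_strip M (A : set R) : measurable A -> approx M (A `*` setT).
Proof.
move=> mA e e0; pose I : set R := `[-M, M]%classic.
pose d : R := e / (4 * (`|M| + 1)).
have M0 : 0 < `|M| + 1 by rewrite ltr_wpDl.
have d0 : 0 < d by rewrite divr_gt0// mulr_gt0.
have mI : measurable I by exact: measurable_itv.
have mAI : measurable (A `&` I) by exact: measurableI.
have muI : (mu I <= (2 * `|M|)%:E)%E.
  rewrite /I lebesgue_measure_itv/= lte_fin; case: ifP => _; last by rewrite lee_fin.
  by rewrite -EFinB lee_fin; have := ler_norm M; lra.
have AIfin : (mu (A `&` I) < +oo)%E.
  apply: (@le_lt_trans _ _ (mu I)); last by apply: le_lt_trans muI _; rewrite ltry.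
  by apply: le_measure; rewrite ?inE//; move=> x [].
have [U [oU AU UA]] := lebesgue_regularity_outer mAI AIfin d0.
have [K [cK KA AK]] := lebesgue_regularity_inner mAI AIfin d0.
have mK : measurable K by exact: compact_measurable.
have mU : measurable U by exact: open_measurable.
have mUK : measurable (U `\` K) by exact: measurableD.
(* Adding the complement of [I] makes the open set contain all of [A] and changes nothing inside the
   window. *)
pose U' := U `|` ~` I.
have oU' : open U'.
  by apply: openU => //; apply: closed_openC; exact: interval_closed.
have muUK : (mu (U `\` K) <= (2 * d)%:E)%E.
  apply: (@le_trans _ _ (mu ((U `\` (A `&` I)) `|` ((A `&` I) `\` K)))).
    apply: le_measure; rewrite ?inE//.
      by apply: measurableU; exact: measurableD.
    move=> x [Ux nKx]; have [AIx|nAIx] := pselect ((A `&` I) x); first by right; split.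
    by left; split.
  apply: (le_trans (measureU2 _ _ _)); [exact: measurableD|exact: measurableD|].
  by rewrite (_ : 2 * d = d + d) ?EFinD; [exact: leeD (ltW UA) (ltW AK)|ring].
exists (fst @^-1` U'), (fst @^-1` K); split.
- by apply: open_comp => // x _; exact: cvg_fst.
- apply: closed_comp => // [x _|]; first exact: cvg_fst.
  exact: compact_closed.
- by move=> [x y] /= /KA[? _].
- move=> [x y] /= [Ax _]; have [Ix|nIx] := pselect (I x); last by right.
  by left; apply: AU; split.
apply: (@le_trans _ _ (leb2 ((U `\` K) `*` I))).
  apply: le_leb2.
  - apply: measurableI => //; apply: measurableD.
      rewrite -[fst @^-1` _]setTI; apply: measurable_fst => //.
      apply: measurableU => //; apply: measurableC.
      exact: measurable_itv.
    by rewrite -[fst @^-1` _]setTI; exact: measurable_fst.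
  - exact: measurableX.
  move=> [x y] /= [[[Ux|nI] nK]]; rewrite /Q/= !in_itv/= => -[xM yM].
    by split; [split|rewrite /I/= in_itv/=; lra].
  by case: nI; rewrite /I/= in_itv/=; lra.
rewrite leb2_setX//; apply: (@le_trans _ _ ((2 * d)%:E * (2 * `|M|)%:E)%E).
  exact: lee_pmul.
rewrite -EFinM lee_fin /d.
have -> : 2 * (e / (4 * (`|M| + 1))) * (2 * `|M|) = e * (`|M| / (`|M| + 1)).
  by field; rewrite gt_eqF.
by rewrite ler_piMr ?(ltW e0)// ler_pdivrMr// mul1r lerDl.
Qed.

Let swap (z : R * R) := (z.2, z.1).

Let mswap : measurable_fun setT swap. Proof. exact: measurable_fun_pair. Qed.

Let leb2_preimage_swap (A : set (R * R)) : measurable A ->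
  leb2 (swap @^-1` A) = leb2 A.
Proof.
move=> mA.
have mA' : measurable (swap @^-1` A) by rewrite -[X in measurable X]setTI; exact: mswap.
transitivity (\int[leb2]_z (\1_(swap @^-1` A) z : R)%:E)%E.
  by rewrite integral_indic// setIT.
transitivity (\int[leb2]_z (\1_A z : R)%:E)%E; last by rewrite integral_indic// setIT.
rewrite -[RHS]leb2_swap//.
by apply/measurable_EFinP; exact: measurable_indic.
Qed.

Let open_swap (U : set (R * R)) : open U -> open (swap @^-1` U).
Proof.
by apply: (@open_preimage_lip _ 1) => // z z' e; rewrite mul1r => *; split.
Qed.

Let approx_swap M A : approx M A -> approx M (swap @^-1` A).
Proof.
move=> aA e e0; have [U [C [oU cC CA AU UC]]] := aA e e0.
exists (swap @^-1` U), (swap @^-1` C); split.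
- exact: open_swap.
- rewrite -openC -[X in open X]/(swap @^-1` (~` C)).
  by apply: open_swap; exact: closed_openC.
- by move=> z; exact: CA.
- by move=> z; exact: AU.
apply: le_trans UC; rewrite -[leRHS]leb2_preimage_swap.
  rewrite le_eqVlt; apply/orP; left; apply/eqP; congr leb2.
  by apply/seteqP; split => z /= [h [h1 h2]]; split => //; split.
apply: measurableI => //; apply: measurableD; first exact: open_measurable_plane.
exact: closed_measurable_plane.
Qed.

Let approx_setC M A : approx M A -> approx M (~` A).
Proof.
move=> aA e e0; have [U [C [oU cC CA AU UC]]] := aA e e0.
exists (~` C), (~` U); split.
- exact: closed_openC.
- exact: open_closedC.
- exact: subsetC.
- exact: subsetC.
rewrite (_ : ~` C `\` ~` U = U `\` C)//.
by apply/seteqP; split => z [h1 h2]; split => //; exact: contrapT.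
Qed.

(** An infinite union of closed sets need not be closed; by continuity from above, a finite part of
    it already loses little area in the window. *)
Let approx_bigcup M (A : nat -> set (R * R)) : (forall n, approx M (A n)) ->
  approx M (\bigcup_n A n).
Proof.
move=> aA e e0.
have e2 n : 0 < e / 2 / (2 ^ n.+1)%:R by rewrite !divr_gt0// ltr0n expn_gt0.
pose en n := e / 2 / (2 ^ n.+1)%:R.
have /choice[UC UCP] n : exists UC : set (R * R) * set (R * R),
    [/\ open UC.1, closed UC.2, UC.2 `<=` A n, A n `<=` UC.1 &
    (leb2 ((UC.1 `\` UC.2) `&` Q M) <= (en n)%:E)%E].
  by have [U [C h]] := aA n _ (e2 n); exists (U, C).
pose U := \bigcup_n (UC n).1.
pose C N := \bigcup_(i in `I_N) (UC i).2.
pose V N := (U `\` C N) `&` Q M.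
have oU : open U by apply: bigcup_open => n _; have [] := UCP n.
have cC N : closed (C N).
  rewrite /C bigcup_mkord; elim: N => [|N IH]; first by rewrite big_ord0; exact: closed0.
  by rewrite big_ord_recr/=; apply: closedU => //; have [] := UCP N.
have mU : measurable U by exact: open_measurable_plane.
have mV N : measurable (V N).
  apply: measurableI => //; apply: measurableD => //.
  exact: closed_measurable_plane.
have mW n : measurable (((UC n).1 `\` (UC n).2) `&` Q M).
  have [oUn cCn _ _ _] := UCP n.
  apply: measurableI => //; apply: measurableD.
    exact: open_measurable_plane.
  exact: closed_measurable_plane.
have Vcvg : leb2 (V N) @[N --> \oo] --> leb2 (\bigcap_N V N).
  apply: leb2_nonincreasing => //.
    by apply: Qfin; apply: measurableD => //; exact: closed_measurable_plane.
  move=> n m nm z [[Uz nC] Qz]; split => //; split => // Cz; apply: nC.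
  move: Cz; case => i /= il Ci.
  by exists i => //=; exact: leq_trans nm.
have capV : (leb2 (\bigcap_N V N) <= (e / 2)%:E)%E.
  apply: le_trans (epsilon_trick0 xpredT (_ : 0 <= e / 2)); last by rewrite divr_ge0// ltW.
  apply: le_trans (_ : _ <= \sum_(n <oo) leb2 (((UC n).1 `\` (UC n).2) `&` Q M))%E _.
    apply: leb2_subadditive => //; first exact: bigcapT_measurable.
    move=> z Vz; have [[[n _ Un] _] Qz] := Vz 0%N I.
    exists n => //; split => //; split => // Cn.
    have [[_ nC] _] := Vz n.+1 I; apply: nC.
    by exists n => /=.
  by apply: lee_nneseries => // n _; have [] := UCP n.
have [N VN] : exists N, (leb2 (V N) < e%:E)%E.
  apply: contrapT => /forallNP noN.
  have : (e%:E <= limn (fun N => leb2 (V N)))%E.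
    apply: lime_ge; first exact: cvgP Vcvg.
    by apply: nearW => N; rewrite leNgt; apply/negP/noN.
  rewrite (cvg_lim _ Vcvg)// => /le_trans/(_ capV).
  by rewrite lee_fin; lra.
exists U, (C N); split => //.
- move=> z [i /= iN Ci]; exists i => //.
  by have [_ _ + _ _] := UCP i; exact.
- by move=> z [n _ An]; exists n => //; have [_ _ _ + _] := UCP n; exact.
- exact: ltW.
Qed.

Let measurable_approx M (A : set (R * R)) : measurable A -> approx M A.
Proof.
move: A; apply: smallest_sub.
  split.
  - move=> e e0; exists set0, set0; split; [exact: open0|exact: closed0|by []|by []|].
    by rewrite setD0 set0I measure0 lee_fin ltW.
  - by move=> A; rewrite setTD; exact: approx_setC.
  - exact: approx_bigcup.
move=> A [[B mB <-]|[B mB <-]].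
  rewrite (_ : _ `&` _ = B `*` setT); first exact: approx_strip.
  by rewrite setTI; apply/seteqP; split => -[x y] //= [].
rewrite (_ : _ `&` _ = swap @^-1` (B `*` setT)).
  exact/approx_swap/approx_strip.
by rewrite setTI; apply/seteqP; split => -[x y] //= [].
Qed.

(** The n-th window is allotted the error [e / 2 ^ (n + 1)]; cutting each open set down to its own
    open window keeps it open and confines the excess. *)
Lemma leb2_regularity_outer (A : set (R * R)) (e : R) : measurable A -> 0 < e ->
  exists U, [/\ open U, A `<=` U & (leb2 U <= leb2 A + e%:E)%E].
Proof.
move=> mA e0.
have e2 n : 0 < e / (2 ^ n.+1)%:R by rewrite divr_gt0// ltr0n expn_gt0.
have /choice[U UP] n : exists U : set (R * R), [/\ open U, A `<=` U &
    (leb2 ((U `\` A) `&` Q n%:R) <= (e / (2 ^ n.+1)%:R)%:E)%E].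
  have [U [C [oU cC CA AU UC]]] := measurable_approx n%:R mA (e2 n).
  exists U; split => //; apply: le_trans UC.
  apply: le_leb2.
  - by apply: measurableI => //; apply: measurableD => //; exact: open_measurable_plane.
  - apply: measurableI => //; apply: measurableD; first exact: open_measurable_plane.
    exact: closed_measurable_plane.
  - by move=> z [[Uz nA] Qz]; split => //; split => // /CA.
have oQ M : open (Q M).
  rewrite openE => z [/= z1 z2].
  have oI : open (`]- M, M[%classic : set R) by exact: interval_open.
  have n1 : nbhs z.1 (`]- M, M[%classic : set R) by exact: open_nbhs_nbhs.
  have n2 : nbhs z.2 (`]- M, M[%classic : set R) by exact: open_nbhs_nbhs.
  by exists (`]- M, M[%classic, `]- M, M[%classic).
have mU n : measurable (U n) by have [oUn _ _] := UP n; exact: open_measurable_plane.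
have mW n : measurable ((U n `\` A) `&` Q n%:R).
  by apply: measurableI => //; exact: measurableD.
have mUQ : measurable (\bigcup_n (U n `&` Q n%:R)).
  by apply: bigcupT_measurable => n; exact: measurableI.
exists (\bigcup_n (U n `&` Q n%:R)); split.
- by apply: bigcup_open => n _; apply: openI => //; have [] := UP n.
- move=> z Az; pose n := (Num.truncn (`|z.1| + `|z.2|)).+1.
  have zn : `|z.1| + `|z.2| < n%:R by exact: Num.Theory.truncnS_gt.
  exists n => //; split; first by have [_ + _] := UP n; exact.
  have := normr_ge0 z.1; have := normr_ge0 z.2 => z2 z1.
  by split; rewrite /= in_itv/= -ltr_norml; lra.
apply: (@le_trans _ _ (leb2 (A `|` (\bigcup_n (U n `&` Q n%:R)) `\` A))).
  apply: le_leb2 => //.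
    by apply: measurableU => //; exact: measurableD.
  by move=> z Uz; have [Az|nAz] := pselect (A z); [left|right].
apply: (le_trans (measureU2 leb2 _ _)) => //; first exact: measurableD.
apply: leeD => //.
apply: le_trans (epsilon_trick0 xpredT (ltW e0)).
apply: le_trans (_ : _ <= \sum_(n <oo) leb2 ((U n `\` A) `&` Q n%:R))%E _.
  apply: leb2_subadditive => //; first exact: measurableD.
  by move=> z [[n _ [Un Qn]] nA]; exists n.
by apply: lee_nneseries => // n _; have [] := UP n.
Qed.

End OuterRegularity.

(** * Periodization over the integer lattice *)

Section Periodization.
Context {R : realType}.

Definition plane_box : set (R * R) :=
  [set z | (-1 <= z.1 <= 2) && (0 <= z.2 <= 1)].

Lemma measurable_plane_box : measurable plane_box.
Proof.
apply: measurable_boolset; apply: measurable_and; apply: measurable_and;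
  exact: measurable_fun_ler.
Qed.

(* Indexing Z^2 by [pickle_inv] makes each lattice point occur exactly once. *)
Definition periodic_piece (U : set (R * R)) (n : nat) : set (R * R) :=
  if pickle_inv n is Some (a, b)
  then [set z | U (z.1 + (a : int)%:~R, z.2 + (b : int)%:~R)] else set0.

Definition periodization (U : set (R * R)) : set (R * R) :=
  \bigcup_n periodic_piece U n.

Lemma periodizationP U z : periodization U z <->
  exists a b : int, U (z.1 + a%:~R, z.2 + b%:~R).
Proof.
split=> [[n _]|[a [b Uab]]].
  by rewrite /periodic_piece; case: pickle_inv => // -[a b] ?; exists a, b.
by exists (pickle (a, b)); [exact: I|rewrite /periodic_piece pickleK_inv].
Qed.

Lemma periodization_add U z (a b : int) :
  periodization U (z.1 + a%:~R, z.2 + b%:~R) <-> periodization U z.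
Proof.
rewrite !periodizationP; split => -[c [d h]].
  by exists (a + c), (b + d); rewrite !intrD !addrA.
by exists (c - a), (d - b); rewrite !intrD !mulrNz /= -!addrA;
   rewrite !(addrC _%:~R (_ - _)) !subrK.
Qed.

Lemma sub_periodization U : U `<=` periodization U.
Proof. by move=> [x y] Uz; apply/periodizationP; exists 0, 0; rewrite !addr0. Qed.

Lemma open_periodic_piece U n : open U -> open (periodic_piece U n).
Proof.
rewrite /periodic_piece => oU; case: pickle_inv => [[a b]|]; last exact: open0.
rewrite -[X in open X]/((fun z : R * R => (z.1 + a%:~R, z.2 + b%:~R)) @^-1` U).
apply: (@open_preimage_lip _ _ 1) => // z z' e h1 h2 /=.
have E (x y c : R) : x + c - (y + c) = x - y by ring.
by rewrite mul1r !E.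
Qed.

Lemma open_periodization U : open U -> open (periodization U).
Proof. by move=> oU; apply: bigcup_open => n _; exact: open_periodic_piece. Qed.

Lemma measurable_periodic_piece U n : measurable U -> measurable (periodic_piece U n).
Proof.
rewrite /periodic_piece => mU; case: pickle_inv => [[a b]|] //.
have m : measurable_fun setT (fun z : R * R => (z.1 + a%:~R, z.2 + b%:~R)).
  by apply: measurable_fun_pair; exact: measurable_funD.
by have := m measurableT _ mU; rewrite setTI.
Qed.

Lemma sum_pred1_le (N m : nat) : (\sum_(n < N) (n == m :> nat) <= 1)%N.
Proof.
have [mN|Nm] := ltnP m N.
  rewrite (bigD1 (Ordinal mN))//= eqxx big1// => i im; apply/eqP.
  by rewrite eqb0; apply: contraNneq im => im; apply/eqP/val_inj.
rewrite big1// => i _; apply/eqP; rewrite eqb0; apply: contraTneq (ltn_ord i) => ->.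
by rewrite -leqNgt.
Qed.

(* 49 = 7 ^ 2: the image of the box lies within sup-distance 3 of the translation
   vector of the motion, and an interval of length 6 contains at most 7 integers. *)
Lemma lattice_count (q : motion) (u : R * R) N :
  \sum_(n < N) (if pickle_inv n is Some (a, b) then
     \1_plane_box (unmove (translate q (a : int)%:~R (b : int)%:~R) u) else 0) <= 49%:R :> R.
Proof.
have window (v : R) (a : int) : v - 3 <= a%:~R <= v + 3 ->
    exists i : 'I_7, a = Num.floor (v - 3) + i%:Z.
  move=> /andP[h1 h2]; have := Num.Theory.floor_itv (v - 3) => /andP[h3 h4].
  have ge0 : Num.floor (v - 3) <= a by rewrite -ltzD1 -(ltr_int R); lra.
  have lt7 : a < Num.floor (v - 3) + 7.
    rewrite -(ltr_int R) intrD; move: h4; rewrite intrD /= => h4.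
    by rewrite -[7%:~R]/(7%:R : R); lra.
  have [k kE] : exists k : nat, a - Num.floor (v - 3) = k%:Z.
    by exists `|a - Num.floor (v - 3)|%N; rewrite gez0_abs// subr_ge0.
  have k7 : (k < 7)%N by rewrite -ltz_nat -kE ltrBlDl.
  by exists (Ordinal k7); rewrite /= -kE addrC subrK.
pose a0 := Num.floor (u.1 - mx q - 3); pose b0 := Num.floor (u.2 - my q - 3).
pose idx (i j : 'I_7) : nat := pickle (a0 + i%:Z, b0 + j%:Z).
have bound n : (if pickle_inv n is Some (a, b) then
     \1_plane_box (unmove (translate q (a : int)%:~R (b : int)%:~R) u) else 0) <=
    \sum_(i < 7) \sum_(j < 7) ((n == idx i j)%N : nat)%:R :> R.
  case E : (pickle_inv n) => [[a b]|]; last first.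
    by apply: sumr_ge0 => i _; apply: sumr_ge0.
  rewrite indicE; have [|_] := boolP (_ \in _); last first.
    by apply: sumr_ge0 => i _; apply: sumr_ge0.
  rewrite inE; set q' := translate _ _ _; set z := unmove _ _.
  move=> /andP[z1 z2].
  have uE : u = move q' z by rewrite unmoveK.
  have [c1 s1] := (mc_le1 q, ms_le1 q).
  have prod (c x e : R) : `|c| <= 1 -> `|x| <= e -> - e <= c * x <= e.
    by move=> hc hx; rewrite -ler_norml normrM -[e]mul1r ler_pM.
  have Z1 : `|z.1| <= 2 by rewrite ler_norml; lra.
  have Z2 : `|if mb q then z.2 else - z.2| <= 1.
    by rewrite ler_norml; case: (mb q); lra.
  have := prod _ _ _ c1 Z1; have := prod _ _ _ s1 Z1.
  have := prod _ _ _ c1 Z2; have := prod _ _ _ s1 Z2.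
  move=> p1 p2 p3 p4.
  have u1 : u.1 = mx q + a%:~R + (mc q * z.1 - ms q * (if mb q then z.2 else - z.2)).
    by rewrite {1}uE.
  have u2 : u.2 = my q + b%:~R + (ms q * z.1 + mc q * (if mb q then z.2 else - z.2)).
    by rewrite {1}uE.
  have [|i iE] := window (u.1 - mx q) a.
    by rewrite u1; move: (a%:~R : R) p1 p2 p3 p4 => A *; lra.
  have [|j jE] := window (u.2 - my q) b.
    by rewrite u2; move: (b%:~R : R) p1 p2 p3 p4 => A *; lra.
  have nE : n = idx i j.
    by have := @pickle_invK (int * int)%type n; rewrite E /= /idx -iE -jE.
  rewrite (bigD1 i)//= (bigD1 j)//= -nE eqxx -addrA lerDl addr_ge0//.
    by apply: sumr_ge0.
  by apply: sumr_ge0 => k _; apply: sumr_ge0.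
apply: (@le_trans _ _ (\sum_(n < N) \sum_(i < 7) \sum_(j < 7)
    ((n == idx i j :> nat)%N : nat)%:R)).
  by apply: ler_sum => n _; exact: bound.
rewrite exchange_big/=; under eq_bigr do rewrite exchange_big/=.
apply: (@le_trans _ _ (\sum_(i < 7) \sum_(j < 7) 1)); last first.
  by rewrite !sumr_const !card_ord -mulrnA.
apply: ler_sum => i _; apply: ler_sum => j _.
by rewrite -natr_sum -[leRHS]/(1%:R) ler_nat; exact: sum_pred1_le.
Qed.

End Periodization.

Section PeriodizationMeasure.
Context {R : realType}.

Lemma nneseries_le (u : nat -> \bar R) (A : \bar R) : (forall n, 0 <= u n)%E ->
  (forall N, \sum_(n < N) u n <= A)%E -> (\sum_(n <oo) u n <= A)%E.
Proof.
move=> u0 uA; apply: lime_le; first exact: is_cvg_nneseries.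
by apply: nearW => N; rewrite big_mkord.
Qed.

Let weight (q : motion) n (u : R * R) : R :=
  if pickle_inv n is Some (a, b) then
     \1_plane_box (unmove (translate q (a : int)%:~R (b : int)%:~R) u) else 0.

Let weight_ge0 q n u : 0 <= weight q n u.
Proof. by rewrite /weight; case: pickle_inv => // -[a b]. Qed.

Let mweight q n : measurable_fun setT (weight q n).
Proof.
rewrite /weight; case: pickle_inv => [[a b]|]; last exact: measurable_cst.
apply: (@measurableT_comp _ _ _ _ _ _ (\1_plane_box : R * R -> R)).
  by apply: measurable_indic; exact: measurable_plane_box.
exact: measurable_unmove.
Qed.

(** Each piece is carried back to [U] by a translate of [q]. There a point [u] is counted once for
    every translate whose image of the box contains [u], and [lattice_count] bounds their number. *)
Lemma periodization_measure (q : motion) (U : set (R * R)) : measurable U ->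
  (leb2 (plane_box `&` (move q @^-1` periodization U)) <= 49%:E * leb2 U)%E.
Proof.
move=> mU.
have mpre (V : set (R * R)) : measurable V -> measurable (move q @^-1` V).
  by move=> mV; rewrite -[X in measurable X]setTI; exact: measurable_move.
have mbox := @measurable_plane_box R.
pose P n := plane_box `&` (move q @^-1` periodic_piece U n).
have mP n : measurable (P n).
  by apply: measurableI => //; apply: mpre; exact: measurable_periodic_piece.
have mper : measurable (periodization U).
  by apply: bigcupT_measurable => n; exact: measurable_periodic_piece.
have mindU : measurable_fun setT (\1_U : R * R -> R) by exact: measurable_indic.
have mW n : measurable_fun setT (fun u => (weight q n u * \1_U u)%:E).
  by apply/measurable_EFinP; apply: measurable_funM => //; exact: mweight.
have PE n : leb2 (P n) = (\int[leb2]_u (weight q n u * \1_U u)%:E)%E.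
  rewrite /P /weight /periodic_piece; case E : (pickle_inv n) => [[a b]|]; last first.
    by rewrite preimage_set0 setI0 measure0; under eq_integral do rewrite mul0r;
       rewrite integral0.
  set q' := translate q a%:~R b%:~R.
  have := mW n; rewrite /weight E -/q' => mW'.
  rewrite -(leb2_move q' mW'); last by move=> u; rewrite lee_fin mulr_ge0.
  rewrite -[X in leb2 X]setIT -integral_indic//; last first.
    by have := mP n; rewrite /P /periodic_piece E.
  apply: eq_integral => z _; congr EFin; rewrite moveK !indicE -natrM mulnb.
  congr (_%:R); congr nat_of_bool.
  have -> : move q' z = ((move q z).1 + a%:~R, (move q z).2 + b%:~R).
    by rewrite /q' /move /rigid/=; congr pair; rewrite addrAC.
  by rewrite in_setI; congr andb; apply/idP/idP; rewrite !inE.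
apply: (@le_trans _ _ (\sum_(n <oo) leb2 (P n))%E).
  apply: leb2_subadditive => //; first by apply: measurableI => //; exact: mpre.
  by move=> z [bz [n _ Pz]]; exists n.
under eq_eseriesr do rewrite PE.
rewrite -integral_nneseries//; last first.
  by move=> n u _; rewrite lee_fin mulr_ge0.
apply: (@le_trans _ _ (\int[leb2]_u (49%:E * (\1_U u : R)%:E))%E); last first.
  rewrite ge0_integralZl//; last exact/measurable_EFinP.
  by rewrite integral_indic// setIT.
apply: ge0_le_integral => //.
- by move=> u _; apply: nneseries_ge0 => n _ _; rewrite lee_fin mulr_ge0.
- apply: ge0_emeasurable_sum; first by move=> n u _ _; rewrite lee_fin mulr_ge0.
  by move=> n _; exact: mW.
- by apply: measurable_funeM; exact/measurable_EFinP.
move=> u _; apply: nneseries_le => [n|N]; first by rewrite lee_fin mulr_ge0.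
rewrite sumEFin -mulr_suml EFinM; apply: lee_wpmul2r => //.
by rewrite lee_fin; exact: lattice_count.
Qed.

End PeriodizationMeasure.

Section Envelope.
Context {R : realType}.

Lemma lsc_measurable_plane (f : R * R -> \bar R) :
  (forall t : R, open [set z | (t%:E < f z)%E]) -> measurable_fun setT f.
Proof.
move=> lsc; apply: (measurability _ (ErealGenOInfty.measurableE R)).
move=> /= _ [_ [a ->]] <-; apply: measurableI => //.
rewrite preimage_itvoy; apply: open_measurable_plane; exact: lsc.
Qed.

Lemma powRX (x p : R) k : 0 <= x -> (x ^+ k) `^ p = (x `^ p) ^+ k.
Proof.
move=> x0; rewrite -(powR_mulrn k x0) -(powR_mulrn k (powR_ge0 x p)).
by rewrite -!powRrM (mulrC p).
Qed.

Lemma geometric_le (r : R) N : 0 <= r < 1 -> \sum_(i < N) r ^+ i <= (1 - r)^-1.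
Proof.
move=> /andP[r0 r1]; rewrite -[leRHS]mul1r ler_pdivlMr ?subr_gt0//.
rewrite mulrC -[leLHS]opprK -mulNr opprB -subrX1 opprB lerBlDr lerDl.
exact: exprn_ge0.
Qed.

Lemma chebyshev_level (rho : R * R -> \bar R) (p t : R) : 0 < p -> 0 < t ->
  measurable_fun setT rho -> (forall z, 0 <= rho z)%E ->
  ((t `^ p)%:E * leb2 [set z | (t%:E < rho z)%E] <= \int[leb2]_z (rho z `^ p))%E.
Proof.
move=> p0 t0 mrho rho0.
have mE : measurable [set z | (t%:E < rho z)%E].
  by rewrite -[X in measurable X]setTI; exact: emeasurable_fun_o_infty.
rewrite -[X in leb2 X]setIT -integral_indic// -ge0_integralZl//; last 2 first.
- by apply/measurable_EFinP; exact: measurable_indic.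
- by rewrite lee_fin powR_ge0.
apply: ge0_le_integral => //.
- by move=> z _; rewrite mule_ge0// lee_fin// powR_ge0.
- by apply: measurable_funeM; apply/measurable_EFinP; exact: measurable_indic.
- by apply: (measurableT_comp (measurable_poweR p)).
move=> z _; rewrite indicE; have [|_] := boolP (z \in _); last first.
  by rewrite mule0 poweR_ge0.
rewrite inE/= mule1 -poweR_EFin => tz; apply: gt0_ler_poweR => //.
- exact: ltW.
- by rewrite in_itv/= lee_fin (ltW t0) leey.
- by rewrite in_itv/= rho0 leey.
- exact: ltW.
Qed.

Lemma lsc_envelope (p sg : R) : 3 < p -> 0 < sg -> sg < 1 - p^-1 ->
  exists2 K : R, 0 < K &
  forall (rho : R * R -> \bar R) (lam : R), 0 < lam ->
  measurable_fun setT rho -> (forall z, 0 <= rho z)%E ->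
  (\int[leb2]_z (rho z `^ p) <= (lam `^ p)%:E)%E ->
  exists rho1 : R * R -> \bar R,
  [/\ measurable_fun setT rho1, (forall z, 0 <= rho1 z)%E,
      forall t : R, open [set z | (t%:E < rho1 z)%E],
      Z2_periodic rho1 /\ small_on_box rho1 sg &
      forall z, (rho z <= (lam * K)%:E * rho1 z)%E].
Proof.
move=> p3 sg0 sgp.
have p0 : 0 < p by lra.
have pV : p * p^-1 = 1 by rewrite divff// gt_eqF.
have pV0 : 0 < p^-1 by rewrite invr_gt0.
(* [d] is the ratio of Chebyshev's bounds at consecutive dyadic levels. In [C1], [98 = 2 * 49]
   combines outer regularity with the lattice multiplicity, and the power of 2 pays for the index
   shift in [W]. *)
pose d : R := 2 `^ (- p); pose C1 : R := 98 * 2 `^ p.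
have d0 : 0 < d by exact: powR_gt0.
have d2 : d * 2 `^ p = 1.
  by rewrite /d -powRD ?addNr ?powRr0//; apply/implyP => _; rewrite pnatr_eq0.
have p2 : 2 <= 2 `^ p :> R.
  by rewrite -[leLHS]powRr1// ler_powR// ?ler1n//; lra.
have C10 : 0 < C1 by rewrite /C1; lra.
(* This is 2 to the power [1 - p * (1 - sg)]; it is less than 1 precisely because
   [sg < 1 - p^-1]. *)
pose r : R := 2 * d `^ (1 - sg).
have r01 : 0 <= r < 1.
  rewrite mulr_ge0 ?powR_ge0//= /r /d -powRrM -[X in X * _](@powRr1 _ 2)//.
  rewrite -powRD; last by apply/implyP => _; rewrite pnatr_eq0.
  rewrite /powR pnatr_eq0/= expR_lt1 pmulr_llt0 ?ln_gt0 ?ltr1n//.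
  have : p * (1 - sg) > p * p^-1 by rewrite ltr_pM2l//; lra.
  by rewrite pV; lra.
pose K : R := C1 `^ (1 - sg) / (1 - r).
have K0 : 0 < K.
  by rewrite divr_gt0// ?powR_gt0//; have /andP[_ ?] := r01; rewrite subr_gt0.
exists K => // rho lam lam0 mrho rho0 intrho.
pose E k : set (R * R) := [set z | ((lam * 2 ^+ k)%:E < rho z)%E].
have mE k : measurable (E k).
  by rewrite -[X in measurable X]setTI; exact: emeasurable_fun_o_infty.
have Ek k : (leb2 (E k) <= (d ^+ k)%:E)%E.
  have t0 : 0 < lam * 2 ^+ k by rewrite mulr_gt0// exprn_gt0.
  have := le_trans (chebyshev_level p0 t0 mrho rho0) intrho.
  rewrite powRM ?exprn_ge0 ?(ltW lam0)// powRX// => h.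
  have X0 : 0 < lam `^ p by exact: powR_gt0.
  have -> : leb2 (E k) =
      ((d ^+ k / lam `^ p)%:E * ((lam `^ p * (2 `^ p) ^+ k)%:E * leb2 (E k)))%E.
    rewrite muleA -EFinM (_ : _ * _ = 1) ?mul1e//.
    by rewrite mulrA divfK ?gt_eqF// -exprMn d2 expr1n.
  apply: (@le_trans _ _ ((d ^+ k / lam `^ p)%:E * (lam `^ p)%:E)%E).
    by apply: lee_wpmul2l => //; rewrite lee_fin divr_ge0 ?powR_ge0// exprn_ge0// ltW.
  by rewrite -EFinM divfK ?gt_eqF.
have dk k : 0 < d ^+ k by rewrite exprn_gt0.
have /choice[U UP] k : exists U : set (R * R),
    [/\ open U, E k `<=` U & (leb2 U <= (2 * d ^+ k)%:E)%E].
  have [U [oU EU Ule]] := leb2_regularity_outer (mE k) (dk k).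
  exists U; split => //; apply: le_trans Ule _.
  by rewrite (_ : 2 * d ^+ k = d ^+ k + d ^+ k) ?EFinD ?leeD//; ring.
(* The index shift bridges the gap between dyadic levels: where [rho] exceeds [lam * 2 ^+ k], the
   function [r0] below is already at least [2 ^+ k.+1]. *)
pose W k : set (R * R) := if k is i.+1 then periodization (U i) else setT.
have oW k : open (W k).
  case: k => [|k]; first exact: openT.
  by apply: open_periodization; have [] := UP k.
have mW k : measurable (W k) by exact: open_measurable_plane.
have mU k : measurable (U k) by apply: open_measurable_plane; have [] := UP k.
have mpre q (V : set (R * R)) : measurable V -> measurable (move q @^-1` V).
  by move=> mV; rewrite -[X in measurable X]setTI; exact: measurable_move.
have Wbox q k : (leb2 (plane_box `&` (move q @^-1` W k)) <= (C1 * d ^+ k)%:E)%E.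
  case: k => [|k].
    apply: (@le_trans _ _ ((2 - -1) * 1)%:E); last first.
      by rewrite lee_fin expr0 /C1; lra.
    apply: (strip_area (g := cst 0)) => //; first lra.
      apply: measurableI; first exact: measurable_plane_box.
      exact: mpre.
    move=> z [/andP[/andP[z1 z2] /andP[z3 z4]] _].
    by apply/and4P; rewrite subr0.
  apply: (le_trans (periodization_measure q (mU k))).
  have [_ _ Uk] := UP k.
  apply: (@le_trans _ _ (49%:E * (2 * d ^+ k)%:E)%E).
    by apply: lee_wpmul2l.
  rewrite -EFinM lee_fin exprS /C1 le_eqVlt; apply/orP; left; apply/eqP.
  have -> : 98 * 2 `^ p * (d * d ^+ k) = 98 * (d * 2 `^ p) * d ^+ k by ring.
  by rewrite d2; ring.
(* The mass of [r0] on [S] is summed over the levels [W k], interpolating between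
   the bounds [|S|] and [C1 * d ^+ k] for the area of [S `&` W k]. *)
pose r0 z : \bar R := ereal_sup [set (2 ^+ k)%:E | k in [set k | W k z]].
have le_r0 k z : W k z -> ((2 ^+ k)%:E <= r0 z)%E.
  by move=> Wk; apply: ereal_sup_ubound; exists k.
have r0_ge0 z : (0 <= r0 z)%E.
  by apply: (@le_trans _ _ (2 ^+ 0)%:E); [rewrite lee_fin|exact: (le_r0 0%N)].
have r0_lsc (t : R) : open [set z | (t%:E < r0 z)%E].
  rewrite (_ : mkset _ = \bigcup_(k in [set k | t < 2 ^+ k]) W k).
    by apply: bigcup_open => k _.
  apply/seteqP; split => z /=.
    by move=> /ereal_sup_gt[_ [k Wk <-]]; rewrite lte_fin => tk; exists k.
  by move=> [k /= tk Wk]; apply: lt_le_trans (le_r0 k z Wk); rewrite lte_fin.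
have mr0 := lsc_measurable_plane r0_lsc.
have KV0 : 0 < K^-1 by rewrite invr_gt0.
exists (fun z => (K^-1)%:E * r0 z)%E.
have m1 : measurable_fun setT (fun z => (K^-1)%:E * r0 z)%E by exact: measurable_funeM.
have pos z : (0 <= (K^-1)%:E * r0 z)%E by rewrite mule_ge0// lee_fin ltW.
split => //.
- move=> t; rewrite (_ : mkset _ = [set z | ((K * t)%:E < r0 z)%E]); first exact: r0_lsc.
  apply/seteqP; split => z /=; rewrite !ltNge; apply: contra => h.
    apply: (@le_trans _ _ ((K^-1)%:E * (K * t)%:E)%E).
      by apply: lee_wpmul2l => //; rewrite lee_fin ltW.
    by rewrite -EFinM mulKf ?gt_eqF.
  have -> : r0 z = (K%:E * ((K^-1)%:E * r0 z))%E.
    by rewrite muleA -EFinM divff ?gt_eqF// mul1e.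
  by rewrite [leRHS]EFinM; apply: lee_wpmul2l => //; rewrite lee_fin ltW.
- split=> [a b z|q S a mS Sbox a0 Sa].
    congr (_ * _)%E; congr ereal_sup; apply/seteqP.
    split => _ [k Wk <-]; exists k => //; move: k Wk => [|k] //=.
      by move/periodization_add.
    by move=> h; apply/periodization_add.
  pose A k := S `&` (move q @^-1` W k).
  have mA k : measurable (A k) by apply: measurableI => //; exact: mpre.
  have mindA k : measurable_fun setT (fun z => (\1_(A k) z : R)%:E).
    by apply/measurable_EFinP; exact: measurable_indic.
  have leA k : (leb2 (A k) <= (a `^ sg * (C1 * d ^+ k) `^ (1 - sg))%:E)%E.
    have h1 : (leb2 (A k) <= a%:E)%E by apply: le_trans Sa; apply: le_leb2 => // z [].
    have h2 : (leb2 (A k) <= (C1 * d ^+ k)%:E)%E.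
      apply: le_trans (Wbox q k); apply: le_leb2 => //.
        by apply: measurableI; [exact: measurable_plane_box|exact: mpre].
      by move=> z [/Sbox[z1 z2] ?]; split => //; rewrite /plane_box/= z1 z2.
    have fin : leb2 (A k) \is a fin_num.
      by rewrite ge0_fin_numE//; apply: le_lt_trans h1 _; rewrite ltry.
    move: h1 h2; rewrite -(fineK fin) !lee_fin; set x := fine _ => h1 h2.
    have x0 : 0 <= x by exact: fine_ge0.
    have -> : x = x `^ sg * x `^ (1 - sg).
      rewrite -powRD; first by rewrite addrC subrK powRr1.
      by apply/implyP; rewrite addrC subrK oner_eq0.
    rewrite ler_pM ?powR_ge0//.
      by apply: ge0_ler_powR => //; rewrite ?nnegrE//; exact: ltW.
    apply: ge0_ler_powR => //; rewrite ?nnegrE//; first lra.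
    by rewrite mulr_ge0 ?exprn_ge0// ltW.
  have bound z : (r0 z <= \sum_(k <oo) ((2 ^+ k)%:E * (\1_(W k) z : R)%:E))%E.
    apply: ge_ereal_sup => _ [k Wk <-].
    apply: le_trans (nneseries_lim_ge (m := 0%N) k.+1 _); last first.
      by move=> n _ _; rewrite mule_ge0// lee_fin.
    rewrite big_mkord big_ord_recr/= indicE mem_set// mule1 leeDr//.
    by apply: sume_ge0 => i _; rewrite mule_ge0// lee_fin.
  rewrite /gain.
  apply: (@le_trans _ _ (\int[leb2]_z ((K^-1)%:E *
      \sum_(k <oo) ((2 ^+ k)%:E * (\1_(A k) z : R)%:E)))%E).
    apply: ge0_le_integral => //.
    - by move=> z _; rewrite mule_ge0// lee_fin.
    - apply: emeasurable_funM.
        by apply/measurable_EFinP; exact: measurable_indic.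
      by apply: (measurableT_comp m1); exact: measurable_move.
    - apply: measurable_funeM; apply: ge0_emeasurable_sum.
        by move=> n u _ _; rewrite mule_ge0// lee_fin.
      by move=> n _; apply: measurable_funeM; exact: mindA.
    move=> z _; rewrite muleCA; apply: lee_wpmul2l; first by rewrite lee_fin ltW.
    have [Sz|nSz] := pselect (S z); last first.
      rewrite indicE memNset// mul0e; apply: nneseries_ge0 => n _ _.
      by rewrite mule_ge0// lee_fin.
    rewrite indicE mem_set// mul1e; apply: le_trans (bound _) _.
    apply: lee_nneseries => [n _ _|n _]; first by rewrite mule_ge0// lee_fin.
    apply: lee_wpmul2l; first by rewrite lee_fin.
    by rewrite lee_fin; apply: le_indic_imp => Wz; split.
  have serie0 z : (0 <= \sum_(k <oo) ((2 ^+ k)%:E * (\1_(A k) z : R)%:E))%E.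
    by apply: nneseries_ge0 => n _ _; rewrite mule_ge0// lee_fin.
  rewrite ge0_integralZl//; last 2 first.
  - apply: ge0_emeasurable_sum; first by move=> n u _ _; rewrite mule_ge0// lee_fin.
    by move=> n _; apply: measurable_funeM; exact: mindA.
  - by rewrite lee_fin ltW.
  rewrite integral_nneseries//; last by move=> n; apply: measurable_funeM; exact: mindA.
  apply: (@le_trans _ _ ((K^-1)%:E * (K * a `^ sg)%:E)%E); last first.
    by rewrite -EFinM mulKf ?gt_eqF.
  apply: lee_wpmul2l; first by rewrite lee_fin ltW.
  apply: nneseries_le => [n|N]; first by apply: integral_ge0 => z _; rewrite mule_ge0// lee_fin.
  apply: (@le_trans _ _ (\sum_(n < N) (a `^ sg * C1 `^ (1 - sg) * r ^+ n)%:E)%E).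
    apply: lee_sum => n _; rewrite ge0_integralZl//; last exact: mindA.
    apply: (@le_trans _ _ ((2 ^+ n)%:E * (a `^ sg * (C1 * d ^+ n) `^ (1 - sg))%:E)%E).
      apply: lee_wpmul2l; first by rewrite lee_fin.
      by move: (leA n); rewrite -[X in leb2 X]setIT -integral_indic//; exact: mA.
    rewrite -EFinM lee_fin powRM ?exprn_ge0 ?(ltW C10) ?(ltW d0)// powRX ?(ltW d0)//.
    by rewrite /r exprMn le_eqVlt; apply/orP; left; apply/eqP; ring.
  rewrite sumEFin lee_fin -mulr_sumr.
  have -> : K * a `^ sg = a `^ sg * C1 `^ (1 - sg) * (1 - r)^-1 by rewrite /K; ring.
  by rewrite ler_wpM2l ?mulr_ge0 ?powR_ge0// geometric_le.
(* If [rho] exceeded [lam * r0] at [z], induction would place [z] in every [W k], and [r0 z] would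
   be infinite. *)
move=> z; rewrite muleA -EFinM mulfK ?gt_eqF// leNgt; apply/negP => lt_rho.
have allW k : W k z.
  elim: k => [//|k Wk]; rewrite /W; apply: sub_periodization.
  have [_ + _] := UP k; apply; apply: le_lt_trans lt_rho.
  by rewrite EFinM; apply: lee_wpmul2l; [rewrite lee_fin ltW|exact: le_r0].
have r0y : r0 z = +oo%E.
  apply: eq_infty => t; apply: (@le_trans _ _ (2 ^+ (Num.truncn t).+1)%:E); last exact: le_r0.
  rewrite lee_fin ltW// (lt_trans (Num.Theory.truncnS_gt t))//.
  by rewrite -natrX ltr_nat ltn_expl.
by move: lt_rho; rewrite r0y gt0_muley ?lte_fin// ltNge leey.
Qed.

End Envelope.

(** * Line integrals along isometric copies of graphs *)

Section Isometry.
Context {R : realType}.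
Local Notation dist := (@Defs.edist R).

Lemma dist2 (x y : R * R) :
  dist x y ^+ 2 = (x.1 - y.1) ^+ 2 + (x.2 - y.2) ^+ 2.
Proof. by rewrite /Defs.edist sqr_sqrtr// addr_ge0// sqr_ge0. Qed.

Lemma dist_le (x y : R * R) : dist x y <= `|x.1 - y.1| + `|x.2 - y.2|.
Proof.
have n0 : 0 <= `|x.1 - y.1| + `|x.2 - y.2| by rewrite addr_ge0.
rewrite -(ger0_norm n0) -sqrtr_sqr ler_wsqrtr// [leRHS]sqrrD !real_normK ?num_real//.
by rewrite lerD2r lerDl mulrn_wge0// mulr_ge0.
Qed.

(* The images of the two unit vectors are orthonormal, and inner products with
   them recover the coordinates of [z]. *)
Lemma plane_isometry_motion (i : R * R -> R * R) : plane_isometry i ->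
  exists q : motion, i = move q.
Proof.
move=> isoi.
have iso2 x y : ((i x).1 - (i y).1) ^+ 2 + ((i x).2 - (i y).2) ^+ 2 =
    (x.1 - y.1) ^+ 2 + (x.2 - y.2) ^+ 2 by rewrite -!dist2 isoi.
move e0 : (i (0, 0)) => P; move e1 : (i (1, 0)) => U; move e2 : (i (0, 1)) => V.
pose c := U.1 - P.1; pose s := U.2 - P.2.
pose c' := V.1 - P.1; pose s' := V.2 - P.2.
have cs : c ^+ 2 + s ^+ 2 = 1.
  by have := iso2 (1, 0) (0, 0); rewrite e0 e1/= !subr0 expr1n expr0n addr0.
have cs' : c' ^+ 2 + s' ^+ 2 = 1.
  by have := iso2 (0, 1) (0, 0); rewrite e0 e2/= !subr0 expr1n expr0n add0r.
have ort : c * c' + s * s' = 0.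
  have := iso2 (1, 0) (0, 1); rewrite e1 e2/= => h; move: cs cs'; rewrite /c /s /c' /s'.
  by move=> ? ?; nra.
have coor z : c * ((i z).1 - P.1) + s * ((i z).2 - P.2) = z.1 /\
    c' * ((i z).1 - P.1) + s' * ((i z).2 - P.2) = z.2.
  have h0 := iso2 z (0, 0); have h1 := iso2 z (1, 0); have h2 := iso2 z (0, 1).
  move: h0 h1 h2; rewrite e0 e1 e2/= => h0 h1 h2.
  move: cs cs'; rewrite /c /s /c' /s' => ? ?.
  by split; nra.
pose k := c * s' - s * c'.
have k2 : k ^+ 2 = 1.
  transitivity ((c ^+ 2 + s ^+ 2) * (c' ^+ 2 + s' ^+ 2) - (c * c' + s * s') ^+ 2).
    by rewrite /k; ring.
  by rewrite cs cs' ort mulr1 expr0n subr0.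
have c'E : c' = - (k * s).
  transitivity (c' * (c ^+ 2 + s ^+ 2) - c * (c * c' + s * s')); last by rewrite /k; ring.
  by rewrite cs ort mulr1 mulr0 subr0.
have s'E : s' = k * c.
  transitivity (s' * (c ^+ 2 + s ^+ 2) - s * (c * c' + s * s')); last by rewrite /k; ring.
  by rewrite cs ort mulr1 mulr0 subr0.
exists (Motion P.1 P.2 (k == 1) cs); apply: funext => z.
have [h1 h2] := coor z.
have kz : (if k == 1 then z.2 else - z.2) = k * z.2.
  have /eqP := k2; rewrite sqrf_eq1; case: eqVneq => [->|_ /= /eqP ->].
    by rewrite mul1r.
  by rewrite mulN1r.
have h3 : k * z.2 = - s * ((i z).1 - P.1) + c * ((i z).2 - P.2).
  rewrite -h2 c'E s'E; transitivity (k ^+ 2 * (- s * ((i z).1 - P.1) + c * ((i z).2 - P.2))).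
    by ring.
  by rewrite k2 mul1r.
have e1' : (i z).1 = P.1 + (c * z.1 - s * (k * z.2)).
  rewrite h3 -h1; transitivity (P.1 + (c ^+ 2 + s ^+ 2) * ((i z).1 - P.1)); last by ring.
  by rewrite cs; ring.
have e2' : (i z).2 = P.2 + (s * z.1 + c * (k * z.2)).
  rewrite h3 -h1; transitivity (P.2 + (c ^+ 2 + s ^+ 2) * ((i z).2 - P.2)); last by ring.
  by rewrite cs; ring.
by rewrite [LHS]surjective_pairing e1' e2' /move /rigid/= kz.
Qed.

End Isometry.

(** * Hausdorff measure of Lipschitz images *)

Section HausdorffLength.
Context {R : realType}.
Local Notation mu := (@lebesgue_measure R).
Local Notation dist := (@Defs.edist R).
Implicit Types (phi : R -> R * R).

Lemma ediam_ge0 (E : set (R * R)) : (0 <= ediam E)%E.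
Proof. by apply: ereal_sup_ubound; right. Qed.

Lemma ediam_lip_le phi (C : R) (I : set R) : 0 <= C ->
  (forall x y, dist (phi x) (phi y) <= C * `|x - y|) -> is_interval I ->
  (ediam (phi @` I) <= C%:E * mu I)%E.
Proof.
move=> C0 lip itvI; apply: ge_ereal_sup => d [|->]; last by rewrite mule_ge0.
move=> [_ [x Ix <-] [_ [y Iy <-] <-]].
have key a b : I a -> I b -> a <= b -> (`|a - b|%:E <= mu I)%E.
  move=> Ia Ib ab; rewrite distrC ger0_norm ?subr_ge0//.
  have -> : (b - a)%:E = mu `[a, b] by rewrite lebesgue_measure_itv/= lte_fin lt_neqAle ab andbT; case: eqVneq => [->|_];
      rewrite -?EFinB ?subrr.
  apply: le_measure; rewrite ?inE//; first exact: is_interval_measurable.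
  by move=> z; rewrite /= in_itv/=; exact: itvI.
apply: (@le_trans _ _ (C%:E * `|x - y|%:E)%E); first by rewrite -EFinM lee_fin.
apply: lee_wpmul2l => //; have [|/ltW] := leP x y; first exact: key.
by rewrite distrC; exact: key.
Qed.

Lemma open_itv_cover_le (E : set R) (e : R) : 0 < e -> (mu E < +oo)%E ->
  exists F : nat -> set R, [/\ forall k, is_interval (F k), E `<=` \bigcup_k F k &
    (\sum_(k <oo) mu (F k) <= mu E + e%:E)%E].
Proof.
move=> e0 Efin.
have fin : mu E \is a fin_num by rewrite ge0_fin_numE.
have muE : mu E = ereal_inf [set (\sum_(k <oo) (@wlength R idfun) (F k))%E | F in open_itv_cover E].
  exact: outer_measure_open_itv_cover.
move: fin; rewrite [in X in X -> _]muE => /lb_ereal_inf_adherent-/(_ _ e0)[_/= [F]] [Fitv EF] <-.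
rewrite -muE => Fe; exists F; split => //.
  by move=> k; have [ab ->] := Fitv k; exact: interval_is_interval.
apply: le_trans (ltW Fe); apply: lee_nneseries => // k _.
by have [[a b] ->] := Fitv k; rewrite wlength_itv/= -(@lebesgue_measure_itv R `]a, b[).
Qed.

Let cell (d : R) (m : nat) : set R := `[m%:R * d, m.+1%:R * d[%classic.

Let mcell d m : measurable (cell d m). Proof. exact: measurable_itv. Qed.

Let trivIset_cell (d : R) : 0 < d -> trivIset setT (cell d).
Proof.
move=> d0; apply/trivIsetP => m n _ _ mn; apply/seteqP; split => // x [].
rewrite /cell/= !in_itv/= => /andP[a b] /andP[c e].
have : m%:R * d < n.+1%:R * d by exact: le_lt_trans e.
have : n%:R * d < m.+1%:R * d by exact: le_lt_trans b.
by rewrite !ltr_pM2r// !ltr_nat !ltnS => nm mn'; move: mn; rewrite eqn_leq nm mn'.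
Qed.

Let cover_cell (d x : R) : 0 < d -> 0 <= x -> exists m, cell d m x.
Proof.
move=> d0 x0; have xd : 0 <= x / d by rewrite divr_ge0// ltW.
exists (Num.truncn (x / d)); rewrite /cell/= in_itv/=.
by rewrite -ler_pdivlMr// -ltr_pdivrMr//; apply: truncn_itv.
Qed.

(** A nearly optimal cover of [E] by intervals is cut along a grid of mesh [dl / C]. The images of
    the pieces have diameter at most [dl], and the total length does not grow because the pieces of
    one interval are disjoint. *)
Lemma hausdorff1_lip_le phi (C : R) (E : set R) : 0 < C ->
  (forall x y, dist (phi x) (phi y) <= C * `|x - y|) ->
  (forall x, E x -> 0 <= x) -> (hausdorff1 (phi @` E) <= C%:E * mu E)%E.
Proof.
move=> C0 lip E0.
have [Efin|] := ltP (mu E) +oo%E; last first.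
  by rewrite leye_eq => /eqP ->; rewrite gt0_muley ?lte_fin// leey.
apply: ge_ereal_sup => _ [dl /= dl0 <-].
apply/lee_addgt0Pr => e e0.
have eC : 0 < e / C by rewrite divr_gt0.
have [F [Fitv EF Fle]] := open_itv_cover_le eC Efin.
pose d := dl / C; have d0 : 0 < d by rewrite divr_gt0.
pose G k m := F k `&` cell d m.
have itvG k m : is_interval (G k m).
  move=> x y [Fx cx] [Fy cy] z xyz; split; first exact: Fitv Fx Fy z xyz.
  exact: interval_is_interval cx cy z xyz.
have mF k : measurable (F k) by exact: is_interval_measurable.
have mG k m : measurable (G k m) by exact: is_interval_measurable.
have smallG k m : (mu (G k m) <= d%:E)%E.
  apply: (@le_trans _ _ (mu (cell d m))).
    by apply: le_measure; [rewrite inE; exact: mG|rewrite inE; exact: mcell|move=> z []].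
  rewrite /cell lebesgue_measure_itv/= lte_fin; case: ifP => _.
    by rewrite -EFinB lee_fin -mulrBl -natr1 addrAC subrr add0r mul1r.
  by rewrite lee_fin ltW.
have diamG k m : (ediam (phi @` G k m) <= C%:E * mu (G k m))%E.
  by apply: ediam_lip_le => //; exact: ltW.
have /card_esym/ppcard_eqP[f] := card_nat2.
have le_sum : (\sum_(n <oo) mu (uncurry G (f n)) <= mu E + (e / C)%:E)%E.
  apply: le_trans Fle.
  rewrite nneseries_esumT; last by move=> n; case: (f n).
  rewrite -(@reindex_esum _ _ _ setT setT f (fun i => mu (uncurry G i))); last exact: 'bij_f.
  have -> : [set: nat * nat] = [set: nat] `*`` (fun=> [set: nat]).
    by apply/seteqP; split.
  rewrite (eq_esum (b := fun i => mu (G i.1 i.2))); last by move=> [].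
  rewrite -(esum_esum (a := fun k m => mu (G k m)))//.
  rewrite -nneseries_esumT//; last by move=> k; exact: esum_ge0.
  apply: lee_nneseries => [k _ _|k _]; first exact: esum_ge0.
  rewrite -nneseries_esumT// -measure_semi_bigcup//; last 3 first.
  - exact: mG.
  - apply/trivIsetP => m n _ _ mn; have /trivIsetP/(_ m n) := trivIset_cell d0.
    by move=> /(_ I I mn) h; rewrite setIACA h setI0.
  - by apply: bigcupT_measurable => m; exact: mG.
  apply: le_measure; [rewrite inE; apply: bigcupT_measurable => m; exact: mG|rewrite inE; exact: mF|].
  by move=> z [m _ []].
apply: (@le_trans _ _ (\sum_(n <oo) ediam (phi @` uncurry G (f n)))%E).
  apply: ereal_inf_lbound; exists (fun n => phi @` uncurry G (f n)) => //; split.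
    move=> _ [x Ex <-]; have [k _ Fx] := EF _ Ex.
    have [m cx] := cover_cell d0 (E0 _ Ex).
    by exists (f^-1%FUN (k, m)) => //; exists x => //; rewrite invK ?inE.
  move=> n; case: (f n) => k m; apply: (le_trans (diamG k m)).
  apply: (@le_trans _ _ (C%:E * d%:E)%E).
    by apply: lee_wpmul2l => //; rewrite lee_fin ltW.
  by rewrite -EFinM lee_fin mulrC divfK// gt_eqF.
apply: (@le_trans _ _ (C%:E * (mu E + (e / C)%:E))%E); last first.
  rewrite ge0_muleDr//; last by rewrite lee_fin ltW.
  by rewrite -EFinM mulrC divfK// gt_eqF.
apply: le_trans (lee_wpmul2l _ le_sum); last by rewrite lee_fin ltW.
rewrite -nneseriesZl//.
apply: lee_nneseries => // [n _ _|n _].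
  exact: ediam_ge0.
by case: (f n) => k m; exact: diamG.
Qed.

End HausdorffLength.

Section LineIntegral.
Context {R : realType}.
Local Notation mu := (@lebesgue_measure R).
Local Notation dist := (@Defs.edist R).

(** The integral of a nonnegative function is a supremum over simple functions below it. The lemma
    serves to compare the function [t |-> hausdorff1 (...)] in the line integral with a measurable
    one. *)
Lemma ge0_le_integral_nonmeasurable (D : set R) (f g : R -> \bar R) :
  (forall x, D x -> 0 <= f x)%E -> (forall x, D x -> f x <= g x)%E ->
  (\int[mu]_(x in D) f x <= \int[mu]_(x in D) g x)%E.
Proof.
move=> f0 fg; have g0 x : D x -> (0 <= g x)%E.
  by move=> Dx; apply: le_trans (f0 x Dx) (fg x Dx).
rewrite !ge0_integralE//; apply: ereal_sup_le => _ /= [h hf <-].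
exists h => // x; apply: le_trans (hf x) _; rewrite !patchE.
by case: ifPn => //; rewrite inE; exact: fg.
Qed.

(** Tonelli on the region of the pairs [(t, x)] with [0 <= t < u x]. *)
Lemma layer_cake (u : R -> \bar R) : measurable_fun setT u -> (forall x, 0 <= u x)%E ->
  (\int[mu]_(t in [set t : R | (0 <= t)%R]) mu [set x | (t%:E < u x)%E] = \int[mu]_x u x)%E.
Proof.
move=> mu_ u0.
pose S : set (R * R) := [set z | (0 <= z.1%:E)%E] `&` [set z | (z.1%:E < u z.2)%E].
pose F z : \bar R := (\1_S z : R)%:E.
have m1 : measurable_fun [set: R * R] (fun z => z.1%:E) by apply/measurable_EFinP.
have m2 : measurable_fun [set: R * R] (fun z => u z.2) by exact: measurableT_comp.
have mF : measurable_fun setT F.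
  apply/measurable_EFinP; apply: measurable_indic; apply: measurableI.
    by rewrite -[X in measurable X]setTI; apply: measurable_lee.
  by rewrite -[X in measurable X]setTI; exact: measurable_lte.
have F0 z : (0 <= F z)%E by rewrite lee_fin.
transitivity (\int[mu]_t \int[mu]_x F (t, x))%E.
  rewrite integral_mkcond; apply: eq_integral => t _; rewrite patchE.
  case: ifPn => [|]; rewrite ?notin_setE ?inE /= => t0; last first.
    by rewrite integral0_eq// => x _; rewrite /F indicE memNset//= /S/= lee_fin => -[].
  have mE : measurable [set x | (t%:E < u x)%E].
    by rewrite -[X in measurable X]setTI; exact: emeasurable_fun_o_infty.
  rewrite -[X in mu X]setIT -integral_indic//; apply: eq_integral => x _.
  rewrite /F !indicE; congr (_ %:R%:E); congr nat_of_bool.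
  by apply/idP/idP; rewrite !inE /S/= lee_fin; [split|case].
rewrite fubini_tonelli//; apply: eq_integral => x _.
case ux : (u x) => [r| |]; last by have := u0 x; rewrite ux.
- have r0 : 0 <= r by rewrite -lee_fin -ux.
  have -> : (fun t => F (t, x)) = (fun t => (\1_(`[0%R, r[ : set R) t : R)%:E).
    apply: funext => t; rewrite /F !indicE; congr (_ %:R%:E); congr nat_of_bool.
    by apply/idP/idP; rewrite !inE /S/= in_itv/= ux lee_fin lte_fin; [move=> /= []-> ->|move/andP].
  rewrite integral_indic// setIT -[LHS]/(mu _) lebesgue_measure_itv/= lte_fin.
  by move: r0; rewrite le_eqVlt => /orP[/eqP <-|->]; rewrite ?ltxx// oppr0 adde0.
have -> : (fun t => F (t, x)) = (fun t => (\1_(`[0%R, +oo[ : set R) t : R)%:E).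
  apply: funext => t; rewrite /F !indicE; congr (_ %:R%:E); congr nat_of_bool.
  by apply/idP/idP; rewrite !inE /S/= in_itv/= andbT ux lee_fin ltry; [case|].
by rewrite integral_indic// setIT -[LHS]/(mu _) lebesgue_measure_itv/= ltry.
Qed.

Lemma continuous_lip (phi : R -> R * R) (C : R) : 0 < C ->
  (forall x y, dist (phi x) (phi y) <= C * `|x - y|) -> continuous phi.
Proof.
move=> C0 lip x; apply/cvg_ballP => e e0.
apply/nbhs_ballP; exists (e / C); first by rewrite /= divr_gt0.
move=> y /= xy; have h : dist (phi x) (phi y) < e.
  by apply: le_lt_trans (lip x y) _; rewrite mulrC -ltr_pdivlMr.
split; apply: le_lt_trans h; rewrite /Defs.edist -sqrtr_sqr ler_wsqrtr//.
  by rewrite lerDl sqr_ge0.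
by rewrite lerDr sqr_ge0.
Qed.

Lemma loc_rect_curve_lip (phi : R -> R * R) (C : R) : 0 < C ->
  (forall x y, dist (phi x) (phi y) <= C * `|x - y|) ->
  loc_rect_curve (phi @` [set x | 0 <= x <= 1]).
Proof.
move=> C0 lip; exists [set x | 0 <= x <= 1], phi; split; [|split; [|split; [|split => //]]].
- move=> x y /= /andP[x0 x1] /andP[y0 y1] z /andP[xz zy].
  by rewrite (le_trans x0 xz) (le_trans zy y1).
- by exists 0; rewrite /= lexx ler01.
- by apply: continuous_subspaceT; exact: continuous_lip lip.
move=> a b _ _ ab; exists (C * (b - a)) => s abs.
(* [b - a] is the variation of the identity along the partition, which is compared with the polygon
   step by step. *)
rewrite -(@nondecreasing_variation _ a b id s)// /polygon_length /variation.
by rewrite mulr_sumr; apply: ler_sum => n _; exact: lip.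
Qed.

End LineIntegral.

Section LineIntegralBound.
Context {R : realType}.
Local Notation mu := (@lebesgue_measure R).
Local Notation dist := (@Defs.edist R).

Lemma hausdorff1_ge0 (A : set (R * R)) : (0 <= hausdorff1 A)%E.
Proof.
apply: (@le_trans _ _ (hausdorff1_delta 1 A)); last by apply: ereal_sup_ubound; exists 1 => /=.
apply: le_ereal_inf_tmp => _ [E _ <-]; apply: nneseries_ge0 => n _ _; exact: ediam_ge0.
Qed.

Lemma hausdorff1_le (A B : set (R * R)) : A `<=` B -> (hausdorff1 A <= hausdorff1 B)%E.
Proof.
move=> AB; apply: ge_ereal_sup => _ [d d0 <-].
apply: (@le_trans _ _ (hausdorff1_delta d B)); last by apply: ereal_sup_ubound; exists d.
apply: ereal_inf_le_tmp => _ [E [BE dE] <-]; exists E => //; split => //.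
exact: subset_trans AB BE.
Qed.

(** At each level [t >= 0], the part of the curve where [rho] exceeds [t] lies in the image of the
    superlevel set of [u], so its length is at most [C] times the measure of that set; [layer_cake]
    then reassembles the levels. *)
Lemma hline_integral_lip_le (phi : R -> R * R) (C : R) (rho r : R * R -> \bar R) :
  0 < C -> (forall x y, dist (phi x) (phi y) <= C * `|x - y|) ->
  (forall z, 0 <= r z)%E -> (forall z, rho z <= r z)%E ->
  measurable_fun setT (r \o phi) ->
  (hline_integral (phi @` [set x | (0 <= x <= 1)%R]) rho <=
   C%:E * \int[mu]_x ((\1_(`[0%R, 1%R] : set R) x : R)%:E * r (phi x)))%E.
Proof.
move=> C0 lip r0 rhor mr.
pose u x : \bar R := ((\1_(`[0%R, 1%R] : set R) x : R)%:E * r (phi x))%E.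
have mu_ : measurable_fun setT u.
  by apply: emeasurable_funM => //; apply/measurable_EFinP; exact: measurable_indic.
have u0 x : (0 <= u x)%E by rewrite mule_ge0// lee_fin.
pose S : set (R * R) := [set z | (z.1%:E < u z.2)%E].
have mS : measurable S.
  rewrite -[X in measurable X]setTI; apply: measurable_lte => //.
    by apply/measurable_EFinP.
  exact: measurableT_comp.
have mtail : measurable_fun setT (fun t : R => mu [set x | (t%:E < u x)%E]).
  rewrite (_ : (fun t => _) = mu \o xsection S); first exact: measurable_fun_xsection.
  by apply/funext => t /=; congr (mu _); apply/seteqP; split => x; rewrite /xsection/= inE.
have mD : measurable [set t : R | 0 <= t] by rewrite -set_itvcy; exact: measurable_itv.
rewrite -[X in (_ <= _ * X)%E](layer_cake mu_ u0) -ge0_integralZl//; last 2 first.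
- exact: measurable_funTS.
- by rewrite lee_fin ltW.
apply: ge0_le_integral_nonmeasurable => [t _|t /= t0]; first exact: hausdorff1_ge0.
apply: (@le_trans _ _ (hausdorff1 (phi @` [set x | (t%:E < u x)%E]))).
  apply: hausdorff1_le => _ [[x /= x01 <-] tx]; exists x => //=.
  rewrite /u indicE mem_set ?mul1e; first exact: lt_le_trans tx (rhor _).
  by rewrite /= in_itv.
apply: hausdorff1_lip_le => // x /=; rewrite /u indicE; have [|_] := boolP (x \in _).
  by rewrite inE/= in_itv => /andP[].
by rewrite mul0e lte_fin ltNge t0.
Qed.

End LineIntegralBound.

Theorem theorem1p1 (R : realType) (p : R) (hp : 3 < p) :
  exists c : R, 0 < c /\
    forall Gamma : set (set (R * R)),
      (forall f : R -> R, lip1_unit f ->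
         exists i : R * R -> R * R, plane_isometry i /\ Gamma (i @` graph01 f)) ->
      (c%:E <= p_modulus p Gamma)%E.
Proof.
have pV : p^-1 < 3^-1 by rewrite ltf_pV2// posrE; lra.
(* The midpoint of the interval from [2 / 3] to [1 - p^-1], which is nonempty because [p > 3]. *)
pose sg : R := (2 / 3 + (1 - p^-1)) / 2.
have pV0 : 0 < p^-1 by rewrite invr_gt0; lra.
have sg_gt : 2 / 3 < sg by rewrite /sg; move: (p^-1) pV => v; lra.
have sg_lt : sg < 1 - p^-1 by rewrite /sg; move: (p^-1) pV => v; lra.
have sg01 : 2 / 3 < sg <= 1 by rewrite sg_gt/= ltW// (lt_trans sg_lt)// ltrBlDr ltrDl.
have [A A0 seqA] := graph_sequence sg01.
have sg0 : 0 < sg by apply: lt_trans sg_gt; rewrite divr_gt0.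
have [K K0 env] := lsc_envelope hp sg0 sg_lt.
(* The line integral will be at most [2 * lam * K * A], where 2 is a Lipschitz constant of the
   parametrization; the factor 4 makes this bound [1 / 2]. *)
pose lam : R := (4 * K * A)^-1.
have lam0 : 0 < lam by rewrite invr_gt0 !mulr_gt0.
exists (lam `^ p); split; first exact: powR_gt0.
move=> Gamma hG; apply: le_ereal_inf_tmp => _ [rho [rho0 [mrho adm]] <-].
rewrite leNgt; apply/negP => /ltW small.
have [r [mr r0 lsc [per box] rhor]] := env rho lam lam0 mrho rho0 small.
have [f fP] := seqA r mr r0 per box.
have [g [glip g01 gA]] := limit_graph mr r0 lsc fP.
have [|i [isoi Gi]] := hG g; first by split.
have [q iq] := plane_isometry_motion isoi.
pose phi x := i (x, g x).
have imE : i @` graph01 g = phi @` [set x | 0 <= x <= 1].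
  by rewrite /graph01 image_comp.
have lip x y : Defs.edist (phi x) (phi y) <= 2 * `|x - y|.
  rewrite /phi isoi; apply: le_trans (dist_le _ _) _ => /=.
  by rewrite mulr_natl mulr2n lerD2l.
have := adm _ Gi; rewrite imE => /(_ (loc_rect_curve_lip (ltr0Sn _ 1) lip)).
pose r' z := ((lam * K)%:E * r z)%E.
have lK0 : 0 <= lam * K by rewrite ltW// mulr_gt0.
have mg : measurable_fun setT g by apply: (@measurable_lip _ 1) => x y; rewrite mul1r.
have mphi : measurable_fun setT phi.
  rewrite /phi iq; apply: (measurableT_comp (measurable_move q)).
  exact: measurable_fun_pair.
have mrphi : measurable_fun setT (r \o phi) by exact: measurableT_comp.
have r'0 z : (0 <= r' z)%E by rewrite mule_ge0// lee_fin.
have mr'phi : measurable_fun setT (r' \o phi) by exact: measurable_funeM.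
have h := hline_integral_lip_le (ltr0Sn _ 1) lip r'0 rhor mr'phi.
apply/negP; rewrite -ltNge; apply: le_lt_trans h _.
under eq_integral => x _ do rewrite /r' muleCA.
rewrite ge0_integralZl//; last 2 first.
- apply: emeasurable_funM => //; apply/measurable_EFinP; exact: measurable_indic.
- by move=> x _; rewrite mule_ge0// lee_fin.
apply: (@le_lt_trans _ _ (2%:E * ((lam * K)%:E * A%:E))%E).
  apply: lee_wpmul2l => //; apply: lee_wpmul2l; first by rewrite lee_fin.
  by have := gA q; rewrite /phi iq.
rewrite -!EFinM lte_fin.
have -> : 2 * (lam * K * A) = 2^-1.
  by rewrite /lam; field; rewrite !gt_eqF.
by rewrite invf_lt1 ?ltr1n.
Qed.
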